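(* Let $a\in\mathbb{R}$, $\lambda\in[0,1)$, and let $f=h+\overline{g}$, where $h,g$ are analytic in $\mathbb{D}$ with $h(0)=g(0)=0$, $h-g=k_a$ and $g'/h'=\lambda z$ in $\mathbb{D}$. For $0<r<1$ let $\mathcal{A}(f(\mathbb{D}_r))$ denote the area of $f(\mathbb{D}_r)$, $\mathbb{D}_r=\{|z|<r\}$. Then $$2\pi\int_0^r\frac{(\rho-\lambda^2\rho^3)(1-\rho)^{2(a-1)}}{(1+\lambda\rho)^2(1+\rho)^{2(a+1)}}\,d\rho\le\mathcal{A}(f(\mathbb{D}_r))\le2\pi\int_0^r\frac{(\rho-\lambda^2\rho^3)(1+\rho)^{2(a-1)}}{(1-\lambda\rho)^2(1-\rho)^{2(a+1)}}\,d\rho\quad\text{if } a\ge1,$$ $$2\pi\int_0^r\frac{\rho-\lambda^2\rho^3}{(1+\lambda\rho)^2(1+\rho)^{4}}\,d\rho\le\mathcal{A}(f(\mathbb{D}_r))\le2\pi\int_0^r\frac{\rho-\lambda^2\rho^3}{(1-\lambda\rho)^2(1-\rho)^{4}}\,d\rho\quad\text{if } -1<a<1,$$ $$2\pi\int_0^r\frac{(\rho-\lambda^2\rho^3)(1+\rho)^{2(a-1)}}{(1+\lambda\rho)^2(1-\rho)^{2(a+1)}}\,d\rho\le\mathcal{A}(f(\mathbb{D}_r))\le2\pi\int_0^r\frac{(\rho-\lambda^2\rho^3)(1-\rho)^{2(a-1)}}{(1-\lambda\rho)^2(1+\rho)^{2(a+1)}}\,d\rho\quad\text{if } a\le-1.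$$
   Context: $\mathbb{D}$ is the open unit disk. For $a\neq0$, $k_a(z)=\frac{1}{2a}\left[\left(\frac{1+z}{1-z}\right)^a-1\right]$ (principal branch), and $k_0(z)=\frac12\log\frac{1+z}{1-z}$. *)

(* Defs.v *)
From HB Require Import structures.
From mathcomp Require Import all_boot all_order all_algebra.
From mathcomp Require Import all_classical all_reals all_analysis.
From mathcomp Require Import complex.
Set Implicit Arguments. Unset Strict Implicit. Unset Printing Implicit Defensive.
Import Order.TTheory GRing.Theory Num.Theory.
Import numFieldNormedType.Exports.
Local Open Scope ring_scope.
Local Open Scope complex_scope.

Section Defs.
Variable R : realType.

Definition cexp (z : R[i]) : R[i] :=
  (expR (complex.Re z) * cos (complex.Im z)) +i* (expR (complex.Re z) * sin (complex.Im z)).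

(* principal argument, with values in (-pi, pi] *)
Definition Arg (w : R[i]) : R :=
  let x := complex.Re w in let y := complex.Im w in
  if 0 < x then atan (y / x)
  else if x < 0 then (if 0 <= y then atan (y / x) + pi else atan (y / x) - pi)
  else if 0 < y then pi / 2 else if y < 0 then - (pi / 2) else 0.

(* principal logarithm (for w <> 0) *)
Definition Log (w : R[i]) : R[i] :=
  (ln (Num.sqrt (complex.Re w ^+ 2 + complex.Im w ^+ 2))) +i* (Arg w).

(* principal power w^a, a real, w <> 0 *)
Definition cpow (w : R[i]) (a : R) : R[i] := cexp ((a%:C)%C * Log w).

Definition k (a : R) (z : R[i]) : R[i] :=
  let w := (1 + z) / (1 - z) in
  if a == 0 then (1 / 2%:R) * Log w
  else (cpow w a - 1) / (2%:R * (a%:C)%C).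

Definition disk (r : R) : set R[i] :=
  [set z | complex.Re z ^+ 2 + complex.Im z ^+ 2 < r ^+ 2].

(* analytic (holomorphic) on an open set D : complex differentiable at each point *)
Definition analytic_on (D : set R[i]) (h : R[i] -> R[i]) : Prop :=
  forall z, D z -> derivable (h : (R[i])^o -> (R[i])^o) z 1.

Definition cderiv (h : R[i] -> R[i]) (z : R[i]) : R[i] :=
  derive1 (h : (R[i])^o -> (R[i])^o) z.

Definition area (A : set R[i]) : \bar R :=
  ((@lebesgue_measure R) \x (@lebesgue_measure R))%E
    [set p | exists2 z, A z & p = (complex.Re z, complex.Im z)].
End Defs.

(* Main.v *)
Require Import Defs.
From HB Require Import structures.
From mathcomp Require Import all_boot all_order all_algebra.
From mathcomp Require Import all_classical all_reals all_analysis.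
From mathcomp Require Import complex.
From mathcomp Require Import measurable_realfun.
From mathcomp Require Import ring lra.
Set Implicit Arguments. Unset Strict Implicit. Unset Printing Implicit Defensive.
Import Order.TTheory GRing.Theory Num.Theory.
Import numFieldNormedType.Exports.
Local Open Scope ring_scope.
Local Open Scope classical_set_scope.

(** Since [h - g = k_a], the map [f = h + conj g] has [Im f = Im k_a] and
Jacobian [|k_a'|^2 (1 - lam^2 |z|^2) / |1 - lam z|^2], where
[|k_a'|^2 = |1 + z|^(2(a-1)) / |1 - z|^(2(a+1))]; on the circle [|z| = rho]
this is squeezed between the two integrands divided by [rho].

The change of variables in the plane is replaced by two one-sided estimates
for a map [F] that is merely differentiable at every point of a square:
[|F(Q)| <= int |J|], and [|F(Q)| >= int |J|] if [F] is injective inside [Q].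
Both follow by quartering [Q] (Cousin's lemma) from the behaviour of [F] at a
point. They are applied to [f] in polar coordinates.

The upper bound needs no injectivity. For the lower bound, [f] is injective
where [|a arg ((1+z)/(1-z))| < pi], because [Re f] is strictly monotone along
the curves [Im k_a = const]. This region contains the whole disk if
[|a| <= 2], and the disk of radius [1/|a|] if [|a| > 2]. For [|a| > 2] and
[r > 1/|a|], where [f] may fail to be injective on the disk, the image of the
sector of radius [1/|a|] and opening [2 pi / 3] on which [|k_a'|] is largest
already has a larger area than the lower bound for [r = 1]. *)

(** * Lebesgue measure of linear images *)

(** The integrands depend on [rho] alone, so no integral over the plane is formed: with [N] a
    primitive of the bound [K], the integral of [K] over a square of side [s] is
    [s * (N (x + s) - N x)], which is additive under quartering. Derivatives of [k_a] are computed
    in the coordinate [w = s + i t = log ((1 + z) / (1 - z))] on the strip [|t| < pi / 2], where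
    [k_a] is [(exp (a w) - 1) / (2 a)]; no principal branch is ever differentiated. There the level
    curves of [Im k_a] are [exp (a s) sin (a t) = const], and each is one connected curve as long as
    [|a t| < pi]: this is the origin of the condition on the argument. The radius [1 / |a|] comes
    from [|t| <= 2 atan |z| <= 2 |z|] and [2 < pi]. For [|a| > 2] the lower bound for [r = 1] is at
    most [pi / (2 (4 a^2 - 1))], while the sector contributes at least [4 pi / (25 a^2)]: both decay
    like [a^-2], and the constants leave room. *)

Section LinearImages.
Variable R : realType.
Local Notation mu := (@lebesgue_measure R).
Local Notation RR := (measurableTypeR R * measurableTypeR R)%type.
Local Notation mu2 := ((mu \x mu)%E : set RR -> \bar R).

Lemma measurable_affine (al be : R) :
  measurable_fun [set: measurableTypeR R]
    (fun x : measurableTypeR R => (al * x + be : measurableTypeR R)).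
Proof.
apply: measurable_funD; last exact: measurable_cst.
exact: (@measurable_funM _ _ R setT (cst al) id).
Qed.

(** Lebesgue measure is determined by its values on half-open intervals, where the pushforward under
    the affine map, scaled by [|al|], agrees with it. For [al < 0] the preimage is half-open on the
    other side, with the same length. *)
Lemma lebesgue_measure_affine (al be : R) (A : set (measurableTypeR R)) :
  al != 0 -> measurable A ->
  mu ((fun x => al * x + be) @^-1` A) = ((`|al|^-1)%:E * mu A)%E.
Proof.
move=> al0 mA.
pose f : measurableTypeR R -> measurableTypeR R := fun x => al * x + be.
have mf : measurable_fun setT f by exact: measurable_affine.
pose pf := (pushforward mu f : {measure set (measurableTypeR R) -> \bar R}).
pose m' : {measure set (measurableTypeR R) -> \bar R} :=
  mscale (NngNum (normr_ge0 al)) (pf mf).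
have e : mu A = m' A.
  apply: lebesgue_measure_unique mA => _ [[a b] /= _ <-].
  rewrite /m' /mscale /= /pushforward.
  have [alp|aln|al00] := ltrgt0P al; last by rewrite al00 eqxx in al0.
    have -> : f @^-1` `]a, b] = `](a - be) / al, (b - be) / al].
      apply/seteqP; split => x /=; rewrite !in_itv /= /f.
        by rewrite ltr_pdivrMr // ler_pdivlMr // => /andP[? ?]; apply/andP; split; lra.
      by rewrite ltr_pdivrMr // ler_pdivlMr // => /andP[? ?]; apply/andP; split; lra.
    rewrite !lebesgue_measure_itv /= !lte_fin ltr_pM2r ?invr_gt0 // ltrD2r.
    case: ifP => _; last by rewrite mule0.
    by rewrite -!EFinB -EFinM; congr EFin; field.
  have -> : f @^-1` `]a, b] = `[(b - be) / al, (a - be) / al[.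
    apply/seteqP; split => x /=; rewrite !in_itv /= /f.
      by rewrite ltr_ndivlMr // ler_ndivrMr // => /andP[? ?]; apply/andP; split; lra.
    by rewrite ltr_ndivlMr // ler_ndivrMr // => /andP[? ?]; apply/andP; split; lra.
  rewrite !lebesgue_measure_itv /= !lte_fin ltr_nM2r ?invr_lt0 // ltrD2r.
  case: ifP => _; last by rewrite mule0.
  by rewrite -!EFinB -EFinM; congr EFin; field.
by rewrite e /m' /mscale /= muleA -EFinM mulVf ?normr_eq0 // mul1e.
Qed.

(** The product measure is defined by slicing along one axis; a shear that moves the first
    coordinate needs the slices along the other. *)
Lemma mu2_ysection (E : set RR) : measurable E ->
  mu2 E = (\int[mu]_y mu (ysection E y))%E.
Proof.
move=> mE.
by apply: (product_measure_unique (m1 := mu) (m2 := mu)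
  (m' := (mu \x^ mu)%E)) => // A B mA mB; exact: product_measure2E.
Qed.

Lemma measurable_lin (al be ga de : R) : measurable_fun [set: RR]
  (fun p : RR => (al * p.1 + be * p.2, ga * p.1 + de * p.2) : RR).
Proof.
by apply: measurable_fun_pair; apply: measurable_funD;
 apply: (@measurable_funM _ _ R setT (cst _) _) => //;
 exact: measurable_fst || exact: measurable_snd.
Qed.

Let lin (al be ga de : R) (p : RR) : RR := (al * p.1 + be * p.2, ga * p.1 + de * p.2).

Let measurable_lin_pre al be ga de (E : set RR) : measurable E -> measurable (lin al be ga de @^-1` E).
Proof. by move=> mE; rewrite -[X in measurable X]setTI; exact: measurable_lin. Qed.

Let mu2_shear1 (al be : R) (E : set RR) : al != 0 -> measurable E ->
  mu2 (lin al be 0 1 @^-1` E) = ((`|al|^-1)%:E * mu2 E)%E.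
Proof.
move=> al0 mE; rewrite mu2_ysection; last exact: measurable_lin_pre.
rewrite mu2_ysection // -ge0_integralZl //=; first last.
- exact: (@measurable_fun_ysection _ _ _ _ R mu _ mE).
apply: eq_integral => y _.
rewrite -(lebesgue_measure_affine (be * y)) //; last exact: measurable_ysection.
congr mu; apply/seteqP; split => x /=.
  by rewrite /ysection /= !inE /lin /= mul0r add0r mul1r.
by rewrite /ysection /= !inE /lin /= mul0r add0r mul1r.
Qed.

Let mu2_shear2 (ga de : R) (E : set RR) : de != 0 -> measurable E ->
  mu2 (lin 1 0 ga de @^-1` E) = ((`|de|^-1)%:E * mu2 E)%E.
Proof.
move=> al0 mE; rewrite /product_measure1.
rewrite -ge0_integralZl //=; first last.
- exact: (@measurable_fun_xsection _ _ _ _ R mu _ mE).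
apply: eq_integral => x _.
rewrite -(lebesgue_measure_affine (ga * x)) //; last exact: measurable_xsection.
congr mu; apply/seteqP; split => y /=.
  by rewrite /xsection /= !inE /lin /= mul0r addr0 mul1r addrC.
by rewrite /xsection /= !inE /lin /= mul0r addr0 mul1r addrC.
Qed.

(** Gaussian elimination with pivot [al]: the matrix is a product of two triangular ones, which act
    by affine maps on horizontal and on vertical slices. *)
Let mu2_lin_neq0 (al be ga de : R) (E : set RR) : al != 0 ->
  al * de - be * ga != 0 -> measurable E ->
  mu2 (lin al be ga de @^-1` E) = ((`|al * de - be * ga|^-1)%:E * mu2 E)%E.
Proof.
move=> al0 D0 mE.
have -> : lin al be ga de =
    lin 1 0 (ga / al) ((al * de - be * ga) / al) \o lin al be 0 1.
  by apply/funext => -[x y]; rewrite /lin /=; congr pair; field.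
rewrite comp_preimage.
rewrite mu2_shear1 //; last exact: measurable_lin_pre.
rewrite mu2_shear2 ?mulf_neq0 ?invr_eq0 // muleA -EFinM; congr (_%:E * _)%E.
by rewrite normrM normfV invfM invrK mulrCA mulVf ?mulr1 // normr_eq0.
Qed.

Lemma mu2_lin (al be ga de : R) (E : set RR) :
  al * de - be * ga != 0 -> measurable E ->
  mu2 ((fun p : RR => (al * p.1 + be * p.2, ga * p.1 + de * p.2) : RR) @^-1` E) =
  ((`|al * de - be * ga|^-1)%:E * mu2 E)%E.
Proof.
move=> D0 mE; have [al0|] := eqVneq al 0; last by move/mu2_lin_neq0; exact.
rewrite {al}al0 in D0 *.
(* With a zero pivot, precompose with the area-preserving map [(x, y) -> (x, x + y)]: the pivot
   becomes [be]. *)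
have be0 : be != 0 by apply: contra_neq D0 => ->; rewrite !mul0r subr0.
have D1 : be * de - be * (ga + de) = 0 * de - be * ga by ring.
have := @mu2_lin_neq0 be be (ga + de) de E be0.
rewrite D1 => /(_ D0 mE) e1; apply: etrans e1.
pose G := lin 0 be ga de @^-1` E.
have mG : measurable G by exact: measurable_lin_pre.
have := @mu2_shear2 1 1 G (oner_neq0 _) mG.
rewrite normr1 invr1 mul1e => e.
rewrite -[LHS]/(mu2 G) -[LHS]e.
rewrite /G -comp_preimage; congr (mu2 (_ @^-1` E)); apply/funext => -[x y].
by rewrite /lin /=; congr pair; ring.
Qed.

Lemma mu2_setX_itv (a b c d : R) : a <= b -> c <= d ->
  mu2 (`[a, b] `*` `[c, d]) = ((b - a) * (d - c))%:E.
Proof.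
move=> ab cd; rewrite product_measure1E //= !lebesgue_measure_itv /= !lte_fin.
have e (x y : R) : x <= y -> (if (x < y)%R then y%:E - x%:E else 0)%E = (y - x)%:E :> \bar R.
  move=> xy; case: ltgtP xy => // -> _; by rewrite subrr.
by rewrite !e // EFinM.
Qed.

End LinearImages.

(** * Plane topology *)

Section PlaneTopology.
Variable R : realType.
Local Notation mu := (@lebesgue_measure R).
Local Notation RR := (measurableTypeR R * measurableTypeR R)%type.

(** An open set is the union of the countably many boxes with rational centre and radius
    [1 / (n + 1)] that it contains. *)
Lemma open_measurable2 (A : set (R * R)) : open A -> measurable (A : set RR).
Proof.
move=> oA.
pose B (q : rat * rat * nat) : set RR :=
  (ball (ratr q.1.1 : R) q.2.+1%:R^-1) `*` (ball (ratr q.1.2 : R) q.2.+1%:R^-1).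
have -> : A = \bigcup_q (if `[< B q `<=` A >] then B q else set0).
  apply/seteqP; split => [[x y] Axy|p [q _]]; last first.
    by case: asboolP => // BA Bqp; exact: BA.
  have : nbhs ((x, y) : R * R) A by exact: open_nbhs_nbhs.
  move=> /nbhs_ballP[e /= e0 eA].
  have [n] := ltr_add_invr (divr_gt0 e0 (ltr0n R 2)).
  rewrite add0r => ne.
  have : 0 < n.+1%:R^-1 :> R by rewrite invr_gt0 ltr0n.
  have : n.+1%:R^-1 = n.+1%:R^-1 :> R by [].
  move: ne; move: {1 2 4}(n.+1%:R^-1) => t te tE t0.
  have [q1] : exists q1, ratr q1 \in `]x - t, x + t[%R.
    by apply: rat_in_itvoo; lra.
  have [q2] : exists q1, ratr q1 \in `]y - t, y + t[%R.
    by apply: rat_in_itvoo; lra.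
  rewrite !in_itv /= => /andP[q2a q2b] /andP[q1a q1b].
  exists ((q1, q2), n) => //.
  case: asboolP => [_|[]]; rewrite /B /= -tE.
    by split; rewrite /= /ball /= ltr_norml; apply/andP; split; lra.
  move=> [x' y'] /= [] /=; rewrite /ball /= !ltr_norml => /andP[? ?] /andP[? ?].
  by apply: eA; split; rewrite /ball /= ltr_norml; apply/andP; split; lra.
apply: countable_bigcupT_measurable => [|q]; first exact: countableP.
case: ifP => _ //; apply: measurableX; exact: measurable_ball.
Qed.

Lemma compact_measurable2 (A : set (R * R)) : compact A -> measurable (A : set RR).
Proof.
move=> cA; rewrite -[A]setCK; apply: measurableC; apply: open_measurable2.
rewrite openC; apply: compact_closed cA.
exact: norm_hausdorff.
Qed.

(** Total differentiability at [(u, v)] with differential [(A, B)], which is stronger than the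
    existence of partial derivatives. The l1 norm and non-strict inequalities keep the estimates
    linear. *)
Definition has_partials (f : R -> R -> R) (u v A B : R) : Prop :=
  forall e : R, 0 < e -> exists2 d, 0 < d &
    forall u' v', `|u' - u| <= d -> `|v' - v| <= d ->
    `|f u' v' - f u v - A * (u' - u) - B * (v' - v)| <= e * (`|u' - u| + `|v' - v|).

Lemma partials_continuous f u v A B : has_partials f u v A B ->
  {for (u, v), continuous (fun q : R * R => f q.1 q.2)}.
Proof.
move=> fAB; apply/cvgrPdist_le => /= e e0.
have [d d0 df] := fAB 1 ltr01.
pose C := 2 + `|A| + `|B|.
have C0 : 0 < C by rewrite /C; have := normr_ge0 A; have := normr_ge0 B; lra.
pose r := Num.min d (e / C).
have r0 : 0 < r by rewrite lt_min d0 divr_gt0.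
exists (ball u r, ball v r) => /=; first by split; exact: nbhsx_ballx.
move=> [u' v'] [/=]; rewrite /ball /= => hu hv.
rewrite distrC in hu; rewrite distrC in hv; rewrite distrC.
have rd : r <= d by rewrite ge_min lexx.
have rC : r * C <= e by rewrite -ler_pdivlMr // ge_min lexx orbT.
have h1 := df u' v' (le_trans (ltW hu) rd) (le_trans (ltW hv) rd).
have -> : f u' v' - f u v =
  (f u' v' - f u v - A * (u' - u) - B * (v' - v)) + A * (u' - u) + B * (v' - v) by ring.
apply: le_trans (ler_normD _ _) _.
apply: le_trans (lerD (ler_normD _ _) (lexx _)) _.
rewrite !normrM.
have h2 : `|A| * `|u' - u| <= `|A| * r by rewrite ler_wpM2l // ltW.
have h3 : `|B| * `|v' - v| <= `|B| * r by rewrite ler_wpM2l // ltW.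
apply: le_trans rC; rewrite /C; lra.
Qed.

Definition plane_map (F1 F2 : R -> R -> R) (q : R * R) : R * R := (F1 q.1 q.2, F2 q.1 q.2).

Definition square (x y s : R) : set (R * R) := `[x, x + s] `*` `[y, y + s].

Lemma squareP x y s u v : square x y s (u, v) <->
  [/\ x <= u, u <= x + s, y <= v & v <= y + s].
Proof.
rewrite /square /= !in_itv /=; split => [[/andP[? ?] /andP[? ?]]|[? ? ? ?]] //.
by split; apply/andP.
Qed.

Lemma square_dist x y s u v u' v' : square x y s (u, v) -> square x y s (u', v') ->
  `|u' - u| <= s /\ `|v' - v| <= s.
Proof.
by move=> /squareP[? ? ? ?] /squareP[? ? ? ?]; rewrite !ler_norml; split; apply/andP; split; lra.
Qed.

Lemma partials_square_error f u v A B e : 0 < e -> has_partials f u v A B ->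
  exists2 d, 0 < d & forall x y s u' v', s < d -> square x y s (u, v) ->
    square x y s (u', v') ->
    `|f u' v' - f u v - A * (u' - u) - B * (v' - v)| <= 2 * (e * s).
Proof.
move=> e0 hf; have [d d0 hd] := hf e e0; exists d => // x y s u' v' sd sq sq'.
have [au av] := square_dist sq sq'.
apply: le_trans (hd u' v' (le_trans au (ltW sd)) (le_trans av (ltW sd))) _.
have -> : 2 * (e * s) = e * (s + s) by ring.
by rewrite ler_pM2l // lerD.
Qed.

Lemma continuous_image_compact2 (F1 F2 : R -> R -> R) (A : set (R * R)) :
  (forall u v, A (u, v) -> exists A1 B1 A2 B2,
     has_partials F1 u v A1 B1 /\ has_partials F2 u v A2 B2) ->
  compact A -> compact (plane_map F1 F2 @` A).
Proof.
move=> FA cA; apply: continuous_compact cA; apply: continuous_in_subspaceT.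
move=> [u v]; rewrite inE => /FA[A1 [B1 [A2 [B2 [h1 h2]]]]].
by apply: (@cvg_pair _ _ _ (nbhs (u, v)) (nbhs (F1 u v)) (nbhs (F2 u v)));
  [exact: partials_continuous h1|exact: partials_continuous h2].
Qed.

Lemma compact_square x y s : compact (square x y s).
Proof. by apply: compact_setX; exact: segment_compact. Qed.

(* Cousin's lemma in the plane, by repeated quartering. *)
Lemma square_induction (G : R -> R -> R -> Prop) (x0 y0 s0 : R) :
  0 < s0 ->
  (forall x y s, 0 < s -> x0 <= x -> x + (s + s) <= x0 + s0 -> y0 <= y ->
     y + (s + s) <= y0 + s0 -> G x y s -> G (x + s) y s -> G x (y + s) s ->
     G (x + s) (y + s) s -> G x y (s + s)) ->
  (forall u v, square x0 y0 s0 (u, v) -> exists2 d, 0 < d &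
     forall x y s, 0 < s -> s < d -> x0 <= x -> x + s <= x0 + s0 -> y0 <= y ->
     y + s <= y0 + s0 -> square x y s (u, v) -> G x y s) ->
  G x0 y0 s0.
Proof.
move=> s00 Gstep Gloc; apply: contrapT => nG.
(* By contradiction: a square on which [G] fails has a quarter on which [G] fails, so quartering
   goes on forever inside the initial square. *)
pose bad (t : R * R * R) := [/\ 0 < t.2, x0 <= t.1.1, t.1.1 + t.2 <= x0 + s0,
   y0 <= t.1.2 & t.1.2 + t.2 <= y0 + s0] /\ ~ G t.1.1 t.1.2 t.2.
pose nxt (t t' : {t | bad t}) := [/\ (sval t').2 = (sval t).2 / 2,
   (sval t).1.1 <= (sval t').1.1, (sval t').1.1 + (sval t').2 <= (sval t).1.1 + (sval t).2,
   (sval t).1.2 <= (sval t').1.2 & (sval t').1.2 + (sval t').2 <= (sval t).1.2 + (sval t).2].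
have step t : {t' | nxt t t'}.
  apply: cid; case: t => -[[x y] s] [/= [sp xx xs yy ys] nGt].
  have sE : s = s / 2 + s / 2 by field.
  have hp : 0 < s / 2 by lra.
  suff [x' [y' [[h1 h2 h3 h4] nG']]] : exists x' y', [/\ x <= x', x' + s / 2 <= x + s,
      y <= y' & y' + s / 2 <= y + s] /\ ~ G x' y' (s / 2).
    have hb : bad ((x', y'), s / 2) by split => //=; split => //=; lra.
    by exists (exist _ _ hb).
  apply: contrapT => hn; apply: nGt; rewrite sE.
  have hG x' y' : x <= x' -> x' + s / 2 <= x + s -> y <= y' -> y' + s / 2 <= y + s ->
     G x' y' (s / 2).
    by move=> ? ? ? ?; apply: contrapT => ?; apply: hn; exists x', y'.
  by apply: Gstep => //; try (by lra); apply: hG; lra.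
have b0 : bad ((x0, y0), s0) by split => //=; split => //=; lra.
have [f [f0 fS]] := dependent_choice step (exist _ _ b0).
pose X n := (sval (f n)).1.1; pose Y n := (sval (f n)).1.2; pose S n := (sval (f n)).2.
have SE n : S n = s0 / 2 ^+ n.
  elim: n => [|n IH]; first by rewrite /S f0 /= expr0 divr1.
  by rewrite /S; have [-> _ _ _ _] := fS n; rewrite -/(S n) IH exprS invfM; ring.
have Sp n : 0 < S n by rewrite SE divr_gt0 // exprn_gt0.
have inX m n : X m <= X (m + n)%N /\ X (m + n)%N + S (m + n)%N <= X m + S m.
  elim: n => [|n [IH1 IH2]]; first by rewrite addn0.
  have [_ h1 h2 _ _] := fS (m + n)%N; rewrite addnS.
  by rewrite -/(X _) -/(X _) -/(S _) -/(S _) in h1 h2; split; lra.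
have inY m n : Y m <= Y (m + n)%N /\ Y (m + n)%N + S (m + n)%N <= Y m + S m.
  elim: n => [|n [IH1 IH2]]; first by rewrite addn0.
  have [_ _ _ h1 h2] := fS (m + n)%N; rewrite addnS.
  by rewrite -/(Y _) -/(Y _) -/(S _) -/(S _) in h1 h2; split; lra.
(* The supremum of the left ends lies in every interval. In both coordinates this gives a point
   common to all bad squares, where the local hypothesis contradicts badness. *)
have nested (Z : nat -> R) : (forall m n, Z m <= Z (m + n)%N /\
    Z (m + n)%N + S (m + n)%N <= Z m + S m) -> exists z, forall n, Z n <= z <= Z n + S n.
  move=> inZ; exists (sup (range Z)) => n.
  have ub m : ubound (range Z) (Z m + S m).
    move=> _ [k _ <-]; have [h1 _] := inZ k m; have [_ h2] := inZ m k.
    by rewrite addnC in h2; have := Sp (k + m)%N; lra.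
  apply/andP; split; last by apply: ge_sup; [exists (Z 0%N), 0%N|exact: ub].
  by apply: ub_le_sup; [exists (Z 0%N + S 0%N); exact: ub|exists n].
have [u hu] := nested X inX; have [v hv] := nested Y inY.
have X0 : X 0%N = x0 by rewrite /X f0.
have Y0 : Y 0%N = y0 by rewrite /Y f0.
have S0 : S 0%N = s0 by rewrite /S f0.
have [d d0 hd] : exists2 d, 0 < d & forall x y s, 0 < s -> s < d -> x0 <= x ->
     x + s <= x0 + s0 -> y0 <= y -> y + s <= y0 + s0 -> square x y s (u, v) -> G x y s.
  apply: Gloc; apply/squareP; move: (hu 0%N) (hv 0%N); rewrite X0 Y0 S0.
  by move=> /andP[? ?] /andP[? ?]; split.
have [n hn] : exists n, S n < d.
  have [n] := ltr_add_invr (divr_gt0 d0 s00); rewrite add0r => hn.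
  exists n; rewrite SE ltr_pdivrMr ?exprn_gt0 // mulrC -ltr_pdivrMr //.
  have : s0 / d < n.+1%:R by rewrite -ltf_pV2 ?posrE ?invr_gt0 ?divr_gt0 ?ltr0n // invf_div.
  move=> /lt_le_trans; apply.
  by rewrite -natrX ler_nat; exact: ltn_expl.
have [/= [_ h1 h2 h3 h4] []] := svalP (f n).
apply: hd => //; first exact: Sp.
by apply/squareP; move: (hu n) (hv n) => /andP[? ?] /andP[? ?]; split.
Qed.

End PlaneTopology.

(** * Area of the image of a small square: upper estimate *)

Section LocalEstimates.
Variable R : realType.
Local Notation mu := (@lebesgue_measure R).
Local Notation RR := (measurableTypeR R * measurableTypeR R)%type.
Local Notation mu2 := ((mu \x mu)%E : set RR -> \bar R).
Implicit Types (f g : R -> R -> R).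

Lemma has_partials_lin f g u v A1 B1 A2 B2 (c1 c2 : R) :
  has_partials f u v A1 B1 -> has_partials g u v A2 B2 ->
  has_partials (fun x y => c1 * f x y + c2 * g x y) u v
    (c1 * A1 + c2 * A2) (c1 * B1 + c2 * B2).
Proof.
move=> hf hg e e0.
pose C := 1 + `|c1| + `|c2|.
have C0 : 0 < C by rewrite /C; have := normr_ge0 c1; have := normr_ge0 c2; lra.
have [d1 d10 hd1] := hf (e / C) (divr_gt0 e0 C0).
have [d2 d20 hd2] := hg (e / C) (divr_gt0 e0 C0).
exists (Num.min d1 d2); first by rewrite lt_min d10.
move=> u' v'; rewrite !le_min => /andP[u1 u2] /andP[v1 v2].
have {hd1} := hd1 _ _ u1 v1; have {hd2} := hd2 _ _ u2 v2.
set t := _ + `|v' - v|; have t0 : 0 <= t by rewrite addr_ge0.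
set X := _ - _ - _ - B2 * _; set Y := _ - _ - _ - B1 * _ => hX hY.
have -> : c1 * f u' v' + c2 * g u' v' - (c1 * f u v + c2 * g u v) -
  (c1 * A1 + c2 * A2) * (u' - u) - (c1 * B1 + c2 * B2) * (v' - v) = c1 * Y + c2 * X.
  by rewrite /X /Y; ring.
apply: le_trans (ler_normD _ _) _; rewrite !normrM.
have h1 : `|c1| * `|Y| <= `|c1| * (e / C * t) by rewrite ler_wpM2l.
have h2 : `|c2| * `|X| <= `|c2| * (e / C * t) by rewrite ler_wpM2l.
apply: le_trans (lerD h1 h2) _.
have -> : `|c1| * (e / C * t) + `|c2| * (e / C * t) = (C - 1) / C * (e * t).
  by rewrite /C; ring.
rewrite -[X in _ <= X]mul1r ler_wpM2r ?mulr_ge0 // ?(ltW e0) //.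
by rewrite ler_pdivrMr // mul1r lerBlDr lerDl.
Qed.

(** For normalizing the differential in the local estimates: [G] is the original map followed by an
    invertible linear map. *)
Lemma mu2_lin_image f g (c1 c2 d1 d2 : R) (Q : set (R * R)) :
  c1 * d2 - c2 * d1 != 0 ->
  let G := plane_map (fun x y => c1 * f x y + c2 * g x y)
                     (fun x y => d1 * f x y + d2 * g x y) in
  measurable (G @` Q : set RR) ->
  mu2 (plane_map f g @` Q) = ((`|c1 * d2 - c2 * d1|^-1)%:E * mu2 (G @` Q))%E.
Proof.
move=> D0 G mG; rewrite -mu2_lin //; congr (mu2 _).
apply/seteqP; split => [_ [[x y] Qxy <-]|[p1 p2] /= [[x y] Qxy]].
  by exists (x, y).
rewrite /G /plane_map /= => -[e1 e2]; exists (x, y) => //=; congr pair.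
  apply: (mulIf D0).
  rewrite (_ : f x y * _ = d2 * (c1 * f x y + c2 * g x y) - c2 * (d1 * f x y + d2 * g x y)); last by ring.
  by rewrite e1 e2; ring.
apply: (mulIf D0).
rewrite (_ : g x y * _ = c1 * (d1 * f x y + d2 * g x y) - d1 * (c1 * f x y + c2 * g x y)); last by ring.
by rewrite e1 e2; ring.
Qed.

Lemma le_mu2_box (E : set RR) a b c d : measurable E -> a <= b -> c <= d ->
  E `<=` `[a, b] `*` `[c, d] -> (mu2 E <= ((b - a) * (d - c))%:E)%E.
Proof.
move=> mE ab cd Ebox; rewrite -mu2_setX_itv //; apply: le_measure => //.
  by rewrite inE.
by rewrite inE; apply: measurableX; exact: measurable_itv.
Qed.

Lemma mu2_box_le (E : set RR) a b c d : measurable E -> a <= b -> c <= d ->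
  `[a, b] `*` `[c, d] `<=` E -> (((b - a) * (d - c))%:E <= mu2 E)%E.
Proof.
move=> mE ab cd Ebox; rewrite -mu2_setX_itv //; apply: le_measure => //.
  by rewrite inE; apply: measurableX; exact: measurable_itv.
by rewrite inE.
Qed.

Lemma near_id_range (x s u u' p q e : R) : x <= u' -> u' <= x + s -> `|p - q - (u' - u)| <= e ->
  q + (x - u) - e <= p <= q + (x - u) + s + e.
Proof. by rewrite ler_norml => ? ? /andP[? ?]; apply/andP; split; lra. Qed.

Lemma bounded_range (p q A B C du dv s e : R) : `|du| <= s -> `|dv| <= s ->
  `|p - q - A * du - B * dv| <= e -> e <= 2 * s -> C = `|A| + `|B| + 2 ->
  q - C * s <= p <= q + C * s.
Proof.
move=> hu hv h es ->.
have hA : `|A * du| <= `|A| * s by rewrite normrM ler_wpM2l.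
have hB : `|B * dv| <= `|B| * s by rewrite normrM ler_wpM2l.
move: h hA hB; rewrite !ler_norml => /andP[? ?] /andP[? ?] /andP[? ?].
by apply/andP; split; lra.
Qed.

Lemma local_upper_id f g u v e : 0 < e ->
  has_partials f u v 1 0 -> has_partials g u v 0 1 ->
  exists2 d, 0 < d & forall x y s, 0 < s -> s < d -> square x y s (u, v) ->
    measurable (plane_map f g @` square x y s : set RR) ->
    (mu2 (plane_map f g @` square x y s) <= ((1 + e) * s ^+ 2)%:E)%E.
Proof.
move=> e0 hf hg.
(* The image lies in a box of side [(1 + 4 * t) * s], and [(1 + 4 * t)^2 <= 1 + 24 * t] for
   [t <= 1]. *)
pose t := Num.min 1 (e / 24).
have t0 : 0 < t by rewrite lt_min ltr01 divr_gt0.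
have t1 : t <= 1 by rewrite ge_min lexx.
have te : 24 * t <= e.
  have : t <= e / 24 by rewrite ge_min lexx orbT.
  lra.
have [d1 d10 h1] := partials_square_error t0 hf.
have [d2 d20 h2] := partials_square_error t0 hg.
exists (Num.min d1 d2); first by rewrite lt_min d10.
move=> x y s s0; rewrite lt_min => /andP[sd1 sd2] sq mE.
have := @le_mu2_box _ (f u v + (x - u) - 2 * (t * s)) (f u v + (x - u) + s + 2 * (t * s))
  (g u v + (y - v) - 2 * (t * s)) (g u v + (y - v) + s + 2 * (t * s)) mE.
have ts : 0 < t * s by rewrite mulr_gt0.
have l1 : f u v + (x - u) - 2 * (t * s) <= f u v + (x - u) + s + 2 * (t * s) by lra.
have l2 : g u v + (y - v) - 2 * (t * s) <= g u v + (y - v) + s + 2 * (t * s) by lra.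
move=> /(_ l1 l2) => h.
apply: le_trans (h _) _.
  move=> _ [[u' v'] sq' <-]; have /squareP[xu' us' yv' vs'] := sq'.
  have := h1 _ _ _ _ _ sd1 sq sq'; have := h2 _ _ _ _ _ sd2 sq sq'.
  rewrite !mul1r !mul0r !subr0 => k2 k1.
  by split; rewrite /= in_itv /=; [exact: near_id_range xu' us' k1|exact: near_id_range yv' vs' k2].
rewrite lee_fin.
apply: (@le_trans _ _ ((1 + 4 * t) ^+ 2 * s ^+ 2)).
  by rewrite le_eqVlt; apply/orP; left; apply/eqP; ring.
rewrite ler_wpM2r ?sqr_ge0 //; nra.
Qed.

Lemma local_upper_singular f g u v A B e : 0 < e ->
  has_partials f u v A B -> has_partials g u v 0 0 ->
  exists2 d, 0 < d & forall x y s, 0 < s -> s < d -> square x y s (u, v) ->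
    measurable (plane_map f g @` square x y s : set RR) ->
    (mu2 (plane_map f g @` square x y s) <= (e * s ^+ 2)%:E)%E.
Proof.
move=> e0 hf hg.
pose C := `|A| + `|B| + 2.
have C0 : 2 <= C by rewrite lerDr addr_ge0.
(* The image is flat: it lies in a box of width [2 * C * s] and height [4 * t * s], whose area is
   [8 * C * t * s^2 = e * s^2]. *)
pose t := e / (8 * C).
have t0 : 0 < t by rewrite divr_gt0 //; lra.
have te : 8 * C * t = e by rewrite /t; field; lra.
have [d1 d10 h1] := partials_square_error ltr01 hf.
have [d2 d20 h2] := partials_square_error t0 hg.
exists (Num.min d1 d2); first by rewrite lt_min d10.
move=> x y s s0; rewrite lt_min => /andP[sd1 sd2] sq mE.
have := @le_mu2_box _ (f u v - C * s) (f u v + C * s)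
  (g u v - 2 * (t * s)) (g u v + 2 * (t * s)) mE.
have ts : 0 < t * s by rewrite mulr_gt0.
have Cs : 0 < C * s by rewrite mulr_gt0 //; lra.
have l1 : f u v - C * s <= f u v + C * s by lra.
have l2 : g u v - 2 * (t * s) <= g u v + 2 * (t * s) by lra.
move=> /(_ l1 l2) => h.
apply: le_trans (h _) _.
  move=> _ [[u' v'] sq' <-]; have [au av] := square_dist sq sq'.
  have k1 := h1 _ _ _ _ _ sd1 sq sq'; have := h2 _ _ _ _ _ sd2 sq sq'.
  rewrite !mul0r !subr0 ler_distl => k2.
  split; rewrite /= in_itv /=; last by exact: k2.
  by apply: bounded_range au av k1 _ (erefl _); rewrite mul1r.
rewrite lee_fin -te.
by rewrite le_eqVlt; apply/orP; left; apply/eqP; ring.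
Qed.

(** An invertible differential is normalized to the identity by applying its inverse. A singular one
    has dependent rows, and a linear change of determinant [1] or [-1] makes the second row zero. *)
Lemma local_upper f g u v A1 B1 A2 B2 e : 0 < e ->
  has_partials f u v A1 B1 -> has_partials g u v A2 B2 ->
  exists2 d, 0 < d & forall x y s, 0 < s -> s < d -> square x y s (u, v) ->
    (forall u' v', square x y s (u', v') -> exists A1 B1 A2 B2,
       has_partials f u' v' A1 B1 /\ has_partials g u' v' A2 B2) ->
    (mu2 (plane_map f g @` square x y s) <= ((`|A1 * B2 - B1 * A2| + e) * s ^+ 2)%:E)%E.
Proof.
move=> e0 hf hg; set D := A1 * B2 - B1 * A2.
have mG c1 c2 d1 d2 x y s : (forall u' v', square x y s (u', v') -> exists A1 B1 A2 B2,
       has_partials f u' v' A1 B1 /\ has_partials g u' v' A2 B2) ->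
   measurable (plane_map (fun x y => c1 * f x y + c2 * g x y)
                     (fun x y => d1 * f x y + d2 * g x y) @` square x y s : set RR).
  move=> hp; apply: compact_measurable2; apply: continuous_image_compact2; last exact: compact_square.
  move=> u' v' /hp[a1 [b1 [a2 [b2 [k1 k2]]]]].
  by do 4 eexists; split; apply: has_partials_lin; eassumption.
have [D0|D0] := eqVneq D 0; last first.
  have h1 := has_partials_lin (B2 / D) (- B1 / D) hf hg.
  have h2 := has_partials_lin (- A2 / D) (A1 / D) hf hg.
  have e' : 0 < e / `|D| by rewrite divr_gt0 // normr_gt0.
  have k1 : B2 / D * A1 + - B1 / D * A2 = 1 by rewrite /D; field; exact: D0.
  have k2 : B2 / D * B1 + - B1 / D * B2 = 0 by rewrite /D; field; exact: D0.
  have k3 : - A2 / D * A1 + A1 / D * A2 = 0 by rewrite /D; field; exact: D0.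
  have k4 : - A2 / D * B1 + A1 / D * B2 = 1 by rewrite /D; field; exact: D0.
  rewrite k1 k2 in h1; rewrite k3 k4 in h2.
  have [d d0 hd] := local_upper_id e' h1 h2.
  exists d => // x y s s0 sd sq hp.
  have kD : (B2 / D) * (A1 / D) - (- B1 / D) * (- A2 / D) = D^-1.
    by rewrite /D; field; exact: D0.
  rewrite (@mu2_lin_image f g (B2 / D) (- B1 / D) (- A2 / D) (A1 / D)); last 2 first.
  - by rewrite kD invr_neq0.
  - exact: mG.
  rewrite kD normfV invrK.
  apply: le_trans (lee_pmul _ _ (lexx _) (hd x y s s0 sd sq (mG _ _ _ _ _ _ _ hp))) _ => //.
  rewrite -EFinM lee_fin mulrA ler_wpM2r ?sqr_ge0 // mulrDr mulr1 mulrCA divff ?normr_eq0 //.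
  by rewrite mulr1.
have [c1 [c2 [d1 [d2 [cd k1 k2]]]]] : exists c1 c2 d1 d2 : R, [/\ `|c1 * d2 - c2 * d1| = 1,
    d1 * A1 + d2 * A2 = 0 & d1 * B1 + d2 * B2 = 0].
  have [a10|a10] := eqVneq A1 0.
    have [b10|b10] := eqVneq B1 0.
      exists 0, 1, 1, 0; rewrite a10 b10; split; last 2 first.
      - by ring.
      - by ring.
      by rewrite mulr0 mulr1 sub0r normrN normr1.
    exists 1, 0, (- B2 / B1), 1; split; first by rewrite mulr1 mul0r subr0 normr1.
      move: D0; rewrite /D a10 mul0r sub0r => /eqP; rewrite oppr_eq0 mulf_eq0 (negbTE b10) /=.
      by move=> /eqP ->; rewrite mulr0 mulr0 addr0.
    by field.
  exists 1, 0, (- A2 / A1), 1; split; first by rewrite mulr1 mul0r subr0 normr1.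
    by field.
  rewrite (_ : _ + _ = D / A1); first by rewrite D0 mul0r.
  by rewrite /D; field.
have h1 := has_partials_lin c1 c2 hf hg.
have h2 := has_partials_lin d1 d2 hf hg.
rewrite k1 k2 in h2.
have [d d0 hd] := local_upper_singular e0 h1 h2.
exists d => // x y s s0 sd sq hp.
rewrite (@mu2_lin_image f g c1 c2 d1 d2); last 2 first.
- by rewrite -normr_eq0 cd oner_eq0.
- exact: mG.
rewrite cd invr1 mul1e D0 normr0 add0r.
by apply: hd => //; exact: mG.
Qed.

End LocalEstimates.

(** * Area of the image of a small square: lower estimate *)

Section LowerEstimate.
Variable R : realType.
Local Notation mu := (@lebesgue_measure R).
Local Notation RR := (measurableTypeR R * measurableTypeR R)%type.
Local Notation mu2 := ((mu \x mu)%E : set RR -> \bar R).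
Implicit Types (f g : R -> R -> R).

Definition local_diffeo f g u v := exists A1 B1 A2 B2,
  [/\ has_partials f u v A1 B1, has_partials g u v A2 B2 & A1 * B2 - B1 * A2 != 0].

Lemma shift_in_range (x s eta u w p d : R) :
  x + 3 * eta <= w -> w <= x + 3 * eta + (s - 6 * eta) ->
  `|p - u| <= eta -> `|p - w| <= eta -> `|d| <= eta -> x <= u + d /\ u + d <= x + s.
Proof.
by rewrite !ler_norml => ? ? /andP[? ?] /andP[? ?] /andP[? ?]; split; lra.
Qed.

(** A damped Newton step turns the residual [p] into [(1 - t) * p] up to an error [c], which is at
    most half of the gain [t * m]. *)
Lemma contracted_norm (m t c p : R) : 0 < m -> 0 < t -> t <= 1 / 2 ->
  `|c| <= t * (m / 2) -> `|p| <= m -> `|c + (1 - t) * p| < m.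
Proof.
move=> m0 t0 t1 hc hp; apply: le_lt_trans (ler_normD _ _) _.
rewrite normrM (@ger0_norm _ (1 - t)); last by lra.
have : (1 - t) * `|p| <= (1 - t) * m by rewrite ler_wpM2l //; lra.
have : 0 < t * m by rewrite mulr_gt0.
lra.
Qed.

(* The distance from [w] to the image is attained at an interior point of the
   square, where an invertible differential would allow decreasing it. *)
Lemma near_identity_covers f g x y s eta w1 w2 : 0 < eta ->
  (forall u v, square x y s (u, v) -> local_diffeo f g u v) ->
  (forall u v, square x y s (u, v) -> `|f u v - u| <= eta /\ `|g u v - v| <= eta) ->
  square (x + 3 * eta) (y + 3 * eta) (s - 6 * eta) (w1, w2) ->
  (plane_map f g @` square x y s) (w1, w2).
Proof.
move=> eta0 hd hid hw.
pose m (q : R * R) : R := Num.max `|f q.1 q.2 - w1| `|g q.1 q.2 - w2|.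
have wsq : square x y s (w1, w2).
  by move/squareP: hw => [? ? ? ?]; apply/squareP; split; lra.
have [[u v] usq umin] : exists2 c, c \in square x y s & forall t, t \in square x y s -> m c <= m t.
  apply: compact_EVT_min; [by exists (w1, w2)|exact: compact_square|].
  apply: continuous_in_subspaceT => -[u v]; rewrite inE => /hd[A1 [B1 [A2 [B2 [h1 h2 _]]]]].
  apply: (@continuous_max _ _ (fun q => `|f q.1 q.2 - w1|) (fun q => `|g q.1 q.2 - w2|)).
    apply: cvg_norm; apply: cvgB; last exact: cvg_cst.
    exact: partials_continuous h1.
  apply: cvg_norm; apply: cvgB; last exact: cvg_cst.
  exact: partials_continuous h2.
rewrite inE in usq.
(* The point [(w1, w2)] itself lies in the square and is a competitor. *)
have mw : m (u, v) <= eta.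
  apply: le_trans (umin (w1, w2) _) _; first by rewrite inE.
  by rewrite /m /= ge_max; apply/andP; exact: hid.
have [m0|m0] := eqVneq (m (u, v)) 0.
  exists (u, v) => //; rewrite /plane_map /=.
  have : m (u, v) <= 0 by rewrite m0.
  rewrite /m /= ge_max !normr_le0 !subr_eq0 => /andP[/eqP -> /eqP ->] //.
have {}m0 : 0 < m (u, v) by rewrite lt_neqAle eq_sym m0 le_max normr_ge0.
exfalso.
have [hu hv] := hid _ _ usq.
have [A1 [B1 [A2 [B2 [h1 h2 D0]]]]] := hd _ _ usq.
set D := A1 * B2 - B1 * A2 in D0.
pose p1 := f u v - w1; pose p2 := g u v - w2.
(* The Newton step: the differential maps [(du, dv)] to [(- p1, - p2)]. *)
pose du := - (B2 * p1 - B1 * p2) / D; pose dv := - (A1 * p2 - A2 * p1) / D.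
have e1 : A1 * du + B1 * dv = - p1 by rewrite /du /dv /D; field.
have e2 : A2 * du + B2 * dv = - p2 by rewrite /du /dv /D; field.
pose T := 1 + `|du| + `|dv|.
have T1 : 1 <= T by rewrite /T -addrA lerDl addr_ge0.
have T0 : 0 < T by lra.
pose e := m (u, v) / (2 * T).
have e0 : 0 < e by rewrite divr_gt0 // mulr_gt0.
have [d1 d10 k1] := h1 e e0; have [d2 d20 k2] := h2 e e0.
(* The step is damped so that it moves by at most [eta] and stays where both first-order expansions
   have error at most [e] times the displacement. *)
pose t := Num.min (1/2) (Num.min (eta / T) (Num.min (d1 / T) (d2 / T))).
have t0 : 0 < t by rewrite !lt_min !divr_gt0.
have t1 : t <= 1/2 by rewrite ge_min lexx.
have te : t * T <= eta by rewrite -ler_pdivlMr // !ge_min lexx ?orbT.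
have td1 : t * T <= d1 by rewrite -ler_pdivlMr // !ge_min lexx ?orbT.
have td2 : t * T <= d2 by rewrite -ler_pdivlMr // !ge_min lexx ?orbT.
have tdu : `|t * du| <= t * T.
  by rewrite normrM gtr0_norm // ler_pM2l // /T addrAC lerDr addr_ge0.
have tdv : `|t * dv| <= t * T.
  by rewrite normrM gtr0_norm // ler_pM2l // /T lerDr addr_ge0.
have mf : `|p1| <= m (u, v) by rewrite le_max lexx.
have mg : `|p2| <= m (u, v) by rewrite le_max lexx orbT.
(* The minimizer is within [2 * eta] of [(w1, w2)] in each coordinate, and the step adds at most
   [eta]: this is what the margin [3 * eta] is for. *)
have usq' : square x y s (u + t * du, v + t * dv).
  move/squareP: hw => [q1 q2 q3 q4].
  have [? ?] := shift_in_range q1 q2 hu (le_trans mf mw) (le_trans tdu te).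
  have [? ?] := shift_in_range q3 q4 hv (le_trans mg mw) (le_trans tdv te).
  by apply/squareP.
have := umin (u + t * du, v + t * dv); rewrite inE => /(_ usq').
apply/negP; rewrite -ltNge.
have eqx a b : a + b - a = b :> R by ring.
have := k1 (u + t * du) (v + t * dv); have := k2 (u + t * du) (v + t * dv).
rewrite !eqx => /(_ (le_trans tdu td2) (le_trans tdv td2)) K2.
move=> /(_ (le_trans tdu td1) (le_trans tdv td1)) K1.
have b : e * (`|t * du| + `|t * dv|) <= t * (m (u, v) / 2).
  rewrite [`|t * du|]normrM [`|t * dv|]normrM gtr0_norm // -mulrDr mulrCA ler_pM2l // /e.
  have -> : m (u, v) / (2 * T) * (`|du| + `|dv|) = m (u, v) / 2 * ((`|du| + `|dv|) / T).
    by field; rewrite gt_eqF.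
  rewrite -[X in _ <= X]mulr1 ler_pM2l ?divr_gt0 // ler_pdivrMr // mul1r /T.
  by rewrite -addrA lerDr.
have red c p := @contracted_norm (m (u, v)) t c p m0 t0 t1.
rewrite [X in X < _]/m /= gt_max; apply/andP; split.
  have := red _ p1 (le_trans K1 b) mf.
  congr (`|_| < _).
  have -> : B1 * (t * dv) = t * (A1 * du + B1 * dv) - A1 * (t * du) by ring.
  by rewrite e1 /p1; ring.
have := red _ p2 (le_trans K2 b) mg.
congr (`|_| < _).
have -> : B2 * (t * dv) = t * (A2 * du + B2 * dv) - A2 * (t * du) by ring.
by rewrite e2 /p2; ring.
Qed.

Lemma local_lower_id f g u v e : 0 < e ->
  has_partials f u v 1 0 -> has_partials g u v 0 1 ->
  exists2 d, 0 < d & forall x y s, 0 < s -> s < d -> square x y s (u, v) ->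
    (forall u' v', square x y s (u', v') -> local_diffeo f g u' v') ->
    measurable (plane_map f g @` square x y s : set RR) ->
    (((1 - e) * s ^+ 2)%:E <= mu2 (plane_map f g @` square x y s))%E.
Proof.
move=> e0 hf hg.
(* After a translation the map is within [eta = 2 * (t * s)] of the identity, so a square of side
   [s - 6 * eta = (1 - 12 * t) * s] is covered, and [(1 - 12 * t)^2 >= 1 - 24 * t]. *)
pose t := Num.min (1/12) (e / 24).
have t0 : 0 < t by rewrite lt_min !divr_gt0.
have t1 : 12 * t <= 1.
  have : t <= 1/12 by rewrite ge_min lexx.
  lra.
have te : 24 * t <= e.
  have : t <= e / 24 by rewrite ge_min lexx orbT.
  lra.
have [d1 d10 h1] := partials_square_error t0 hf.
have [d2 d20 h2] := partials_square_error t0 hg.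
exists (Num.min d1 d2); first by rewrite lt_min d10.
move=> x y s s0; rewrite lt_min => /andP[sd1 sd2] sq hd mE.
have ts : 0 < t * s by rewrite mulr_gt0.
pose c1 := f u v - u; pose c2 := g u v - v.
have ts1 : 0 <= (1 - 12 * t) * s by rewrite mulr_ge0 ?(ltW s0) //; lra.
have := @mu2_box_le _ _ (c1 + x + 6 * (t * s)) (c1 + x + s - 6 * (t * s))
  (c2 + y + 6 * (t * s)) (c2 + y + s - 6 * (t * s)) mE.
have l1 : c1 + x + 6 * (t * s) <= c1 + x + s - 6 * (t * s) by lra.
have l2 : c2 + y + 6 * (t * s) <= c2 + y + s - 6 * (t * s) by lra.
move=> /(_ l1 l2) => h.
apply: le_trans (h _); last first.
  move=> [p1 p2] [/=]; rewrite !in_itv /= => /andP[q1 q2] /andP[q3 q4].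
  have [] := @near_identity_covers (fun x y => f x y - c1) (fun x y => g x y - c2)
     x y s (2 * (t * s)) (p1 - c1) (p2 - c2).
  - lra.
  - move=> u' v' /hd[A1 [B1 [A2 [B2 [k1 k2 k3]]]]]; exists A1, B1, A2, B2; split => //.
      move=> r r0; have [d d0 hd'] := k1 r r0; exists d => // a b ha hb.
      by rewrite (_ : f a b - c1 - (f u' v' - c1) = f a b - f u' v'); [exact: hd'|ring].
    move=> r r0; have [d d0 hd'] := k2 r r0; exists d => // a b ha hb.
    by rewrite (_ : g a b - c2 - (g u' v' - c2) = g a b - g u' v'); [exact: hd'|ring].
  - move=> u' v' sq'; have := h1 _ _ _ _ _ sd1 sq sq'; have := h2 _ _ _ _ _ sd2 sq sq'.
    rewrite !mul1r !mul0r !subr0 => k2 k1; split; [move: k1|move: k2].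
      by congr (`|_| <= _); rewrite /c1; ring.
    by congr (`|_| <= _); rewrite /c2; ring.
  - by apply/squareP; split; [move: q1|move: q2|move: q3|move: q4]; rewrite /c1 /c2; lra.
  move=> [a b] sab; rewrite /plane_map /= => -[r1 r2]; exists (a, b) => //=.
  rewrite /plane_map /=; congr pair; first by rewrite -[LHS](subrK c1) r1 subrK.
  by rewrite -[LHS](subrK c2) r2 subrK.
rewrite lee_fin.
apply: (@le_trans _ _ ((1 - 12 * t) ^+ 2 * s ^+ 2)); last first.
  by rewrite le_eqVlt; apply/orP; left; apply/eqP; ring.
rewrite ler_wpM2r ?sqr_ge0 //; nra.
Qed.

Lemma local_lower f g u v A1 B1 A2 B2 e : 0 < e ->
  has_partials f u v A1 B1 -> has_partials g u v A2 B2 -> A1 * B2 - B1 * A2 != 0 ->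
  exists2 d, 0 < d & forall x y s, 0 < s -> s < d -> square x y s (u, v) ->
    (forall u' v', square x y s (u', v') -> local_diffeo f g u' v') ->
    (((`|A1 * B2 - B1 * A2| - e) * s ^+ 2)%:E <= mu2 (plane_map f g @` square x y s))%E.
Proof.
move=> e0 hf hg; set D := A1 * B2 - B1 * A2 => D0.
have h1 := has_partials_lin (B2 / D) (- B1 / D) hf hg.
have h2 := has_partials_lin (- A2 / D) (A1 / D) hf hg.
have e' : 0 < e / `|D| by rewrite divr_gt0 // normr_gt0.
have k1 : B2 / D * A1 + - B1 / D * A2 = 1 by rewrite /D; field; exact: D0.
have k2 : B2 / D * B1 + - B1 / D * B2 = 0 by rewrite /D; field; exact: D0.
have k3 : - A2 / D * A1 + A1 / D * A2 = 0 by rewrite /D; field; exact: D0.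
have k4 : - A2 / D * B1 + A1 / D * B2 = 1 by rewrite /D; field; exact: D0.
rewrite k1 k2 in h1; rewrite k3 k4 in h2.
have [d d0 hd] := local_lower_id e' h1 h2.
exists d => // x y s s0 sd sq hp.
have kD : (B2 / D) * (A1 / D) - (- B1 / D) * (- A2 / D) = D^-1.
  by rewrite /D; field; exact: D0.
pose G1 x y := B2 / D * f x y + - B1 / D * g x y.
pose G2 x y := - A2 / D * f x y + A1 / D * g x y.
have hp' u' v' : square x y s (u', v') -> local_diffeo G1 G2 u' v'.
  move=> /hp[a1 [b1 [a2 [b2 [l1 l2 l3]]]]].
  exists (B2 / D * a1 + - B1 / D * a2), (B2 / D * b1 + - B1 / D * b2).
  exists (- A2 / D * a1 + A1 / D * a2), (- A2 / D * b1 + A1 / D * b2).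
  split; [exact: has_partials_lin|exact: has_partials_lin|].
  have := mulf_neq0 (invr_neq0 D0) l3; rewrite -[X in X * _ != 0]kD; congr (_ != 0); ring.
have mG : measurable (plane_map G1 G2 @` square x y s : set RR).
  apply: compact_measurable2; apply: continuous_image_compact2; last exact: compact_square.
  by move=> u' v' /hp'[a1 [b1 [a2 [b2 [l1 l2 l3]]]]]; exists a1, b1, a2, b2.
rewrite (@mu2_lin_image _ f g (B2 / D) (- B1 / D) (- A2 / D) (A1 / D)); last 2 first.
- by rewrite kD invr_neq0.
- exact: mG.
rewrite kD normfV invrK.
have := hd x y s s0 sd sq hp' mG.
have Dp : (0 <= `|D|%:E)%E by rewrite lee_fin.
move=> /(lee_wpmul2l Dp); apply: le_trans.
rewrite -EFinM lee_fin [X in _ <= X]mulrA ler_wpM2r ?sqr_ge0 //.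
by rewrite mulrBr mulr1 mulrCA divff ?normr_eq0 // mulr1.
Qed.

End LowerEstimate.

(** * Area of the image of a square *)

Section AreaOfImage.
Variable R : realType.
Local Notation mu := (@lebesgue_measure R).
Local Notation RR := (measurableTypeR R * measurableTypeR R)%type.
Local Notation mu2 := ((mu \x mu)%E : set RR -> \bar R).

Definition has_slope (N : R -> R) (x k : R) := forall e : R, 0 < e ->
  exists2 d, 0 < d & forall x', `|x' - x| <= d -> `|N x' - N x - k * (x' - x)| <= e * `|x' - x|.

(** The straddle lemma: the increment is controlled over every short interval around [u], not only
    over those with [u] as an end, by subtracting the expansions at [u] of the two end values. *)
Lemma has_slope_straddle N u k e : has_slope N u k -> 0 < e ->
  exists2 d, 0 < d & forall x s, 0 < s -> s < d -> x <= u -> u <= x + s ->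
    `|N (x + s) - N x - k * s| <= e * s.
Proof.
move=> hN e0; have [d d0 hd] := hN e e0; exists d => // x s s0 sd xu us.
have a1 : `|x - u| = u - x by rewrite ler0_norm ?opprB // subr_le0.
have a2 : `|x + s - u| = x + s - u by rewrite ger0_norm // subr_ge0.
have := hd x; have := hd (x + s); rewrite a1 a2 => h1 h2.
have {h1}h1 := h1 ltac:(lra); have {h2}h2 := h2 ltac:(lra).
have -> : N (x + s) - N x - k * s =
  (N (x + s) - N u - k * (x + s - u)) - (N x - N u - k * (x - u)) by ring.
apply: le_trans (ler_normB _ _) _; lra.
Qed.

Lemma has_slope0 (x : R) : has_slope (fun=> 0) x 0.
Proof. by move=> e e0; exists 1 => // x' _; rewrite subrr mul0r subr0 normr0 mulr_ge0 // ltW. Qed.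

(** Removing the null set [Z] makes the two sets disjoint without changing their measures. *)
Lemma measureU_ge (A B Z : set RR) : measurable A -> measurable B -> measurable Z ->
  mu2 Z = 0 -> A `&` B `<=` Z -> (mu2 A + mu2 B <= mu2 (A `|` B))%E.
Proof.
move=> mA mB mZ Z0 ABZ.
have dZ C : measurable C -> mu2 C = mu2 (C `\` Z).
  move=> mC; rewrite (measureDI _ mC mZ) (@subset_measure0 _ _ _ _ (C `&` Z) Z) ?adde0 //.
  exact: measurableI.
rewrite (dZ A) // (dZ B) //.
have <- : mu2 ((A `\` Z) `|` (B `\` Z)) = (mu2 (A `\` Z) + mu2 (B `\` Z))%E.
  apply: measureU; [exact: measurableD|exact: measurableD|].
  by apply/seteqP; split => // p [[Ap nZ] [Bp _]]; apply: nZ; exact: ABZ.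
apply: le_measure; rewrite ?inE.
- by apply: measurableU; exact: measurableD.
- exact: measurableU.
- by move=> p [[? _]|[? _]]; [left|right].
Qed.

Section Squares.
Variables (f g : R -> R -> R) (x0 y0 s0 : R).
Hypothesis s0_gt0 : 0 < s0.
Variables (A1 B1 A2 B2 : R -> R -> R).
Hypothesis hf : forall u v, square x0 y0 s0 (u, v) -> has_partials f u v (A1 u v) (B1 u v).
Hypothesis hg : forall u v, square x0 y0 s0 (u, v) -> has_partials g u v (A2 u v) (B2 u v).
Variables (K N : R -> R).
Hypothesis hN : forall u, x0 <= u -> u <= x0 + s0 -> has_slope N u (K u).
Local Notation F := (plane_map f g).
Let J u v := A1 u v * B2 u v - B1 u v * A2 u v.

Let subsquare x y s : x0 <= x -> x + s <= x0 + s0 -> y0 <= y -> y + s <= y0 + s0 ->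
  square x y s `<=` square x0 y0 s0.
Proof. by move=> ? ? ? ? [u v] /squareP[? ? ? ?]; apply/squareP; split; lra. Qed.

Let measurable_img (Q : set (R * R)) : compact Q -> Q `<=` square x0 y0 s0 ->
  measurable (F @` Q : set RR).
Proof.
move=> cQ Qs; apply: compact_measurable2; apply: continuous_image_compact2 cQ.
move=> u v /Qs h; exists (A1 u v), (B1 u v), (A2 u v), (B2 u v).
by split; [exact: hf|exact: hg].
Qed.

Lemma square_split (x y s : R) : 0 < s -> square x y (s + s) =
  (square x y s `|` square (x + s) y s) `|` (square x (y + s) s `|` square (x + s) (y + s) s).
Proof.
move=> sp; apply/seteqP; split => -[u v]; last first.
  by move=> [[|]|[|]] /squareP[? ? ? ?]; apply/squareP; split; lra.
move=> /squareP[h1 h2 h3 h4].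
have [ux|ux] := leP u (x + s); have [vy|vy] := leP v (y + s).
- by left; left; apply/squareP; split; lra.
- by right; left; apply/squareP; split; lra.
- by left; right; apply/squareP; split; lra.
- by right; right; apply/squareP; split; lra.
Qed.

(** [K] depends on the first coordinate only, so [s0 * (N (x0 + s0) - N x0)] is the integral of [K]
    over the square. *)
Lemma area_image_le : (forall u v, square x0 y0 s0 (u, v) -> `|J u v| <= K u) ->
  (mu2 (F @` square x0 y0 s0) <= (s0 * (N (x0 + s0) - N x0))%:E)%E.
Proof.
move=> JK; apply/lee_addgt0Pr => e e0; rewrite -EFinD.
pose c := e / s0 ^+ 2.
have c0 : 0 < c by rewrite divr_gt0 // exprn_gt0.
have ce : c * s0 ^+ 2 = e by rewrite /c mulfVK // gt_eqF // exprn_gt0.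
rewrite -ce.
(* Both terms on the right are additive when a square is quartered; the slack [c * s^2] absorbs two
   local errors of [c / 2 * s^2], that of the map and that of [N]. *)
pose G x y s := (mu2 (F @` square x y s) <= (s * (N (x + s) - N x) + c * s ^+ 2)%:E)%E.
apply: (square_induction (G := G)) => //.
  move=> x y s sp x1 x2 y1 y2 G1 G2 G3 G4; rewrite /G square_split // !image_setU.
  have m1 : measurable (F @` square x y s : set RR).
    by apply: measurable_img; [exact: compact_square|apply: subsquare; lra].
  have m2 : measurable (F @` square (x + s) y s : set RR).
    by apply: measurable_img; [exact: compact_square|apply: subsquare; lra].
  have m3 : measurable (F @` square x (y + s) s : set RR).
    by apply: measurable_img; [exact: compact_square|apply: subsquare; lra].
  have m4 : measurable (F @` square (x + s) (y + s) s : set RR).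
    by apply: measurable_img; [exact: compact_square|apply: subsquare; lra].
  apply: le_trans (measureU2 _ (measurableU _ _ m1 m2) (measurableU _ _ m3 m4)) _.
  apply: le_trans (leeD (measureU2 _ m1 m2) (measureU2 _ m3 m4)) _.
  apply: le_trans (leeD (leeD G1 G2) (leeD G3 G4)) _.
  rewrite -!EFinD lee_fin -addrA; rewrite le_eqVlt; apply/orP; left; apply/eqP.
  by rewrite -!addrA; ring.
move=> u v suv; have /squareP[xu us yv vs] := suv.
have c2 : 0 < c / 2 by rewrite divr_gt0.
have [d1 d10 h1] := local_upper c2 (hf suv) (hg suv).
have [d2 d20 h2] := has_slope_straddle (hN xu us) c2.
exists (Num.min d1 d2); first by rewrite lt_min d10.
move=> x y s sp; rewrite lt_min => /andP[sd1 sd2] x1 x2 y1 y2 sq.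
have ss := subsquare x1 x2 y1 y2.
apply: le_trans (h1 x y s sp sd1 sq _) _.
  move=> u' v' /ss h; exists (A1 u' v'), (B1 u' v'), (A2 u' v'), (B2 u' v').
  by split; [exact: hf|exact: hg].
have /squareP[xu1 us1 yv1 vs1] := sq.
have := h2 x s sp sd2 xu1 us1; rewrite ler_norml lee_fin => /andP[k1 _].
have := JK _ _ suv; rewrite /J => k2.
have k3 : (`|A1 u v * B2 u v - B1 u v * A2 u v| + c / 2) * s ^+ 2 <= (K u + c / 2) * s ^+ 2.
  by rewrite ler_wpM2r ?sqr_ge0 // lerD2r.
apply: le_trans k3 _.
have k4 : s * (- (c / 2 * s)) <= s * (N (x + s) - N x - K u * s) by rewrite ler_wpM2l // ltW.
lra.
Qed.


End Squares.

(** * Null edges and the lower estimate *)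

Section Edges.
Variables (f g : R -> R -> R) (x0 y0 s0 : R).
Variables (A1 B1 A2 B2 : R -> R -> R).
Hypothesis hf : forall u v, square x0 y0 s0 (u, v) -> has_partials f u v (A1 u v) (B1 u v).
Hypothesis hg : forall u v, square x0 y0 s0 (u, v) -> has_partials g u v (A2 u v) (B2 u v).
Local Notation F := (plane_map f g).

(** The image of an edge is the image of a whole square under a map that ignores one variable. Its
    Jacobian vanishes, and the upper estimate applies with [K = N = 0]. *)
Lemma vertical_edge_null c y s : 0 < s -> x0 <= c -> c <= x0 + s0 -> y0 <= y ->
  y + s <= y0 + s0 -> mu2 (F @` ([set c] `*` `[y, y + s])) = 0.
Proof.
move=> sp xc cx yy ys.
have -> : F @` ([set c] `*` `[y, y + s]) =
    plane_map (fun _ v => f c v) (fun _ v => g c v) @` square 0 y s.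
  apply/seteqP; split => [_ [[u v] [/= -> hv] <-]|_ [[u v] [/= hu hv] <-]].
    by exists (0, v) => //; split => //=; rewrite in_itv /=; apply/andP; split; lra.
  by exists (c, v).
apply/eqP; rewrite -measure_le0.
have -> : 0%E = (s * (0 - 0))%:E :> \bar R by rewrite subrr mulr0.
have key h A B : (forall u v, square x0 y0 s0 (u, v) -> has_partials h u v (A u v) (B u v)) ->
   forall u v, square 0 y s (u, v) -> has_partials (fun _ v => h c v) u v 0 (B c v).
  move=> hh u v /squareP[h1 h2 h3 h4] e e0.
  have /hh/(_ e e0)[d d0 hd] : square x0 y0 s0 (c, v) by apply/squareP; split; lra.
  exists d => // u' v' _ hv; have := hd c v'; rewrite subrr normr0 mulr0 mul0r subr0 add0r.
  move=> /(_ (ltW d0) hv) /le_trans; apply.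
  by rewrite ler_pM2l // lerDr.
apply: (@area_image_le _ _ _ _ _ sp _ _ _ _ (key _ _ _ hf) (key _ _ _ hg) (fun=> 0) (fun=> 0)).
  by move=> *; exact: has_slope0.
by move=> u v _; rewrite mul0r mulr0 subr0 normr0.
Qed.

Lemma horizontal_edge_null c x s : 0 < s -> y0 <= c -> c <= y0 + s0 -> x0 <= x ->
  x + s <= x0 + s0 -> mu2 (F @` (`[x, x + s] `*` [set c])) = 0.
Proof.
move=> sp xc cx yy ys.
have -> : F @` (`[x, x + s] `*` [set c]) =
    plane_map (fun u _ => f u c) (fun u _ => g u c) @` square x 0 s.
  apply/seteqP; split => [_ [[u v] [/= hu ->] <-]|_ [[u v] [/= hu hv] <-]].
    by exists (u, 0) => //; split => //=; rewrite in_itv /=; apply/andP; split; lra.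
  by exists (u, c).
apply/eqP; rewrite -measure_le0.
have -> : 0%E = (s * (0 - 0))%:E :> \bar R by rewrite subrr mulr0.
have key h A B : (forall u v, square x0 y0 s0 (u, v) -> has_partials h u v (A u v) (B u v)) ->
   forall u v, square x 0 s (u, v) -> has_partials (fun u _ => h u c) u v (A u c) 0.
  move=> hh u v /squareP[h1 h2 h3 h4] e e0.
  have /hh/(_ e e0)[d d0 hd] : square x0 y0 s0 (u, c) by apply/squareP; split; lra.
  exists d => // u' v' hu _; have := hd u' c; rewrite subrr normr0 mulr0 mul0r !subr0 addr0.
  move=> /(_ hu (ltW d0)) /le_trans; apply.
  by rewrite ler_pM2l // lerDl.
apply: (@area_image_le _ _ _ _ _ sp _ _ _ _ (key _ _ _ hf) (key _ _ _ hg) (fun=> 0) (fun=> 0)).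
  by move=> *; exact: has_slope0.
by move=> u v _; rewrite mul0r mulr0 subr0 normr0.
Qed.

Let measurable_img (Q : set (R * R)) : compact Q -> Q `<=` square x0 y0 s0 ->
  measurable (F @` Q : set RR).
Proof.
move=> cQ Qs; apply: compact_measurable2; apply: continuous_image_compact2 cQ.
move=> u v /Qs h; exists (A1 u v), (B1 u v), (A2 u v), (B2 u v).
by split; [exact: hf|exact: hg].
Qed.

Hypothesis finj : forall u v u' v', x0 < u -> u < x0 + s0 -> y0 < v -> v < y0 + s0 ->
  x0 < u' -> u' < x0 + s0 -> y0 < v' -> v' < y0 + s0 ->
  f u v = f u' v' -> g u v = g u' v' -> u = u' /\ v = v'.

(** The edges of the four quarters. Injectivity is assumed in the open square only, since polar
    coordinates collapse or glue sides, so the images of the quarters are disjoint only off the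
    image of these edges. *)
Let grid x y s : set (R * R) :=
  (([set x] `*` `[y, y + (s + s)]) `|` ([set x + s] `*` `[y, y + (s + s)]) `|`
   ([set x + (s + s)] `*` `[y, y + (s + s)])) `|`
  ((`[x, x + (s + s)] `*` [set y]) `|` (`[x, x + (s + s)] `*` [set y + s]) `|`
   (`[x, x + (s + s)] `*` [set y + (s + s)])).

Let grid_null x y s : 0 < s -> x0 <= x -> x + (s + s) <= x0 + s0 -> y0 <= y ->
     y + (s + s) <= y0 + s0 ->
  measurable (F @` grid x y s : set RR) /\ mu2 (F @` grid x y s) = 0.
Proof.
move=> sp x1 x2 y1 y2; have ssp : 0 < s + s by lra.
have mv c : x0 <= c -> c <= x0 + s0 -> measurable (F @` ([set c] `*` `[y, y + (s + s)]) : set RR).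
  move=> c1 c2; apply: measurable_img.
    by apply: compact_setX; [exact: compact_set1|exact: segment_compact].
  move=> [u v] [/= -> ]; rewrite in_itv /= => /andP[? ?].
  by apply/squareP; split; lra.
have mh c : y0 <= c -> c <= y0 + s0 -> measurable (F @` (`[x, x + (s + s)] `*` [set c]) : set RR).
  move=> c1 c2; apply: measurable_img.
    by apply: compact_setX; [exact: segment_compact|exact: compact_set1].
  move=> [u v] [/= + ->]; rewrite in_itv /= => /andP[? ?].
  by apply/squareP; split; lra.
rewrite /grid !image_setU.
have a1 : x0 <= x + s by lra.
have a2 : x + s <= x0 + s0 by lra.
have a3 : x0 <= x + (s + s) by lra.
have a4 : x <= x0 + s0 by lra.
have b1 : y0 <= y + s by lra.
have b2 : y + s <= y0 + s0 by lra.
have b3 : y0 <= y + (s + s) by lra.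
have b4 : y <= y0 + s0 by lra.
split; first by do ?[apply: measurableU]; (apply: mv || apply: mh).
rewrite measureU0; [|by do ?[apply: measurableU]; (apply: mv || apply: mh)..|].
  rewrite measureU0; [|by do ?[apply: measurableU]; (apply: mv || apply: mh)..|].
    rewrite measureU0; [|by do ?[apply: measurableU]; (apply: mv || apply: mh)..|].
      exact: vertical_edge_null.
    exact: vertical_edge_null.
  exact: vertical_edge_null.
rewrite measureU0; [|by do ?[apply: measurableU]; (apply: mv || apply: mh)..|].
  rewrite measureU0; [|by do ?[apply: measurableU]; (apply: mv || apply: mh)..|].
    exact: horizontal_edge_null.
  exact: horizontal_edge_null.
exact: horizontal_edge_null.
Qed.

Let cell_interior x y s a b u v : 0 < s -> (a = 0 \/ a = s) -> (b = 0 \/ b = s) ->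
  square (x + a) (y + b) s (u, v) -> ~ grid x y s (u, v) ->
  [/\ x + a < u, u < x + a + s, y + b < v & v < y + b + s].
Proof.
move=> sp ha hb /squareP[h1 h2 h3 h4] ng.
have hu : `[x, x + (s + s)]%classic u by rewrite /= in_itv /=; apply/andP; case: ha => ?; split; lra.
have hv : `[y, y + (s + s)]%classic v by rewrite /= in_itv /=; apply/andP; case: hb => ?; split; lra.
have ux k : (k = x \/ k = x + s \/ k = x + (s + s)) -> u <> k.
  move=> hk uk; apply: ng; left; rewrite uk.
  by case: hk => [->|[->|->]]; [left; left|left; right|right].
have vy k : (k = y \/ k = y + s \/ k = y + (s + s)) -> v <> k.
  move=> hk uk; apply: ng; right; rewrite uk.
  by case: hk => [->|[->|->]]; [left; left|left; right|right].
split; rewrite lt_neqAle; apply/andP; split => //; apply/eqP.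
- by apply/nesym/ux; case: ha => ->; [left|right; left]; ring.
- by apply/ux; case: ha => ->; [right; left|right; right]; ring.
- by apply/nesym/vy; case: hb => ->; [left|right; left]; ring.
- by apply/vy; case: hb => ->; [right; left|right; right]; ring.
Qed.

(** Off the grid both points lie in open quarters, hence in the open square. Injectivity identifies
    them, but different open quarters are disjoint. *)
Let cells_overlap x y s a b a' b' : 0 < s -> x0 <= x -> x + (s + s) <= x0 + s0 -> y0 <= y ->
     y + (s + s) <= y0 + s0 ->
  (a = 0 \/ a = s) -> (b = 0 \/ b = s) ->
  (a' = 0 \/ a' = s) -> (b' = 0 \/ b' = s) -> (a, b) <> (a', b') ->
  (F @` square (x + a) (y + b) s) `&` (F @` square (x + a') (y + b') s) `<=` F @` grid x y s.
Proof.
move=> sp x1 x2 y1 y2 ha hb ha' hb' ne p [[[u v] suv <-] [[u' v'] suv' e]].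
have [gu|gu] := pselect (grid x y s (u, v)); first by exists (u, v).
have [gu'|gu'] := pselect (grid x y s (u', v')); first by rewrite -e; exists (u', v').
exfalso.
have [k1 k2 k3 k4] := cell_interior sp ha hb suv gu.
have [l1 l2 l3 l4] := cell_interior sp ha' hb' suv' gu'.
have ia : 0 <= a /\ a <= s by case: ha => ->; split; lra.
have ib : 0 <= b /\ b <= s by case: hb => ->; split; lra.
have ia' : 0 <= a' /\ a' <= s by case: ha' => ->; split; lra.
have ib' : 0 <= b' /\ b' <= s by case: hb' => ->; split; lra.
case: e => e1 e2.
have [||||||||eu ev] := @finj u v u' v' _ _ _ _ _ _ _ _ (esym e1) (esym e2); try lra.
apply: ne; congr pair.
  by case: ha ha' => ha [] ha'; lra.
by case: hb hb' => hb [] hb'; lra.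
Qed.

Variables (K N : R -> R).
Hypothesis s0_gt0 : 0 < s0.
Hypothesis hN : forall u, x0 <= u -> u <= x0 + s0 -> has_slope N u (K u).
Hypothesis Kpos : forall u, x0 <= u -> u <= x0 + s0 -> 0 < K u ->
  exists2 d, 0 < d & forall u', `|u' - u| < d -> 0 < K u'.

(** Same induction as for the upper estimate, with superadditivity in place of subadditivity. The
    local estimate needs an invertible differential on a whole small square; [Kpos] provides it,
    because the Jacobian is at least [K], which stays positive near a point where it is positive. *)
Lemma area_image_ge : (forall u v, square x0 y0 s0 (u, v) ->
    K u <= `|A1 u v * B2 u v - B1 u v * A2 u v|) ->
  ((s0 * (N (x0 + s0) - N x0))%:E <= mu2 (F @` square x0 y0 s0))%E.
Proof.
move=> JK; apply/lee_addgt0Pr => e e0; rewrite -leeBlDr // -EFinB.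
pose c := e / s0 ^+ 2.
have c0 : 0 < c by rewrite divr_gt0 // exprn_gt0.
have ce : c * s0 ^+ 2 = e by rewrite /c mulfVK // gt_eqF // exprn_gt0.
rewrite -ce.
pose G x y s := ((s * (N (x + s) - N x) - c * s ^+ 2)%:E <= mu2 (F @` square x y s))%E.
have sub x y s : x0 <= x -> x + s <= x0 + s0 -> y0 <= y -> y + s <= y0 + s0 ->
  square x y s `<=` square x0 y0 s0.
  by move=> ? ? ? ? [u v] /squareP[? ? ? ?]; apply/squareP; split; lra.
rewrite -/(G x0 y0 s0).
apply: (@square_induction R G x0 y0 s0 s0_gt0).
  move=> x y s sp x1 x2 y1 y2 G1 G2 G3 G4; rewrite /G square_split // !image_setU.
  have m1 : measurable (F @` square x y s : set RR).
    by apply: measurable_img; [exact: compact_square|apply: sub; lra].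
  have m2 : measurable (F @` square (x + s) y s : set RR).
    by apply: measurable_img; [exact: compact_square|apply: sub; lra].
  have m3 : measurable (F @` square x (y + s) s : set RR).
    by apply: measurable_img; [exact: compact_square|apply: sub; lra].
  have m4 : measurable (F @` square (x + s) (y + s) s : set RR).
    by apply: measurable_img; [exact: compact_square|apply: sub; lra].
  have [mZ Z0] := grid_null sp x1 x2 y1 y2.
  have ov a b a' b' := @cells_overlap x y s a b a' b' sp x1 x2 y1 y2.
  have s0' : 0 <> s by move=> s0'; rewrite -s0' ltxx in sp.
  have z : 0 = 0 :> R \/ 0 = s by left.
  have w : s = 0 \/ s = s by right.
  have o12 := ov 0 0 s 0 z z w z ltac:(by case).
  have o13 := ov 0 0 0 s z z z w ltac:(by case).
  have o14 := ov 0 0 s s z z w w ltac:(by case).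
  have o23 := ov s 0 0 s w z z w ltac:(by case => /esym).
  have o24 := ov s 0 s s w z w w ltac:(by case).
  have o34 := ov 0 s s s z w w w ltac:(by case).
  rewrite !addr0 in o12 o13 o14 o23 o24 o34.
  apply: le_trans (measureU_ge (measurableU _ _ m1 m2) (measurableU _ _ m3 m4) mZ Z0 _); last first.
    by move=> p [[?|?] [?|?]]; [exact: o13|exact: o14|exact: o23|exact: o24].
  apply: le_trans (leeD (measureU_ge m1 m2 mZ Z0 o12) (measureU_ge m3 m4 mZ Z0 o34)).
  apply: le_trans (leeD (leeD G1 G2) (leeD G3 G4)).
  rewrite -!EFinD lee_fin -addrA; rewrite le_eqVlt; apply/orP; left; apply/eqP.
  by rewrite -!addrA; ring.
move=> u v suv; have /squareP[xu us yv vs] := suv.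
have c2 : 0 < c / 2 by rewrite divr_gt0.
have [d2 d20 h2] := has_slope_straddle (hN xu us) c2.
(* Where [K u <= 0] the differential may be singular, but then the left-hand side of [G] is at most
   [0] on small squares. *)
have [Ku|Ku] := leP (K u) 0.
  exists d2 => // x y s sp sd2 x1 x2 y1 y2 sq.
  have /squareP[xu1 us1 yv1 vs1] := sq.
  apply: (@le_trans _ _ 0%E); last exact: measure_ge0.
  have := h2 x s sp sd2 xu1 us1; rewrite ler_norml lee_fin => /andP[_ k1].
  have k4 : s * (N (x + s) - N x - K u * s) <= s * (c / 2 * s) by rewrite ler_wpM2l // ltW.
  have k5 : K u * s ^+ 2 <= 0 by rewrite mulr_le0_ge0 // sqr_ge0.
  have k6 : 0 <= c * s ^+ 2 by rewrite mulr_ge0 ?sqr_ge0 // ltW.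
  lra.
have [d3 d30 h3] := Kpos xu us Ku.
have D0 : A1 u v * B2 u v - B1 u v * A2 u v != 0.
  by rewrite -normr_gt0; apply: lt_le_trans Ku _; exact: JK.
have [d1 d10 h1] := local_lower c2 (hf suv) (hg suv) D0.
exists (Num.min d1 (Num.min d2 d3)); first by rewrite !lt_min d10 d20.
move=> x y s sp; rewrite !lt_min => /andP[sd1 /andP[sd2 sd3]] x1 x2 y1 y2 sq.
have ss := sub _ _ _ x1 x2 y1 y2.
have /squareP[xu1 us1 yv1 vs1] := sq.
apply: le_trans (h1 x y s sp sd1 sq _); last first.
  move=> u' v' suv'; have h := ss _ suv'; exists (A1 u' v'), (B1 u' v'), (A2 u' v'), (B2 u' v').
  split; [exact: hf|exact: hg|].
  rewrite -normr_gt0; apply: lt_le_trans (JK _ _ h).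
  move/squareP : suv' => [? ? ? ?].
  by apply: h3; apply: le_lt_trans sd3; rewrite ler_norml; apply/andP; split; lra.
have := h2 x s sp sd2 xu1 us1; rewrite ler_norml lee_fin => /andP[_ k1].
have k3 : (K u - c / 2) * s ^+ 2 <= (`|A1 u v * B2 u v - B1 u v * A2 u v| - c / 2) * s ^+ 2.
  by rewrite ler_wpM2r ?sqr_ge0 // lerD2r; exact: JK.
apply: le_trans k3.
have k4 : s * (N (x + s) - N x - K u * s) <= s * (c / 2 * s) by rewrite ler_wpM2l // ltW.
lra.
Qed.

End Edges.
End AreaOfImage.

(** * Calculus of partial derivatives *)

Section PartialsCalculus.
Variable R : realType.
Implicit Types (f g h : R -> R -> R) (u v : R).

Lemma has_partials_eq f f' u v A B A' B' :
  (exists2 d, 0 < d & forall u' v', `|u' - u| <= d -> `|v' - v| <= d -> f u' v' = f' u' v') ->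
  A = A' -> B = B' -> has_partials f u v A B -> has_partials f' u v A' B'.
Proof.
move=> [d0 d00 ff'] <- <- hf e e0; have [d dp hd] := hf e e0.
exists (Num.min d d0); first by rewrite lt_min dp.
move=> u' v'; rewrite !le_min => /andP[u1 u2] /andP[v1 v2].
have z x : `|x - x| <= d0 by rewrite subrr normr0 ltW.
by rewrite -(ff' u' v') // -(ff' u v) //; exact: hd.
Qed.

Lemma has_partials_cast f u v A B A' B' :
  has_partials f u v A B -> A = A' -> B = B' -> has_partials f u v A' B'.
Proof. by move=> h <- <-. Qed.

Lemma has_partials_lip f u v A B : has_partials f u v A B ->
  exists2 d, 0 < d & forall u' v', `|u' - u| <= d -> `|v' - v| <= d ->
    `|f u' v' - f u v| <= (`|A| + `|B| + 1) * (`|u' - u| + `|v' - v|).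
Proof.
move=> hf; have [d dp hd] := hf 1 ltr01; exists d => // u' v' hu hv.
have {hd} := hd _ _ hu hv; set X := _ - _ - _ - _ => hX.
have -> : f u' v' - f u v = X + A * (u' - u) + B * (v' - v) by rewrite /X; ring.
apply: le_trans (ler_normD _ _) _.
apply: le_trans (lerD (ler_normD _ _) (lexx _)) _; rewrite !normrM.
have : 0 <= `|A| * `|v' - v| by rewrite mulr_ge0.
have : 0 <= `|B| * `|u' - u| by rewrite mulr_ge0.
lra.
Qed.

Lemma has_partials_comp h f g u v HA HB A1 B1 A2 B2 :
  has_partials h (f u v) (g u v) HA HB ->
  has_partials f u v A1 B1 -> has_partials g u v A2 B2 ->
  has_partials (fun x y => h (f x y) (g x y)) u v
    (HA * A1 + HB * A2) (HA * B1 + HB * B2).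
Proof.
move=> hh hf hg e e0.
have [df df0 Lf] := has_partials_lip hf.
have [dg dg0 Lg] := has_partials_lip hg.
have C10 : 0 <= `|A1| + `|B1| by rewrite addr_ge0.
have C20 : 0 <= `|A2| + `|B2| by rewrite addr_ge0.
move: Lf Lg C10 C20; set C1 := `|A1| + `|B1|; set C2 := `|A2| + `|B2| => Lf Lg C10 C20.
pose C := C1 + C2 + 2.
have C0 : 0 < C by rewrite /C; lra.
have [dh dh0 Hh] := hh (e / (2 * C)) ltac:(by rewrite divr_gt0 // mulr_gt0).
have H0 : 0 < `|HA| + `|HB| + 1 by have := normr_ge0 HA; have := normr_ge0 HB; lra.
pose e2 := e / (2 * (`|HA| + `|HB| + 1)).
have e20 : 0 < e2 by rewrite divr_gt0 // mulr_gt0.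
have [d1 d10 H1] := hf e2 e20; have [d2 d20 H2] := hg e2 e20.
pose d := Num.min (Num.min df dg) (Num.min (Num.min d1 d2) (dh / (2 * C))).
have dp : 0 < d by rewrite !lt_min df0 dg0 d10 d20 divr_gt0 // mulr_gt0.
exists d => // u' v'; rewrite !le_min.
move=> /andP[/andP[u1 u2] /andP[/andP[u3 u4] u5]] /andP[/andP[v1 v2] /andP[/andP[v3 v4] v5]].
have {Lf} := Lf _ _ u1 v1; have {Lg} := Lg _ _ u2 v2.
have {H1} := H1 _ _ u3 v3; have {H2} := H2 _ _ u4 v4.
set t := `|u' - u| + `|v' - v|.
have t0 : 0 <= t by rewrite addr_ge0.
have tdh : C * t <= dh.
  rewrite ler_pdivlMr ?mulr_gt0 // in u5; rewrite ler_pdivlMr ?mulr_gt0 // in v5.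
  rewrite /t; lra.
set E2 := g u' v' - _ - _ - _; set E1 := f u' v' - _ - _ - _ => hE2 hE1 Lg Lf.
have b1 : `|f u' v' - f u v| <= dh.
  apply: le_trans Lf _; apply: le_trans tdh; rewrite ler_wpM2r // /C; lra.
have b2 : `|g u' v' - g u v| <= dh.
  apply: le_trans Lg _; apply: le_trans tdh; rewrite ler_wpM2r // /C; lra.
have {Hh} := Hh _ _ b1 b2.
set EH := h _ _ - _ - _ - _ => hEH.
have -> : h (f u' v') (g u' v') - h (f u v) (g u v) - (HA * A1 + HB * A2) * (u' - u)
   - (HA * B1 + HB * B2) * (v' - v) = EH + HA * E1 + HB * E2.
  by rewrite /EH /E1 /E2; ring.
apply: le_trans (ler_normD _ _) _.
apply: le_trans (lerD (ler_normD _ _) (lexx _)) _; rewrite !normrM.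
have k1 : `|EH| <= e / 2 * t.
  apply: le_trans hEH _.
  have := lerD Lf Lg; rewrite -mulrDl => k.
  apply: le_trans (ler_wpM2l _ k) _; first by rewrite divr_ge0 ?mulr_ge0 ?ltW.
  rewrite mulrA ler_wpM2r // (_ : C1 + 1 + (C2 + 1) = C); last by rewrite /C; ring.
  by rewrite invfM mulrA mulfVK // gt_eqF.
have k2 : `|HA| * `|E1| <= `|HA| * (e2 * t) by rewrite ler_wpM2l.
have k3 : `|HB| * `|E2| <= `|HB| * (e2 * t) by rewrite ler_wpM2l.
have k4 : (`|HA| + `|HB| + 1) * (e2 * t) = e / 2 * t.
  by rewrite /e2; field; rewrite gt_eqF.
have k5 : 0 <= e2 * t by rewrite mulr_ge0 // ltW.
lra.
Qed.

Lemma has_partials_cst (c : R) u v : has_partials (fun _ _ => c) u v 0 0.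
Proof.
move=> e e0; exists 1 => // u' v' _ _.
by rewrite !mul0r subrr !subr0 normr0 mulr_ge0 ?addr_ge0 // ltW.
Qed.

Lemma has_partials_fst u v : has_partials (fun x _ => x) u v 1 0.
Proof.
move=> e e0; exists 1 => // u' v' _ _.
by rewrite !mul0r mul1r subrr !subr0 normr0 mulr_ge0 ?addr_ge0 // ltW.
Qed.

Lemma has_partials_snd u v : has_partials (fun _ y => y) u v 0 1.
Proof.
move=> e e0; exists 1 => // u' v' _ _.
by rewrite !mul0r mul1r subr0 subrr normr0 mulr_ge0 ?addr_ge0 // ltW.
Qed.

Lemma has_partials_prod u v : has_partials (fun x y => x * y) u v v u.
Proof.
move=> e e0; exists e => // u' v' hu hv.
have -> : u' * v' - u * v - v * (u' - u) - u * (v' - v) = (u' - u) * (v' - v) by ring.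
by rewrite normrM; apply: ler_pM => //; rewrite lerDr.
Qed.

Lemma has_partialsM f g u v A1 B1 A2 B2 :
  has_partials f u v A1 B1 -> has_partials g u v A2 B2 ->
  has_partials (fun x y => f x y * g x y) u v
    (g u v * A1 + f u v * A2) (g u v * B1 + f u v * B2).
Proof. exact: (has_partials_comp (has_partials_prod _ _)). Qed.

Lemma has_partialsD f g u v A1 B1 A2 B2 :
  has_partials f u v A1 B1 -> has_partials g u v A2 B2 ->
  has_partials (fun x y => f x y + g x y) u v (A1 + A2) (B1 + B2).
Proof.
move=> hf hg; apply: has_partials_eq (has_partials_lin 1 1 hf hg).
- by exists 1 => // *; rewrite !mul1r.
- by rewrite !mul1r.
- by rewrite !mul1r.
Qed.

Lemma has_partialsB f g u v A1 B1 A2 B2 :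
  has_partials f u v A1 B1 -> has_partials g u v A2 B2 ->
  has_partials (fun x y => f x y - g x y) u v (A1 - A2) (B1 - B2).
Proof.
move=> hf hg; apply: has_partials_eq (has_partials_lin 1 (- 1) hf hg).
- by exists 1 => // *; rewrite !mul1r mulN1r.
- by rewrite !mul1r mulN1r.
- by rewrite !mul1r mulN1r.
Qed.

(** The bridge to [is_derive], through which the known derivatives of [expR], [cos], [ln] and [atan]
    and Rolle's theorem become available. *)
Lemma is_derive_slope (p : R -> R) (x k : R) : is_derive x 1 p k <-> has_slope p x k.
Proof.
split => [[dp pk]|hs].
  move: dp; rewrite /derivable => dp.
  have := cvgP _ dp; have := dp; move=> /cvg_ex[l hl].
  have lk : l = k by rewrite -pk; apply/esym/cvg_lim; [exact: Rhausdorff|exact: hl].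
  rewrite {l}lk in hl; move=> _ e e0.
  move/cvgrPdist_le : hl => /(_ e e0) /nbhs_ballP[d /= d0 hd].
  exists (d / 2); first by rewrite divr_gt0.
  move=> x' hx; have [->|xx] := eqVneq x' x; first by rewrite !subrr mulr0 subr0 normr0 mulr0.
  have xx' : x' - x != 0 by rewrite subr_eq0.
  have := hd (x' - x).
  rewrite /= /ball /= sub0r normrN => /(_ _ xx') h.
  have {h}h := h ltac:(lra).
  move: h; rewrite /= [(x' - x) *: 1]mulr1 subrK.
  set q := _ *: _ => h.
  have -> : p x' - p x - k * (x' - x) = - ((k - q) * (x' - x)).
    by rewrite /q /GRing.scale /=; field.
  by rewrite normrN normrM ler_wpM2r.
have hl : h^-1 *: (p (h *: 1 + x) - p x) @[h --> 0^'] --> k.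
  apply/cvgrPdist_le => e e0; have [d d0 hd] := hs e e0.
  apply/nbhs_ballP; exists d => //= h /=; rewrite /= /ball /= sub0r normrN => hd1 h0.
  have := hd (x + h); rewrite [x + h]addrC addrK => /(_ (ltW hd1)) k1.
  rewrite [h *: 1]mulr1.
  have -> : k - h^-1 *: (p (h + x) - p x) = - (p (h + x) - p x - k * h) / h.
    by rewrite /GRing.scale /=; field.
  by rewrite normrM normrN normfV ler_pdivrMr ?normr_gt0.
split; first by apply/cvg_ex; exists k.
by apply/cvg_lim; [exact: Rhausdorff|exact: hl].
Qed.

Lemma has_partials_slope (p : R -> R) f u v k A B : has_slope p (f u v) k ->
  has_partials f u v A B -> has_partials (fun x y => p (f x y)) u v (k * A) (k * B).
Proof.
move=> hp hf.
have hp' : has_partials (fun x _ => p x) (f u v) 0 k 0.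
  move=> e e0; have [d d0 hd] := hp e e0; exists d => // u' v' hu _.
  rewrite mul0r subr0; apply: le_trans (hd _ hu) _.
  by rewrite ler_pM2l // lerDl.
apply: has_partials_cast (has_partials_comp hp' hf (has_partials_cst 0 u v)) _ _.
- by rewrite mulr0 addr0.
- by rewrite mulr0 addr0.
Qed.

Lemma slope_of_partials (p : R -> R) u v A B :
  has_partials (fun x _ => p x) u v A B -> has_slope p u A.
Proof.
move=> hp e e0; have [d d0 hd] := hp e e0; exists d => // x' hx.
have := hd x' v hx; rewrite subrr normr0 mulr0 subr0 addr0.
by apply; exact: ltW.
Qed.

Lemma partials_of_slope (p : R -> R) u v A :
  has_slope p u A -> has_partials (fun x _ => p x) u v A 0.
Proof.
move=> hp; apply: has_partials_cast (has_partials_slope hp (has_partials_fst _ v)) _ _.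
  by rewrite mulr1.
by rewrite mulr0.
Qed.

Lemma partials_of_slope2 (p : R -> R) u v A :
  has_slope p v A -> has_partials (fun _ y => p y) u v 0 A.
Proof.
move=> hp; apply: has_partials_cast (has_partials_slope hp (has_partials_snd u _)) _ _.
  by rewrite mulr0.
by rewrite mulr1.
Qed.

Lemma has_slope_unique (p : R -> R) u A B : has_slope p u A -> has_slope p u B -> A = B.
Proof. by move=> /is_derive_slope[_ <-] /is_derive_slope[_ <-]. Qed.

Lemma has_slopeV (x : R) : x != 0 -> has_slope (fun y => y^-1) x (- x ^- 2).
Proof.
move=> x0; apply/is_derive_slope.
have := @is_deriveV R id x 1 1 x0 (is_derive_id _ _).
by rewrite -[X in is_derive _ _ _ X -> _]/(- x ^- 2 * 1) mulr1.
Qed.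

Lemma has_partialsV f u v A B : f u v != 0 -> has_partials f u v A B ->
  has_partials (fun x y => (f x y)^-1) u v (- f u v ^- 2 * A) (- f u v ^- 2 * B).
Proof. by move=> f0; apply: has_partials_slope (has_slopeV f0). Qed.

End PartialsCalculus.

(** * Complex derivatives *)

Section ComplexDerivative.
Variable R : realType.
Local Notation Re := (@complex.Re R).
Local Notation Im := (@complex.Im R).

Lemma cReD (z w : R[i]) : Re (z + w) = Re z + Re w. Proof. by case: z w => ? ? []. Qed.
Lemma cImD (z w : R[i]) : Im (z + w) = Im z + Im w. Proof. by case: z w => ? ? []. Qed.
Lemma cReB (z w : R[i]) : Re (z - w) = Re z - Re w. Proof. by case: z w => ? ? []. Qed.
Lemma cImB (z w : R[i]) : Im (z - w) = Im z - Im w. Proof. by case: z w => ? ? []. Qed.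
Lemma cReM (z w : R[i]) : Re (z * w) = Re z * Re w - Im z * Im w.
Proof. by case: z w => ? ? []. Qed.
Lemma cImM (z w : R[i]) : Im (z * w) = Re z * Im w + Im z * Re w.
Proof. by case: z w => ? ? [? ?] /=. Qed.
Lemma cRe_conj (z : R[i]) : Re z^* = Re z. Proof. by case: z. Qed.
Lemma cIm_conj (z : R[i]) : Im z^* = - Im z. Proof. by case: z. Qed.
Lemma complex_eta (z : R[i]) : (Re z +i* Im z)%C = z. Proof. by case: z. Qed.
Lemma complex_ext (z w : R[i]) : Re z = Re w -> Im z = Im w -> z = w.
Proof. by case: z w => ? ? [? ?] /= -> ->. Qed.

(* Complex differentiability as real differentiability of the components
   together with the Cauchy-Riemann equations. *)
Definition cdiff (h : R[i] -> R[i]) (z c : R[i]) :=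
  has_partials (fun x y => Re (h (x +i* y)%C)) (Re z) (Im z) (Re c) (- Im c) /\
  has_partials (fun x y => Im (h (x +i* y)%C)) (Re z) (Im z) (Im c) (Re c).

Lemma normc_ge_abs (z : R[i]) (e : R) : `|z| <= e%:C%C -> `|Re z| <= e /\ `|Im z| <= e.
Proof.
rewrite normc_def lecR => h.
have sq (a b : R) : `|a| <= Num.sqrt (a ^+ 2 + b ^+ 2).
  by rewrite -sqrtr_sqr ler_sqrt ?lerDl ?sqr_ge0 // addr_ge0 ?sqr_ge0.
split; apply: le_trans h; first exact: sq.
by rewrite addrC; exact: sq.
Qed.

Lemma normc_le_abs (z : R[i]) : `|z| <= (`|Re z| + `|Im z|)%:C%C.
Proof.
rewrite normc_def lecR -[leRHS]ger0_norm ?addr_ge0 // -sqrtr_sqr ler_sqrt ?sqr_ge0 //.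
rewrite sqrrD !real_normK ?num_real // addrAC lerDl.
by rewrite mulrn_wge0 // mulr_ge0.
Qed.

Lemma derivable_cdiff (h : R[i] -> R[i]) (z : R[i]) :
  derivable (h : (R[i])^o -> (R[i])^o) z 1 -> cdiff h z (cderiv h z).
Proof.
move=> dh; rewrite /cderiv derive1E; set L := (X in cdiff _ _ X).
have hL : (t : (R[i])^o)^-1 *: ((h : (R[i])^o -> (R[i])^o) (t *: 1 + z) - h z)
    @[t --> (0 : (R[i])^o)^'] --> L.
  exact: dh.
have key (e : R) : 0 < e -> exists2 d : R, 0 < d & forall w : R[i], `|Re w| <= d -> `|Im w| <= d ->
    `|h (z + w) - h z - L * w| <= (e * (`|Re w| + `|Im w|))%:C%C.
  move=> e0.
  have e0' : 0 < e%:C%C by rewrite ltcR.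
  move/cvgrPdist_le : hL => /(_ e%:C%C e0') /nbhs_ballP[d /= d0 hd].
  have [dI dR] : Im d = 0 /\ 0 < Re d by move: d0; rewrite ltcE => /andP[/eqP].
  (* A positive element of [R[i]] is real, so [d] is [Re d]; the factor [1 / 3] makes
     [|Re w| + |Im w| < d]. *)
  exists (Re d / 3); first by rewrite divr_gt0.
  move=> w wr wi; have [->|w0] := eqVneq w 0.
    by rewrite addr0 subrr mulr0 subr0 normr0 normr0 addr0 mulr0.
  have := hd w; rewrite /= /ball /= sub0r normrN => /(_ _ w0) hw.
  have {}hw : `|L - w^-1 *: (h (w *: 1 + z) - h z)| <= e%:C%C.
    apply: hw; apply: le_lt_trans (normc_le_abs w) _.
    rewrite -[d]complex_eta dI ltcE /= eqxx /=; lra.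
  have -> : h (z + w) - h z - L * w = - ((L - w^-1 *: (h (w *: 1 + z) - h z)) * w).
    rewrite mulrBl [w *: 1]mulr1 [w + z]addrC opprB /GRing.scale /= mulrAC.
    by rewrite mulVf // mul1r.
  rewrite normrN normrM.
  have -> : (e * (`|Re w| + `|Im w|))%:C%C = e%:C%C * (`|Re w| + `|Im w|)%:C%C by rewrite rmorphM.
  by apply: ler_pM => //; exact: normc_le_abs.
have zE u v : (u +i* v)%C = z + ((u - Re z) +i* (v - Im z))%C :> R[i].
  by apply: complex_ext; rewrite ?cReD ?cImD /=; ring.
split => e e0; have [d d0 hd] := key e e0; exists d => // u v hu hv.
  have := hd ((u - Re z) +i* (v - Im z))%C hu hv; rewrite -zE => /normc_ge_abs[+ _].
  rewrite complex_eta !cReB cReM /=; congr (`|_| <= _); ring.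
have := hd ((u - Re z) +i* (v - Im z))%C hu hv; rewrite -zE => /normc_ge_abs[_].
by rewrite complex_eta !cImB cImM /=; congr (`|_| <= _); ring.
Qed.

Lemma cdiff_comp h z c (X Y : R -> R -> R) u v X1 X2 Y1 Y2 : cdiff h z c ->
  X u v = Re z -> Y u v = Im z ->
  has_partials X u v X1 X2 -> has_partials Y u v Y1 Y2 ->
  has_partials (fun x y => Re (h (X x y +i* Y x y)%C)) u v
     (Re c * X1 - Im c * Y1) (Re c * X2 - Im c * Y2) /\
  has_partials (fun x y => Im (h (X x y +i* Y x y)%C)) u v
     (Im c * X1 + Re c * Y1) (Im c * X2 + Re c * Y2).
Proof.
move=> [h1 h2] Xz Yz hX hY; rewrite -Xz -Yz in h1 h2.
split; last exact: (has_partials_comp h2).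
by apply: has_partials_cast (has_partials_comp h1 hX hY) _ _; ring.
Qed.

End ComplexDerivative.

(** * Coordinates on the strip *)

Section StripCoordinates.
Variable R : realType.
Local Notation Re := (@complex.Re R).
Local Notation Im := (@complex.Im R).

Definition strip (t : R) := - (pi / 2) < t < pi / 2.

(** This is [|1 + exp w|^2] for [w = s + i t]. The next two definitions are the real and imaginary
    parts of [tanh (w / 2)], the inverse of [z -> log ((1 + z) / (1 - z))], which maps the strip
    [|t| < pi / 2] onto the disk. *)
Definition tanh_den (s t : R) : R := expR s ^+ 2 + 2 * expR s * cos t + 1.
Definition tanh_re (s t : R) : R := (expR s ^+ 2 - 1) / tanh_den s t.
Definition tanh_im (s t : R) : R := 2 * expR s * sin t / tanh_den s t.

Lemma tanh_den_gt0 s t : strip t -> 0 < tanh_den s t.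
Proof.
move=> /cos_gt0_pihalf ct; have := expR_gt0 s => es.
have : 0 < expR s * cos t by rewrite mulr_gt0.
by rewrite /tanh_den; have := sqr_ge0 (expR s); lra.
Qed.

Lemma tanh_sqr_norm s t : strip t ->
  1 - (tanh_re s t ^+ 2 + tanh_im s t ^+ 2) = 4 * expR s * cos t / tanh_den s t.
Proof.
move=> st; have := tanh_den_gt0 s st; rewrite /tanh_re /tanh_im => D0.
have -> : (2 * expR s * sin t / tanh_den s t) ^+ 2 =
    4 * expR s ^+ 2 * (1 - cos t ^+ 2) / tanh_den s t ^+ 2.
  by rewrite -sin2cos2; field; rewrite gt_eqF.
by rewrite /tanh_den in D0 *; field; rewrite gt_eqF.
Qed.

Lemma tanh_disk s t : strip t -> tanh_re s t ^+ 2 + tanh_im s t ^+ 2 < 1.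
Proof.
move=> st; rewrite -subr_gt0 tanh_sqr_norm // divr_gt0 ?tanh_den_gt0 //.
by rewrite !mulr_gt0 ?expR_gt0 // cos_gt0_pihalf.
Qed.

Lemma tanh_moebius s t : strip t -> let z := (tanh_re s t +i* tanh_im s t)%C in
  (1 + z) / (1 - z) = ((expR s * cos t) +i* (expR s * sin t))%C.
Proof.
move=> st z; have D0 := tanh_den_gt0 s st.
have z1 : 1 - z != 0.
  apply/eqP => /(congr1 (@complex.Re R)); rewrite cReB /= => h.
  have := tanh_disk s st; have := sqr_ge0 (tanh_im s t).
  have -> : tanh_re s t = 1 by lra.
  lra.
apply: (mulIf z1); rewrite mulfVK //.
have s2 := sin2cos2 t.
have Dn0 : tanh_den s t != 0 by rewrite gt_eqF.
apply: complex_ext; rewrite ?cReM ?cImM ?cReB ?cImB ?cReD ?cImD /=.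
  have -> : expR s * sin t * (0 - tanh_im s t) = - (2 * expR s ^+ 2 * sin t ^+ 2 / tanh_den s t).
    by rewrite /tanh_im; field.
  rewrite s2 /tanh_re; rewrite /tanh_den in Dn0 *; field; exact: Dn0.
rewrite /tanh_re /tanh_im; rewrite /tanh_den in Dn0 *; field; exact: Dn0.
Qed.

Lemma Log_polar s t : strip t ->
  Log ((expR s * cos t) +i* (expR s * sin t))%C = (s +i* t)%C.
Proof.
move=> st; have ct := cos_gt0_pihalf st; have es := expR_gt0 s.
rewrite /Log /Arg /= mulr_gt0 //; congr Complex.
  have -> : (expR s * cos t) ^+ 2 + (expR s * sin t) ^+ 2 = expR s ^+ 2.
    by rewrite !exprMn -mulrDr cos2Dsin2 mulr1.
  by rewrite sqrtr_sqr gtr0_norm // expRK.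
have -> : expR s * sin t / (expR s * cos t) = tan t.
  by rewrite /tan -mulf_div divff ?mul1r // gt_eqF.
by apply: tanK; rewrite in_itv.
Qed.

Lemma polar_Log (w : R[i]) : 0 < Re w -> exists s t, [/\ strip t,
  w = ((expR s * cos t) +i* (expR s * sin t))%C & t = atan (Im w / Re w)].
Proof.
case: w => x y /= x0.
exists (ln (Num.sqrt (x ^+ 2 + y ^+ 2))), (atan (y / x)).
have n0 : 0 < x ^+ 2 + y ^+ 2 by rewrite ltr_pwDl ?sqr_ge0 // exprn_gt0.
have st : strip (atan (y / x)) by rewrite /strip atan_gtNpi2 atan_ltpi2.
have ct := cos_gt0_pihalf st.
split => //; rewrite lnK ?posrE ?sqrtr_gt0 //.
have E : Num.sqrt (x ^+ 2 + y ^+ 2) * cos (atan (y / x)) = x.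
  rewrite cos_atan.
  have -> : 1 + (y / x) ^+ 2 = (x ^+ 2 + y ^+ 2) / x ^+ 2 by field; rewrite gt_eqF.
  rewrite sqrtrM ?ltW // sqrtrV ?sqr_ge0 // sqrtr_sqr gtr0_norm // invfM invrK mulrA divff ?mul1r //.
  by rewrite gt_eqF // sqrtr_gt0.
congr Complex; first by rewrite E.
have -> : sin (atan (y / x)) = cos (atan (y / x)) * (y / x).
  by rewrite -{3}[y / x]atanK /tan mulrCA divff ?mulr1 // gt_eqF.
by rewrite mulrA E mulrCA divff ?mulr1 // gt_eqF.
Qed.

(** The [w] of the proof is [(1 + z) / (1 - z)], with positive real part [(1 - |z|^2) / |1 - z|^2];
    its logarithm is [s + i t]. The formula for [t] serves to bound the argument on smaller
    disks. *)
Lemma disk_strip x y : x ^+ 2 + y ^+ 2 < 1 -> exists s t, [/\ strip t,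
  x = tanh_re s t, y = tanh_im s t & t = atan (2 * y / (1 - (x ^+ 2 + y ^+ 2)))].
Proof.
move=> xy; pose z := (x +i* y)%C.
pose M := (1 - x) ^+ 2 + y ^+ 2.
have x1 : x < 1 by have := sqr_ge0 (x - 1); have := sqr_ge0 y; nra.
have M0 : 0 < M by rewrite /M ltr_pwDl ?sqr_ge0 // exprn_gt0 // subr_gt0.
pose w : R[i] := (((1 - (x ^+ 2 + y ^+ 2)) / M) +i* (2 * y / M))%C.
have rw : 0 < Re w by rewrite /= divr_gt0 // subr_gt0.
have [s [t [st wE tE]]] := polar_Log rw.
exists s, t; have D0 := tanh_den_gt0 s st.
move: wE => [/esym c1 /esym c2].
have e2 : expR s ^+ 2 = ((1 - (x ^+ 2 + y ^+ 2)) / M) ^+ 2 + (2 * y / M) ^+ 2.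
  by rewrite -c1 -c2 !exprMn -mulrDr cos2Dsin2 mulr1.
have Mn : (1 - x) ^+ 2 + y ^+ 2 != 0 by rewrite gt_eqF.
have DE : tanh_den s t = 4 / M.
  by rewrite /tanh_den -mulrA c1 e2 /M; field.
split => //.
- by rewrite /tanh_re DE e2 /M; field.
- by rewrite /tanh_im DE -(mulrA 2) c2 /M; field.
- by rewrite tE /=; congr atan; rewrite /M; field; rewrite Mn subr_eq0 gt_eqF.
Qed.

Lemma expR_slope (s : R) : has_slope expR s (expR s).
Proof. by apply/is_derive_slope; exact: is_derive_expR. Qed.
Lemma cos_slope (s : R) : has_slope cos s (- sin s).
Proof. by apply/is_derive_slope; exact: is_derive_cos. Qed.
Lemma sin_slope (s : R) : has_slope sin s (cos s).
Proof. by apply/is_derive_slope; exact: is_derive_sin. Qed.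

Let den_partials s t : has_partials tanh_den s t
   (2 * expR s ^+ 2 + 2 * expR s * cos t) (- 2 * expR s * sin t).
Proof.
have hE := partials_of_slope t (expR_slope s).
have hc := partials_of_slope2 s (cos_slope t).
apply: has_partials_eq (has_partialsD (has_partialsD (has_partialsM hE hE)
  (has_partialsM (has_partialsM (has_partials_cst 2 s t) hE) hc)) (has_partials_cst 1 s t)).
- by exists 1 => // u v _ _; rewrite /tanh_den expr2.
- by ring.
- by ring.
Qed.

(** The derivative of [z = tanh (w / 2)] is [(1 - z^2) / 2], with real part [(1 - x^2 + y^2) / 2]
    and imaginary part [- x y]. *)
Lemma tanh_re_partials s t : strip t -> has_partials tanh_re s t
  ((1 - tanh_re s t ^+ 2 + tanh_im s t ^+ 2) / 2) (tanh_re s t * tanh_im s t).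
Proof.
move=> st; have Dp := tanh_den_gt0 s st.
have D0 : tanh_den s t != 0 by rewrite gt_eqF.
have hE := partials_of_slope t (expR_slope s).
have hV := has_partialsV D0 (den_partials s t).
apply: has_partials_eq (has_partialsM (has_partialsB (has_partialsM hE hE)
   (has_partials_cst 1 s t)) hV).
- by exists 1 => // u v _ _; rewrite /tanh_re expr2.
- rewrite /tanh_re.
  have -> : tanh_im s t ^+ 2 = 4 * expR s ^+ 2 * (1 - cos t ^+ 2) / tanh_den s t ^+ 2.
    by rewrite -sin2cos2 /tanh_im; field.
  by rewrite /tanh_den in D0 *; field.
- by rewrite /tanh_re /tanh_im; field.
Qed.

Lemma tanh_im_partials s t : strip t -> has_partials tanh_im s t
  (- (tanh_re s t * tanh_im s t)) ((1 - tanh_re s t ^+ 2 + tanh_im s t ^+ 2) / 2).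
Proof.
move=> st; have Dp := tanh_den_gt0 s st.
have D0 : tanh_den s t != 0 by rewrite gt_eqF.
have hE := partials_of_slope t (expR_slope s).
have hs := partials_of_slope2 s (sin_slope t).
have hV := has_partialsV D0 (den_partials s t).
apply: has_partials_eq (has_partialsM (has_partialsM (has_partialsM (has_partials_cst 2 s t) hE) hs) hV).
- by exists 1.
- by rewrite /tanh_re /tanh_im; rewrite /tanh_den in D0 *; field.
- have -> : tanh_im s t ^+ 2 = 4 * expR s ^+ 2 * (1 - cos t ^+ 2) / tanh_den s t ^+ 2.
    by rewrite -sin2cos2 /tanh_im; field.
  transitivity (2 * expR s * cos t / tanh_den s t +
      2 * expR s * sin t * (- tanh_den s t ^- 2 * (- 2 * expR s * sin t))).
    by field.
  have -> : 2 * expR s * sin t * (- tanh_den s t ^- 2 * (- 2 * expR s * sin t)) =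
     4 * expR s ^+ 2 * (1 - cos t ^+ 2) / tanh_den s t ^+ 2.
    by rewrite -sin2cos2; field.
  by rewrite /tanh_re; rewrite /tanh_den in D0 *; field.
Qed.

Lemma sin_gt0E (x : R) : - pi < x -> x < pi -> (0 < sin x) = (0 < x).
Proof.
move=> x1 x2; apply/idP/idP => [s0|x0]; last by apply: sin_gt0_pi; rewrite x0.
rewrite ltNge; apply/negP => xn.
have : 0 <= sin (- x) by apply: sin_ge0_pi; apply/andP; split; lra.
by rewrite sinN; lra.
Qed.

Lemma sin_eq0E (x : R) : - pi < x -> x < pi -> sin x = 0 -> x = 0.
Proof.
move=> x1 x2 s0; have h1 := sin_gt0E x1 x2.
have h2 : (0 < sin (- x)) = (0 < - x) by apply: sin_gt0E; lra.
move: h1 h2; rewrite sinN s0 oppr0 ltxx oppr_gt0 => h1 h2.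
by apply/eqP; rewrite eq_le !leNgt -h1 -h2.
Qed.

(** Here [(1 + z) / (1 - z) = exp w], whose principal logarithm is [w] because [|t| < pi / 2]; hence
    [k_a = (exp (a w) - 1) / (2 a)] for [a <> 0] and [k_0 = w / 2]. *)
Lemma k_tanh a s t : strip t -> k a (tanh_re s t +i* tanh_im s t)%C =
  Complex (if a == 0 then s / 2 else (expR (a * s) * cos (a * t) - 1) / (2 * a))
  (if a == 0 then t / 2 else expR (a * s) * sin (a * t) / (2 * a)).
Proof.
move=> st; rewrite /k tanh_moebius // Log_polar //.
have two : 2%:R = (2 +i* 0)%C :> R[i] by apply: complex_ext => //=; rewrite addr0.
case: ifP => [_|/negbT a0].
  have i2 : 1 / 2%:R = ((1/2) +i* 0)%C :> R[i].
    apply: (mulIf (x := 2%:R)); first by rewrite pnatr_eq0.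
    rewrite mulfVK ?pnatr_eq0 // two; apply: complex_ext => /=; last by ring.
    by field.
  by rewrite i2; apply: complex_ext => /=; field.
have -> : (2%:R * a%:C%C)^-1 = ((2 * a)^-1 +i* 0)%C :> R[i].
  have a0' : 2%:R * a%:C%C != 0 :> R[i].
    rewrite mulf_neq0 ?pnatr_eq0 //; apply: contra a0 => /eqP[->]; exact: eqxx.
  apply: (mulIf a0'); rewrite mulVf // two; apply: complex_ext => /=; last by ring.
  by field.
rewrite /cpow Log_polar // /cexp; apply: complex_ext => /=.
  rewrite !mul0r !mulr0 !subr0 !addr0; field; exact: a0.
by rewrite !mul0r !mulr0 !subr0 !addr0; field; exact: a0.
Qed.

End StripCoordinates.

(** * The harmonic shear *)

Section HarmonicShear.
Variable R : realType.
Local Notation Re := (@complex.Re R).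
Local Notation Im := (@complex.Im R).
Variables (a lam : R) (h g dh dg : R[i] -> R[i]).
Hypothesis lam01 : 0 <= lam < 1.
Hypothesis h_diff : forall z, disk 1 z -> cdiff h z (dh z).
Hypothesis g_diff : forall z, disk 1 z -> cdiff g z (dg z).
Hypothesis hgk : forall z, disk 1 z -> h z - g z = k a z.
Hypothesis dilatation : forall z, disk 1 z ->
  dh z != 0 /\ dg z / dh z = (lam%:C)%C * z.

Let zeta (s t : R) : R[i] := (tanh_re s t +i* tanh_im s t)%C.

Let zeta_disk s t : strip t -> disk 1 (zeta s t).
Proof. by move=> st; rewrite /disk /= expr1n; exact: tanh_disk. Qed.

Lemma has_slope_fst (f : R -> R -> R) u v A B : has_partials f u v A B ->
  has_slope (fun x => f x v) u A.
Proof.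
move=> hp e e0; have [d d0 hd] := hp e e0; exists d => // x' hx.
have := hd x' v hx; rewrite subrr normr0 mulr0 subr0 addr0.
by apply; exact: ltW.
Qed.

Lemma has_slope_eq (p q : R -> R) u A B : p =1 q -> A = B -> has_slope p u A -> has_slope q u B.
Proof. by move=> /funext -> ->. Qed.

Lemma dgE z : disk 1 z ->
  Re (dg z) = lam * (Re z * Re (dh z) - Im z * Im (dh z)) /\
  Im (dg z) = lam * (Re z * Im (dh z) + Im z * Re (dh z)).
Proof.
move=> dz; have [h0 e] := dilatation dz.
have -> : dg z = (lam%:C)%C * z * dh z by rewrite -e mulfVK.
by rewrite !cReM !cImM ?cReM ?cImM /=; split; ring.
Qed.

Let mre (s t : R) := (1 - tanh_re s t ^+ 2 + tanh_im s t ^+ 2) / 2.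
Let mim (s t : R) := - (tanh_re s t * tanh_im s t).

(** This is [(h' - g') dz/dw = exp (a w) / 2], where [mre + i mim = dz/dw], found by differentiating
    [h - g = k_a] in [s] alone. In this form the value [a = 0] is no exception. *)
Lemma shear_derivative s t : strip t ->
  let c := dh (zeta s t) in let d := dg (zeta s t) in
  (Re c - Re d) * mre s t - (Im c - Im d) * mim s t = expR (a * s) * cos (a * t) / 2 /\
  (Im c - Im d) * mre s t + (Re c - Re d) * mim s t = expR (a * s) * sin (a * t) / 2.
Proof.
move=> st c d; have dz := zeta_disk s st.
have hX := tanh_re_partials s st; have hY := tanh_im_partials s st.
have [h1 h2] := cdiff_comp (h_diff dz) (erefl (tanh_re s t)) (erefl (tanh_im s t)) hX hY.
have [g1 g2] := cdiff_comp (g_diff dz) (erefl (tanh_re s t)) (erefl (tanh_im s t)) hX hY.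
have sl1 := has_slope_fst (has_partialsB h1 g1).
have sl2 := has_slope_fst (has_partialsB h2 g2).
have he : has_slope (fun x => expR (a * x)) s (a * expR (a * s)).
  apply: (slope_of_partials (v := 0) (B := 0)).
  apply: has_partials_cast (has_partials_slope (f := fun x _ => a * x) (expR_slope (a * s))
    (has_partialsM (has_partials_cst a s 0) (has_partials_fst s 0))) _ _; ring.
have lin (f : R -> R) A c0 c1 : has_slope f s A -> has_slope (fun x => c1 * f x + c0) s (c1 * A).
  move=> hf; apply: (slope_of_partials (v := 0) (B := 0)).
  apply: has_partials_cast (has_partialsD (has_partialsM (has_partials_cst c1 s 0)
     (partials_of_slope 0 hf)) (has_partials_cst c0 s 0)) _ _; ring.
have hid : has_slope id s 1 by exact: slope_of_partials (has_partials_fst s 0).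
have kE x : h (zeta x t) - g (zeta x t) = k a (zeta x t) by apply: hgk; exact: zeta_disk.
have k1 : has_slope (fun x => Re (h (zeta x t)) - Re (g (zeta x t))) s
    (expR (a * s) * cos (a * t) / 2).
  have -> : (fun x => Re (h (zeta x t)) - Re (g (zeta x t))) =
     (fun x => if a == 0 then x / 2 else (expR (a * x) * cos (a * t) - 1) / (2 * a)).
    by apply/funext => x; rewrite -cReB kE /zeta k_tanh.
  case: eqP => [->|/eqP a0].
    apply: has_slope_eq (lin id 1 0 (1/2) hid) => [x|]; first by ring.
    by rewrite !mul0r expR0 cos0; ring.
  by apply: has_slope_eq (lin _ _ (- (2 * a)^-1) (cos (a * t) / (2 * a)) he) => [x|]; field.
have k2 : has_slope (fun x => Im (h (zeta x t)) - Im (g (zeta x t))) s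
    (expR (a * s) * sin (a * t) / 2).
  have -> : (fun x => Im (h (zeta x t)) - Im (g (zeta x t))) =
     (fun x => if a == 0 then t / 2 else expR (a * x) * sin (a * t) / (2 * a)).
    by apply/funext => x; rewrite -cImB kE /zeta k_tanh.
  case: eqP => [->|/eqP a0].
    apply: has_slope_eq (lin id 1 (t / 2) 0 hid) => [x|]; first by ring.
    by rewrite !mul0r sin0; ring.
  by apply: has_slope_eq (lin _ _ 0 (sin (a * t) / (2 * a)) he) => [x|]; field.
have := has_slope_unique sl1 k1; have := has_slope_unique sl2 k2.
rewrite -/c -/d /mre /mim.
move: (Re c) (Im c) (Re d) (Im d) (tanh_re s t) (tanh_im s t) => cr ci dr di x y <- <-.
by split; ring.
Qed.

(** The three quantities are [|1 + z|^2], [|1 - z|^2] and [|1 - lam z|^2] for [z = x + i y]. *)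
Definition plus_sq (x y : R) := (1 + x) ^+ 2 + y ^+ 2.
Definition minus_sq (x y : R) := (1 - x) ^+ 2 + y ^+ 2.
Definition lam_sq (x y : R) := (1 - lam * x) ^+ 2 + (lam * y) ^+ 2.

Lemma tanh_plus_minus s t : strip t ->
  minus_sq (tanh_re s t) (tanh_im s t) = 4 / tanh_den s t /\
  plus_sq (tanh_re s t) (tanh_im s t) = 4 * expR s ^+ 2 / tanh_den s t.
Proof.
move=> st; have Dp := tanh_den_gt0 s st.
have D0 : tanh_den s t != 0 by rewrite gt_eqF.
have i2 : tanh_im s t ^+ 2 = 4 * expR s ^+ 2 * (1 - cos t ^+ 2) / tanh_den s t ^+ 2.
  by rewrite -sin2cos2 /tanh_im; field.
by rewrite /minus_sq /plus_sq i2 /tanh_re; rewrite /tanh_den in D0 *; split; field.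
Qed.

Lemma lam_sq_gt0 x y : x ^+ 2 + y ^+ 2 < 1 -> 0 < lam_sq x y.
Proof.
move=> n1; have /andP[l0 l1] := lam01.
have x1 : x < 1 by have := sqr_ge0 (x - 1); have := sqr_ge0 y; nra.
rewrite /lam_sq ltr_pwDl ?sqr_ge0 // exprn_gt0 // subr_gt0.
by have [x0|x0] := leP x 0; nra.
Qed.

Lemma jacobian x y : x ^+ 2 + y ^+ 2 < 1 ->
  let c := dh (x +i* y)%C in let d := dg (x +i* y)%C in
  (Re c ^+ 2 + Im c ^+ 2) - (Re d ^+ 2 + Im d ^+ 2) =
  (1 - lam ^+ 2 * (x ^+ 2 + y ^+ 2)) * (plus_sq x y / minus_sq x y) `^ a /
   (lam_sq x y * (plus_sq x y * minus_sq x y)).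
Proof.
move=> n1; have [s [t [st xE yE _]]] := disk_strip n1.
have := shear_derivative s st; rewrite /zeta /mre /mim -xE -yE /=.
have [|dR dI] := @dgE (x +i* y)%C; first by rewrite /disk /= expr1n.
have [ME PE] := tanh_plus_minus s st; rewrite -xE -yE in ME PE.
have D0 := tanh_den_gt0 s st.
move: dR dI => /=.
move: (Re (dh _)) (Im (dh _)) (Re (dg _)) (Im (dg _)) => cr ci dr di.
move=> dR dI [e1 e2].
have -> : (plus_sq x y / minus_sq x y) `^ a = expR (a * s) ^+ 2.
  rewrite ME PE (_ : 4 * expR s ^+ 2 / _ / _ = expR s ^+ 2); last by field; rewrite gt_eqF.
  by rewrite -!expRM_natr -expRM; congr expR; ring.
(* The squared modulus of the equation in [shear_derivative], with [|dz/dw|^2 = |1 - z^2|^2 / 4]. *)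
have key : (cr ^+ 2 + ci ^+ 2) * lam_sq x y * (plus_sq x y * minus_sq x y) = expR (a * s) ^+ 2.
  have -> : expR (a * s) ^+ 2 = 4 * ((expR (a * s) * cos (a * t) / 2) ^+ 2 +
     (expR (a * s) * sin (a * t) / 2) ^+ 2).
    by rewrite !exprMn sin2cos2; field.
  by rewrite -e1 -e2 dR dI /lam_sq /plus_sq /minus_sq; field.
have L0 := lam_sq_gt0 n1.
have M0 : 0 < minus_sq x y by rewrite ME divr_gt0.
have P0 : 0 < plus_sq x y by rewrite PE divr_gt0 // mulr_gt0 // exprn_gt0 // expR_gt0.
rewrite -key dR dI.
by field; rewrite !gt_eqF.
Qed.

Let Phi s t := Re (h (zeta s t)) + Re (g (zeta s t)).

(* Along a curve on which [k_a] moves horizontally, [Re f] has derivative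
   [Re ((1 + lam z) / (1 - lam z))] times the speed of [k_a]. *)
Lemma no_return (S T S' T' r : R -> R) u1 u2 : u1 < u2 ->
  (forall u, u1 <= u -> u <= u2 -> [/\ has_slope S u (S' u), has_slope T u (T' u) & strip (T u)]) ->
  (forall u, u1 <= u -> u <= u2 ->
    [/\ expR (a * S u) * (cos (a * T u) * S' u - sin (a * T u) * T' u) = r u,
        cos (a * T u) * T' u + sin (a * T u) * S' u = 0 & r u != 0]) ->
  Phi (S u1) (T u1) <> Phi (S u2) (T u2).
Proof.
move=> u12 hST hr.
pose p u := Phi (S u) (T u).
have hp u : u1 <= u -> u <= u2 -> exists2 U, has_slope p u U & U != 0.
  move=> a1 a2; have [hS hT st] := hST u a1 a2; have [r1 r2 r0] := hr u a1 a2.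
  have dz := zeta_disk (S u) st.
  have hX := tanh_re_partials (S u) st; have hY := tanh_im_partials (S u) st.
  have [h1 _] := cdiff_comp (h_diff dz) (erefl (tanh_re (S u) (T u)))
    (erefl (tanh_im (S u) (T u))) hX hY.
  have [g1 _] := cdiff_comp (g_diff dz) (erefl (tanh_re (S u) (T u)))
    (erefl (tanh_im (S u) (T u))) hX hY.
  have hphi := has_partialsD h1 g1.
  have := @has_partials_comp _ Phi (fun u _ => S u) (fun u _ => T u) u 0 _ _ _ _ _ _ hphi
    (partials_of_slope 0 hS) (partials_of_slope 0 hT).
  move=> /slope_of_partials sl; eexists; first exact: sl.
  have [e1 e2] := shear_derivative (S u) st.
  have [dR dI] := dgE dz.
  move: e1 e2 dR dI; rewrite /mre /mim /zeta /=.
  have n1 := tanh_disk (S u) st; have Q0 := lam_sq_gt0 n1.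
  set x := tanh_re _ _ in n1 Q0 *; set y := tanh_im _ _ in n1 Q0 *.
  move: (Re (dh _)) (Im (dh _)) (Re (dg _)) (Im (dg _)).
  move=> cr ci dr di e1 e2 dR dI.
  set U := _ + _; apply/eqP => U0.
  have /andP[l0 l1] := lam01.
  have /eqP : U * lam_sq x y = r u / 2 * (1 - lam ^+ 2 * (x ^+ 2 + y ^+ 2)).
    have q1 : (expR (a * S u) * cos (a * T u) / 2) * S' u -
        (expR (a * S u) * sin (a * T u) / 2) * T' u = r u / 2.
      by rewrite -r1; field.
    have q2 : (expR (a * S u) * cos (a * T u) / 2) * T' u +
        (expR (a * S u) * sin (a * T u) / 2) * S' u = 0.
      by rewrite -[RHS](mulr0 (expR (a * S u) / 2)) -r2; field.
    rewrite -e1 -e2 in q1 q2.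
    (* Here [(1 + lam z) (1 - lam conj z) = 1 - lam^2 |z|^2 + 2 i lam y]. Its imaginary part
       multiplies the vertical speed of [k_a], which is [0]. *)
    transitivity ((1 - lam ^+ 2 * (x ^+ 2 + y ^+ 2)) * (r u / 2) - 2 * (lam * y) * 0); last by ring.
    by rewrite -q1 -q2 /U dR dI /lam_sq; field.
  rewrite U0 mul0r eq_sym !mulf_eq0 (negbTE r0) invr_eq0 pnatr_eq0 /=.
  apply/negP; rewrite gt_eqF // subr_gt0.
  have l2 : lam ^+ 2 <= 1 by rewrite expr_le1 ?(ltW l1).
  have : 0 <= x ^+ 2 + y ^+ 2 by rewrite addr_ge0 ?sqr_ge0.
  nra.
move=> pe.
have dp u : u1 <= u -> u <= u2 -> derivable p u 1.
  by move=> a1 a2; have [U /is_derive_slope[]] := hp u a1 a2.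
have [||c] := @Rolle R p u1 u2 u12 _ _ pe.
- by move=> x; rewrite in_itv /= => /andP[? ?]; apply: dp; exact: ltW.
- apply: continuous_in_subspaceT => x; rewrite inE /= in_itv /= => /andP[? ?].
  by apply: differentiable_continuous; apply/derivable1_diffP; exact: dp.
- rewrite in_itv /= => /andP[/ltW c1 /ltW c2] /is_derive_slope c0.
  have [U sU U0] := hp c c1 c2.
  by move/eqP: U0; apply; exact: has_slope_unique sU c0.
Qed.

(** For [a <> 0] both points lie on a level curve [exp (a s) sin (a t) = C]. If [C <> 0], then
    [|a t| < pi] makes the curve a graph over [t]; if [C = 0] it is the line [t = 0], and for
    [a = 0] it is a line [t = const]. By [no_return], [Re f] takes different values at different
    points of it. Only one order of the points is excluded here; the other follows by exchanging
    them. *)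
Lemma shear_inj_lt s1 t1 s2 t2 : strip t1 -> strip t2 ->
  - pi < a * t1 < pi -> - pi < a * t2 < pi ->
  Im (k a (zeta s1 t1)) = Im (k a (zeta s2 t2)) ->
  Phi s1 t1 = Phi s2 t2 ->
  ~ (t1 < t2) /\ (t1 = t2 -> ~ (s1 < s2)).
Proof.
move=> st1 st2 at1 at2; rewrite /zeta !k_tanh //= => ke pe.
have hid (u : R) : has_slope id u 1 by exact: slope_of_partials (has_partials_fst u 0).
have hcst (c u : R) : has_slope (fun=> c) u 0 by exact: slope_of_partials (has_partials_cst c u 0).
have horiz t : strip t -> sin (a * t) = 0 -> cos (a * t) != 0 -> forall s1 s2, s1 < s2 ->
    Phi s1 t <> Phi s2 t.
  move=> st st0 ct x1 x2 x12.
  apply: (@no_return id (fun=> t) (fun=> 1) (fun=> 0) (fun u => expR (a * u) * cos (a * t))) => //.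
  move=> u _ _; rewrite st0 !mulr0 mul0r mulr1 subr0 addr0; split => //.
  by rewrite mulf_neq0 // gt_eqF // expR_gt0.
have [a0|a0] := eqVneq a 0.
  rewrite a0 eqxx in ke.
  have te : t1 = t2 by lra.
  split; first by rewrite te ltxx.
  move=> _ s12; rewrite -te in pe; apply: (horiz t1 _ _ _ _ _ s12 pe) => //.
    by rewrite a0 mul0r sin0.
  by rewrite a0 mul0r cos0 oner_eq0.
rewrite (negbTE a0) in ke.
have {}ke : expR (a * s1) * sin (a * t1) = expR (a * s2) * sin (a * t2).
  by apply: (mulIf (x := (2 * a)^-1)) => //; rewrite invr_eq0 mulf_neq0 // pnatr_eq0.
have E1 := expR_gt0 (a * s1); have E2 := expR_gt0 (a * s2).
have /andP[b1 b2] := at1; have /andP[c1 c2] := at2.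
have [z1|z1] := eqVneq (sin (a * t1)) 0.
  have z2 : sin (a * t2) = 0.
    move: ke; rewrite z1 mulr0 => /esym/eqP; rewrite mulf_eq0 gt_eqF //= => /eqP //.
  have t10 : t1 = 0 by apply: (mulfI a0); rewrite mulr0; exact: sin_eq0E.
  have t20 : t2 = 0 by apply: (mulfI a0); rewrite mulr0; exact: sin_eq0E.
  rewrite t10 t20 ltxx; split => // _ s12; rewrite t10 t20 in pe.
  apply: (horiz 0 _ _ _ _ _ s12 pe).
  - by rewrite -t10.
  - by rewrite mulr0 sin0.
  - by rewrite mulr0 cos0 oner_eq0.
split; last first.
  move=> te s12; move: ke; rewrite -te => /(mulIf z1) /expR_inj /(mulfI a0) se.
  by rewrite se ltxx in s12.
move=> t12.
pose C := expR (a * s1) * sin (a * t1).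
(* Since [a * t1] and [a * t2] have the same sign, [a * u] stays in [(0, pi)] or in [(- pi, 0)], and
   [sin (a * u)] keeps the sign of [C]. *)
have Cpos u : t1 <= u -> u <= t2 -> 0 < C / sin (a * u).
  move=> u1 u2.
  have [au1 au2] : - pi < a * u /\ a * u < pi.
    by have [ap|an] := leP 0 a; split; nra.
  have sE : (0 < sin (a * u)) = (0 < a * u) := sin_gt0E au1 au2.
  have sE1 : (0 < sin (a * t1)) = (0 < a * t1) := sin_gt0E b1 b2.
  have sE2 : (0 < sin (a * t2)) = (0 < a * t2) := sin_gt0E c1 c2.
  have nE x : - pi < x -> x < pi -> (sin x < 0) = (x < 0).
    by move=> x1 x2; rewrite -oppr_gt0 -sinN sin_gt0E ?oppr_gt0 //; lra.
  have [p1|p1|p1] := ltrgt0P (sin (a * t1)); last by rewrite p1 eqxx in z1.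
    have p2 : 0 < sin (a * t2).
      by rewrite -(pmulr_rgt0 _ E2) -ke mulr_gt0.
    have q1 : 0 < a * t1 by rewrite -sE1.
    have q2 : 0 < a * t2 by rewrite -sE2.
    rewrite divr_gt0 ?mulr_gt0 // sE.
    by have [ap|an] := leP 0 a; nra.
  have p2 : sin (a * t2) < 0.
    by rewrite -(pmulr_rlt0 _ E2) -ke nmulr_llt0.
  have q1 : a * t1 < 0 by rewrite -nE.
  have q2 : a * t2 < 0 by rewrite -nE.
  have p3 : sin (a * u) < 0.
    by rewrite nE //; have [ap|an] := leP 0 a; nra.
  by rewrite nmulr_rgt0 ?invr_lt0 // /C nmulr_llt0.
(* The level curve solved for [s]. Its slope is [- cot (a u)], and twice the speed of [k_a] along it
   is [- exp (a S) / sin (a u)], which never vanishes. *)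
pose S u := ln (C / sin (a * u)) / a.
have S1 : S t1 = s1.
  by rewrite /S /C mulfK // expRK mulrAC divff ?mul1r.
have z2 : sin (a * t2) != 0.
  apply: contra z1 => /eqP z2; move: ke; rewrite z2 mulr0 => /eqP.
  by rewrite mulf_eq0 gt_eqF.
have S2 : S t2 = s2.
  by rewrite /S /C ke mulfK // expRK mulrAC divff ?mul1r.
have := @no_return S id (fun u => - cos (a * u) / sin (a * u)) (fun=> 1)
  (fun u => - expR (a * S u) / sin (a * u)) t1 t2 t12.
rewrite S1 S2 /=; apply => // u u1 u2; have Cp := Cpos u u1 u2.
  have su : sin (a * u) != 0.
    by apply: contraTN Cp => /eqP ->; rewrite invr0 mulr0 ltxx.
  split => //; last by move: st1 st2; rewrite /strip => /andP[? ?] /andP[? ?]; apply/andP; split; lra.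
  have hsin : has_partials (fun x _ => sin (a * x)) u 0 (cos (a * u) * a) 0.
    apply: has_partials_cast (has_partials_slope (f := fun x _ => a * x) (sin_slope (a * u))
      (has_partialsM (has_partials_cst a u 0) (has_partials_fst u 0))) _ _; ring.
  have hln : has_slope (@ln R) (C / sin (a * u)) (C / sin (a * u))^-1.
    by apply/is_derive_slope; exact: is_derive1_ln.
  apply: (slope_of_partials (v := 0) (B := 0)).
  have C0 : C != 0 by apply: contraTN Cp => /eqP ->; rewrite mul0r ltxx.
  apply: has_partials_cast (has_partialsM (has_partials_slope (f := fun x _ => C / sin (a * x)) hln
     (has_partialsM (has_partials_cst C u 0) (has_partialsV su hsin)))
     (has_partials_cst a^-1 u 0)) _ _; last by ring.
  by field; rewrite su C0.
have su : sin (a * u) != 0.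
  by apply: contraTN Cp => /eqP ->; rewrite invr0 mulr0 ltxx.
have cs := cos2Dsin2 (a * u).
split.
- have -> : cos (a * u) * (- cos (a * u) / sin (a * u)) - sin (a * u) * 1 =
    - (cos (a * u) ^+ 2 + sin (a * u) ^+ 2) / sin (a * u) by field.
  by rewrite cs; ring.
- by field.
- by rewrite mulf_neq0 ?invr_eq0 // oppr_eq0 gt_eqF // expR_gt0.
Qed.

Lemma shear_injective (z w : R[i]) : disk 1 z -> disk 1 w ->
  - pi < a * atan (2 * Im z / (1 - (Re z ^+ 2 + Im z ^+ 2))) < pi ->
  - pi < a * atan (2 * Im w / (1 - (Re w ^+ 2 + Im w ^+ 2))) < pi ->
  h z + (g z)^* = h w + (g w)^* -> z = w.
Proof.
move=> dz dw; have := hgk dz; have := hgk dw; move: dz dw.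
case: z w => x y [x' y']; rewrite /disk /= expr1n => n1 n1' kw kz.
have [s [t [st xE yE tE]]] := disk_strip n1.
have [s' [t' [st' xE' yE' tE']]] := disk_strip n1'.
rewrite -tE -tE' => at1 at2 fe.
have pe : Phi s t = Phi s' t'.
  move: fe => /(congr1 Re); rewrite !cReD !cRe_conj.
  by rewrite /Phi /zeta -xE -yE -xE' -yE'.
have ke : Im (k a (zeta s t)) = Im (k a (zeta s' t')).
  move: fe => /(congr1 Im); rewrite !cImD !cIm_conj -!cImB kw kz.
  by rewrite /zeta -xE -yE -xE' -yE'.
have [n2 n3] := shear_inj_lt st st' at1 at2 ke pe.
have [n4 n5] := shear_inj_lt st' st at2 at1 (esym ke) (esym pe).
have te : t = t'.
  by apply/eqP; rewrite eq_le !leNgt; apply/andP; split; apply/negP.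
have se : s = s'.
  apply/eqP; rewrite eq_le !leNgt; apply/andP; split; apply/negP.
    by apply: n5; rewrite te.
  by apply: n3.
by rewrite xE yE xE' yE' se te.
Qed.

End HarmonicShear.

(** * Polar coordinates *)

Section Primitive.
Variable R : realType.
Local Notation mu := (@lebesgue_measure R).

Lemma has_slope_continuous (p : R -> R) x k : has_slope p x k -> {for x, continuous p}.
Proof.
move=> /is_derive_slope[dp _].
by apply: differentiable_continuous; apply/derivable1_diffP.
Qed.

Lemma primitive (K : R -> R) (r : R) : 0 < r ->
  (forall x, 0 <= x -> x <= r -> {for x, continuous K}) ->
  exists N : R -> R, (forall x, 0 <= x -> x <= r -> has_slope N x (K x)) /\
    (\int[mu]_(x in `[0%R, r]) (K x)%:E = (N r - N 0)%:E)%E.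
Proof.
move=> r0 cK.
(* Continuity of [K] is known on [[0, r]] only; clamping extends it to the line, and integrating
   from [-1] with room up to [r + 1] gives two-sided derivatives at both ends. *)
pose cl (x : R) := Num.max 0 (Num.min x r).
have cl0 x : 0 <= cl x by rewrite le_max lexx.
have clr x : cl x <= r by rewrite ge_max (ltW r0) ge_min lexx orbT.
have clE x : 0 <= x -> x <= r -> cl x = x.
  by move=> x0 xr; rewrite /cl min_l // max_r.
have ccl : continuous cl.
  move=> x; apply: (@continuous_max _ _ (cst 0) (fun x => Num.min x r)); first exact: cvg_cst.
  by apply: (@continuous_min _ _ id (cst r)); [exact: cvg_id|exact: cvg_cst].
pose Kc x := K (cl x).
have cKc : continuous Kc.
  by move=> x; apply: continuous_comp; [exact: ccl|exact: cK].
pose N x := (\int[mu]_(t in `[(-1)%R, x]) Kc t)%R.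
have hN x : 0 <= x -> x <= r -> has_slope N x (K x).
  move=> x0 xr.
  have [] := @continuous_FTC1_closed R Kc (-1) x (r + 1).
  - lra.
  - apply: continuous_compact_integrable; first exact: segment_compact.
    exact: continuous_subspaceT.
  - lra.
  - exact: cKc.
  move=> dN eN; apply/is_derive_slope; split; first exact: dN.
  by rewrite -derive1E eN /Kc clE.
exists N; split => //.
rewrite (continuous_FTC2 (F := N)) //.
- by apply: continuous_in_subspaceT => x; rewrite inE /= in_itv /= => /andP[? ?]; exact: cK.
- split.
  + by move=> x; rewrite in_itv /= => /andP[/ltW x0 /ltW xr]; have /is_derive_slope[] := hN x x0 xr.
  + by apply: cvg_at_right_filter; apply: has_slope_continuous (hN 0 _ _); lra.
  + by apply: cvg_at_left_filter; apply: has_slope_continuous (hN r _ _); lra.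
- move=> x; rewrite in_itv /= => /andP[/ltW x0 /ltW xr].
  by have /is_derive_slope[_] := hN x x0 xr; rewrite derive1E.
Qed.

Lemma slope_scale (N : R -> R) x k c : has_slope N x k -> has_slope (fun y => c * N y) x (c * k).
Proof.
move=> hN; apply: (slope_of_partials (v := 0) (B := 0)).
by apply: has_partials_cast (has_partialsM (has_partials_cst c x 0) (partials_of_slope 0 hN)) _ _; ring.
Qed.

End Primitive.

(** * The shear in polar coordinates and its Jacobian *)

Section PolarMap.
Variable R : realType.
Local Notation Re := (@complex.Re R).
Local Notation Im := (@complex.Im R).
Local Notation mu := (@lebesgue_measure R).
Local Notation RR := (measurableTypeR R * measurableTypeR R)%type.
Local Notation mu2 := ((mu \x mu)%E : set RR -> \bar R).

(** The angle is scaled by [kappa] so that a sector of radius [s] and opening [kappa * s] has a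
    square as parameter domain; [theta] is the angle of its first ray. *)
Definition polar (kappa theta u v : R) : R[i] :=
  ((u * cos (kappa * v + theta)) +i* (u * sin (kappa * v + theta)))%C.

Lemma polar_sqr kappa theta u v :
  Re (polar kappa theta u v) ^+ 2 + Im (polar kappa theta u v) ^+ 2 = u ^+ 2.
Proof. by rewrite /= !exprMn -mulrDr cos2Dsin2 mulr1. Qed.

Lemma polar_inj kappa theta s u v u' v' : 0 < kappa -> kappa * s <= 2 * pi ->
  0 < u -> 0 < u' -> 0 < v < s -> 0 < v' < s ->
  polar kappa theta u v = polar kappa theta u' v' -> u = u' /\ v = v'.
Proof.
move=> k0 ks u0 u0' /andP[v0 vs] /andP[v0' vs'] e.
have uu : u = u'.
  have : u ^+ 2 = u' ^+ 2 by rewrite -(polar_sqr kappa theta u v) e polar_sqr.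
  by move=> /eqP; rewrite eqrXn2 ?ltW // => /eqP.
split => //; move: e; rewrite -uu => -[/(mulfI (lt0r_neq0 u0)) ec /(mulfI (lt0r_neq0 u0)) es].
set A := kappa * v + theta in ec es; set B := kappa * v' + theta in ec es.
have c1 : cos (A - B) = 1 by rewrite cosB ec es -!expr2 cos2Dsin2.
(* [cos (A - B) = 1] forces [sin H = 0], and an opening of at most [2 * pi] puts [H] strictly
   between [- pi] and [pi]. *)
pose H := (A - B) / 2.
have sH : sin H = 0.
  move: c1; have -> : A - B = H *+ 2 by rewrite /H; field.
  rewrite cos_mulr2n cos2sin2 => c1.
  by apply/eqP; rewrite -sqrf_eq0; apply/eqP; lra.
have ABE : A - B = kappa * (v - v') by rewrite /A /B; ring.
have H0 : H = 0.
  apply: sin_eq0E sH; rewrite /H ABE.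
    have : kappa * (v' - v) < kappa * s by rewrite ltr_pM2l //; lra.
    lra.
  have : kappa * (v - v') < kappa * s by rewrite ltr_pM2l //; lra.
  lra.
have /eqP : kappa * (v - v') = 0 by rewrite -ABE; rewrite /H in H0; lra.
by rewrite mulf_eq0 gt_eqF //= subr_eq0 => /eqP.
Qed.

Lemma polar_surj r x y : 0 < r -> exists u v, [/\ 0 <= u, u ^+ 2 = x ^+ 2 + y ^+ 2,
  0 <= v <= r & polar (2 * pi / r) (- pi) u v = (x +i* y)%C].
Proof.
move=> r0; pose u := Num.sqrt (x ^+ 2 + y ^+ 2).
have n0 : 0 <= x ^+ 2 + y ^+ 2 by rewrite addr_ge0 ?sqr_ge0.
have u0 : 0 <= u by rewrite sqrtr_ge0.
have u2 : u ^+ 2 = x ^+ 2 + y ^+ 2 by rewrite sqr_sqrtr.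
suff [al [al1 al2 ca sa]] : exists al, [/\ - pi <= al, al <= pi, u * cos al = x & u * sin al = y].
  exists u, ((al + pi) * r / (2 * pi)); have p0 := pi_gt0 R; split => //.
    apply/andP; split; first by apply: divr_ge0; [apply: mulr_ge0; lra|lra].
    rewrite ler_pdivrMr ?mulr_gt0 // mulrC ler_pM2l //; lra.
  rewrite /polar; have -> : 2 * pi / r * ((al + pi) * r / (2 * pi)) - pi = al.
    by move: (pi : R) p0 => p p0; field; rewrite !gt_eqF.
  by rewrite ca sa.
have [z|z] := eqVneq u 0.
  exists 0; rewrite z !mul0r; have := pi_gt0 R; move: u2; rewrite z expr0n /= => /esym/eqP.
  rewrite paddr_eq0 ?sqr_ge0 // !sqrf_eq0 => /andP[/eqP -> /eqP ->] p0; split => //; lra.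
have up : 0 < u by rewrite lt_neqAle eq_sym z.
have xu : -1 <= x / u <= 1.
  have : `|x / u| <= 1.
    rewrite normrM normfV (gtr0_norm up) ler_pdivrMr // mul1r.
    by rewrite -(@ler_sqr _ `|x|) ?nnegrE // real_normK ?num_real // u2 lerDl sqr_ge0.
  by rewrite ler_norml.
have a1 := acos_ge0 xu; have a2 := acos_lepi xu.
have ca : u * cos (acos (x / u)) = x by rewrite acosK // mulrC mulfVK.
have sa : u * sin (acos (x / u)) = `|y|.
  rewrite sin_acos //.
  have -> : 1 - (x / u) ^+ 2 = (y / u) ^+ 2.
    by rewrite !exprMn !exprVn u2; field; rewrite -u2 sqrf_eq0.
  by rewrite sqrtr_sqr normrM normfV (gtr0_norm up) mulrC mulfVK.
have [y0|y0] := leP 0 y.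
  by exists (acos (x / u)); rewrite ger0_norm // in sa; split => //; lra.
exists (- acos (x / u)); rewrite ltr0_norm // in sa.
by rewrite cosN sinN mulrN sa opprK; split => //; lra.
Qed.

Variables (h g dh dg : R[i] -> R[i]).
Hypothesis h_diff : forall z, disk 1 z -> cdiff h z (dh z).
Hypothesis g_diff : forall z, disk 1 z -> cdiff g z (dg z).

Section Fixed.
Variables kappa theta : R.

Definition polar_re u v := Re (h (polar kappa theta u v)) + Re (g (polar kappa theta u v)).
Definition polar_im u v := Im (h (polar kappa theta u v)) - Im (g (polar kappa theta u v)).

Let C v := cos (kappa * v + theta).
Let S v := sin (kappa * v + theta).

Let X_partials u v : has_partials (fun u v => u * C v) u v (C v) (- (kappa * u * S v)).
Proof.
have ha : has_partials (fun _ v => kappa * v + theta) u v 0 kappa.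
  by apply: has_partials_cast (has_partialsD (has_partialsM (has_partials_cst kappa u v)
    (has_partials_snd u v)) (has_partials_cst theta u v)) _ _; ring.
by apply: has_partials_cast (has_partialsM (has_partials_fst u v)
  (has_partials_slope (f := fun _ v => kappa * v + theta) (cos_slope _) ha)) _ _;
  rewrite /C /S; ring.
Qed.

Let Y_partials u v : has_partials (fun u v => u * S v) u v (S v) (kappa * u * C v).
Proof.
have ha : has_partials (fun _ v => kappa * v + theta) u v 0 kappa.
  by apply: has_partials_cast (has_partialsD (has_partialsM (has_partials_cst kappa u v)
    (has_partials_snd u v)) (has_partials_cst theta u v)) _ _; ring.
by apply: has_partials_cast (has_partialsM (has_partials_fst u v)
  (has_partials_slope (f := fun _ v => kappa * v + theta) (sin_slope _) ha)) _ _;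
  rewrite /C /S; ring.
Qed.

Let hr u v := Re (dh (polar kappa theta u v)).
Let hi u v := Im (dh (polar kappa theta u v)).
Let gr u v := Re (dg (polar kappa theta u v)).
Let gi u v := Im (dg (polar kappa theta u v)).

Definition polar_re_u u v := (hr u v * C v - hi u v * S v) + (gr u v * C v - gi u v * S v).
Definition polar_re_v u v := (hr u v * (- (kappa * u * S v)) - hi u v * (kappa * u * C v)) +
   (gr u v * (- (kappa * u * S v)) - gi u v * (kappa * u * C v)).
Definition polar_im_u u v := (hi u v * C v + hr u v * S v) - (gi u v * C v + gr u v * S v).
Definition polar_im_v u v := (hi u v * (- (kappa * u * S v)) + hr u v * (kappa * u * C v)) -
   (gi u v * (- (kappa * u * S v)) + gr u v * (kappa * u * C v)).

Lemma polar_disk u v r : 0 <= u -> u < r -> disk r (polar kappa theta u v).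
Proof.
move=> u0 ur; rewrite /disk /= -/(Re (polar kappa theta u v)) polar_sqr.
by rewrite ltrXn2r // (le_trans u0) // ltW.
Qed.

Lemma polar_re_partials u v : 0 <= u -> u < 1 ->
  has_partials polar_re u v (polar_re_u u v) (polar_re_v u v).
Proof.
move=> u0 u1; have dz := polar_disk v u0 u1.
have [h1 _] := cdiff_comp (X := fun u v => u * C v) (Y := fun u v => u * S v)
  (h_diff dz) (erefl _) (erefl _) (X_partials u v) (Y_partials u v).
have [g1 _] := cdiff_comp (X := fun u v => u * C v) (Y := fun u v => u * S v)
  (g_diff dz) (erefl _) (erefl _) (X_partials u v) (Y_partials u v).
exact: has_partialsD h1 g1.
Qed.

Lemma polar_im_partials u v : 0 <= u -> u < 1 ->
  has_partials polar_im u v (polar_im_u u v) (polar_im_v u v).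
Proof.
move=> u0 u1; have dz := polar_disk v u0 u1.
have [_ h1] := cdiff_comp (X := fun u v => u * C v) (Y := fun u v => u * S v)
  (h_diff dz) (erefl _) (erefl _) (X_partials u v) (Y_partials u v).
have [_ g1] := cdiff_comp (X := fun u v => u * C v) (Y := fun u v => u * S v)
  (g_diff dz) (erefl _) (erefl _) (X_partials u v) (Y_partials u v).
exact: has_partialsB h1 g1.
Qed.

Lemma polar_det u v : polar_re_u u v * polar_im_v u v - polar_re_v u v * polar_im_u u v =
  kappa * u * ((hr u v ^+ 2 + hi u v ^+ 2) - (gr u v ^+ 2 + gi u v ^+ 2)).
Proof.
transitivity (kappa * u * ((hr u v ^+ 2 + hi u v ^+ 2) - (gr u v ^+ 2 + gi u v ^+ 2)) *
  (C v ^+ 2 + S v ^+ 2)); last by rewrite /C /S cos2Dsin2 mulr1.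
rewrite /polar_re_u /polar_im_v /polar_re_v /polar_im_u.
by move: (hr u v) (hi u v) (gr u v) (gi u v) => a b c d; ring.
Qed.

End Fixed.
End PolarMap.

(** * Area of the image of a disk *)

Section AreaOfDisk.
Variable R : realType.
Local Notation Re := (@complex.Re R).
Local Notation Im := (@complex.Im R).
Local Notation mu := (@lebesgue_measure R).
Local Notation RR := (measurableTypeR R * measurableTypeR R)%type.
Local Notation mu2 := ((mu \x mu)%E : set RR -> \bar R).
Variables (a lam : R) (h g dh dg : R[i] -> R[i]).
Hypothesis lam01 : 0 <= lam < 1.
Hypothesis h_diff : forall z, disk 1 z -> cdiff h z (dh z).
Hypothesis g_diff : forall z, disk 1 z -> cdiff g z (dg z).
Hypothesis hgk : forall z, disk 1 z -> h z - g z = k a z.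
Hypothesis dilatation : forall z, disk 1 z ->
  dh z != 0 /\ dg z / dh z = (lam%:C)%C * z.

(** This is [|k_a'|^2 / |1 - lam z|^2]; the remaining factor [1 - lam^2 |z|^2] of the Jacobian is
    kept apart because it is constant on circles. *)
Definition jac_weight (x y : R) : R := (plus_sq x y / minus_sq x y) `^ a /
   (lam_sq lam x y * (plus_sq x y * minus_sq x y)).

Definition fimg (r : R) : set RR :=
  [set p | exists2 z, ((fun z => h z + (g z)^* ) @` disk r) z & p = (Re z, Im z)].

Let F kappa theta := plane_map (polar_re h g kappa theta) (polar_im h g kappa theta).

Lemma F_fimg kappa theta r u v : 0 <= u -> u < r -> fimg r (F kappa theta (u, v)).
Proof.
move=> u0 ur; set z := polar kappa theta u v.
exists (h z + (g z)^*); first by exists z => //; exact: polar_disk.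
by rewrite cReD cImD cRe_conj cIm_conj.
Qed.

Let partials_det kappa theta u v : 0 <= u -> u < 1 ->
  polar_re_u dh dg kappa theta u v * polar_im_v dh dg kappa theta u v -
  polar_re_v dh dg kappa theta u v * polar_im_u dh dg kappa theta u v =
  kappa * (u * ((1 - lam ^+ 2 * u ^+ 2) *
    jac_weight (Re (polar kappa theta u v)) (Im (polar kappa theta u v)))).
Proof.
move=> u0 u1; rewrite polar_det -(mulrA kappa); congr (_ * (_ * _)).
have n1 : Re (polar kappa theta u v) ^+ 2 + Im (polar kappa theta u v) ^+ 2 < 1.
  by rewrite polar_sqr expr_lt1.
rewrite -[polar kappa theta u v in LHS]complex_eta.
rewrite (jacobian lam01 h_diff g_diff hgk dilatation n1) polar_sqr.
by rewrite /jac_weight [RHS]mulrA.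
Qed.

Lemma jac_weight_ge0 x y : 0 <= jac_weight x y.
Proof.
rewrite divr_ge0 ?powR_ge0 // !mulr_ge0 //; by rewrite addr_ge0 ?sqr_ge0.
Qed.

Lemma lam_factor_gt0 u : 0 <= u -> u < 1 -> 0 < 1 - lam ^+ 2 * u ^+ 2.
Proof.
move=> u0 u1; have /andP[l0 l1] := lam01.
have l2 : lam ^+ 2 <= 1 by rewrite expr_le1 ?(ltW l1).
have u2 : u ^+ 2 < 1 by rewrite expr_lt1.
have := sqr_ge0 u; have := sqr_ge0 lam; nra.
Qed.

Let sq_bounds (s u v : R) : square 0 0 s (u, v) -> s < 1 -> [/\ 0 <= u, u < 1 & u <= s].
Proof. by move=> /squareP[? ? ? ?] ?; split => //; lra. Qed.

(** The open disk is exhausted by the polar rectangles [u <= r - r / (n + 1)], which are compact in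
    the parameters, so the image is a countable union of compact sets. *)
Lemma measurable_fimg r : 0 < r -> r < 1 -> measurable (fimg r).
Proof.
move=> r0 r1; pose th : R := - pi; pose ka : R := 2 * pi / r.
have -> : fimg r = \bigcup_n (F ka th @` (`[0, r - r / n.+1%:R] `*` `[0, r])).
  apply/seteqP; split => [p [w [z dz <-] ->]|p [n _ [[u v] [/= ]]]]; last first.
    rewrite !in_itv /= => /andP[u0 un] _ <-; apply: F_fimg => //.
    by apply: le_lt_trans un _; rewrite ltrBlDr ltrDl divr_gt0.
  have [u [v [u0 u2 v01 pz]]] := polar_surj (Re z) (Im z) r0.
  rewrite complex_eta in pz.
  have ur : u < r by rewrite -(@ltr_sqr _ u) ?nnegrE // ?(ltW r0) // u2.
  have d0 : 0 < 1 - u / r by rewrite subr_gt0 ltr_pdivrMr // mul1r.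
  have [n] := ltr_add_invr d0; rewrite add0r => hn.
  exists n => //; exists (u, v).
    split => /=; rewrite in_itv /=; last exact: v01.
    rewrite u0 /=.
    have : r * n.+1%:R^-1 < r * (1 - u / r) by rewrite ltr_pM2l.
    by rewrite mulrBr mulr1 mulrCA divff ?gt_eqF // mulr1 => ?; rewrite lerBrDr -lerBrDl ltW.
  by rewrite /F /plane_map /polar_re /polar_im /= pz cReD cImD cRe_conj cIm_conj.
apply: bigcupT_measurable => n; apply: compact_measurable2.
apply: continuous_image_compact2; last by apply: compact_setX; exact: segment_compact.
move=> u v [/=]; rewrite in_itv /= => /andP[u0 un] _.
have u1 : u < 1.
  apply: le_lt_trans un _; apply: lt_le_trans (ltW r1).
  by rewrite ltrBlDr ltrDl divr_gt0.
exists (polar_re_u dh dg ka th u v), (polar_re_v dh dg ka th u v).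
exists (polar_im_u dh dg ka th u v), (polar_im_v dh dg ka th u v).
by split; [exact: (polar_re_partials h_diff g_diff)|exact: (polar_im_partials h_diff g_diff)].
Qed.

(** The image of the disk is contained in that of the closed parameter square of side [r]; the side
    times [kappa] gives the factor [2 * pi]. *)
Lemma fimg_upper r (K : R -> R) : 0 < r -> r < 1 ->
  (forall u, 0 <= u -> u <= r -> {for u, continuous K}) ->
  (forall u x y, 0 <= u -> u <= r -> x ^+ 2 + y ^+ 2 = u ^+ 2 ->
     u * ((1 - lam ^+ 2 * u ^+ 2) * jac_weight x y) <= K u) ->
  (mu2 (fimg r) <= (2 * pi)%:E * \int[mu]_(u in `[0%R, r]) (K u)%:E)%E.
Proof.
move=> r0 r1 cK hK; pose th : R := - pi; pose ka : R := 2 * pi / r.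
have ka0 : 0 < ka by rewrite divr_gt0 // mulr_gt0 // pi_gt0.
have [N [hN ->]] := primitive r0 cK.
rewrite -EFinM.
have p1 u v : square 0 0 r (u, v) -> has_partials (polar_re h g ka th) u v
    (polar_re_u dh dg ka th u v) (polar_re_v dh dg ka th u v).
  by move=> /sq_bounds/(_ r1)[u0 u1 _]; exact: (polar_re_partials h_diff g_diff).
have p2 u v : square 0 0 r (u, v) -> has_partials (polar_im h g ka th) u v
    (polar_im_u dh dg ka th u v) (polar_im_v dh dg ka th u v).
  by move=> /sq_bounds/(_ r1)[u0 u1 _]; exact: (polar_im_partials h_diff g_diff).
have sl u : 0 <= u -> u <= 0 + r -> has_slope (fun x => ka * N x) u (ka * K u).
  by rewrite add0r => u0 ur; apply: slope_scale; exact: hN.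
have := area_image_le r0 p1 p2 sl.
have E : 2 * pi * (N r - N 0) = r * (ka * N (0 + r) - ka * N 0).
  by rewrite add0r /ka; field; rewrite gt_eqF.
rewrite -E => H; apply: le_trans (H _).
  apply: le_measure; rewrite ?inE.
  - exact: measurable_fimg.
  - apply: compact_measurable2; apply: continuous_image_compact2; last exact: compact_square.
    move=> u v sq; exists (polar_re_u dh dg ka th u v), (polar_re_v dh dg ka th u v).
    by exists (polar_im_u dh dg ka th u v), (polar_im_v dh dg ka th u v);
      split; [exact: p1|exact: p2].
  move=> p [w [z dz <-] ->].
  have [u [v [u0 u2 /andP[v0 v1] pz]]] := polar_surj (Re z) (Im z) r0.
  rewrite complex_eta in pz.
  have ur : u < r by rewrite -(@ltr_sqr _ u) ?nnegrE // ?(ltW r0) // u2.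
  exists (u, v); first by apply/squareP; rewrite !add0r; split => //; exact: ltW.
  by rewrite /F /plane_map /polar_re /polar_im /= pz cReD cImD cRe_conj cIm_conj.
move=> u v /sq_bounds/(_ r1)[u0 u1 ur].
rewrite partials_det // ger0_norm; last first.
  apply: mulr_ge0; [exact: ltW|apply: mulr_ge0 => //; apply: mulr_ge0].
      exact/ltW/lam_factor_gt0.
    exact: jac_weight_ge0.
by rewrite ler_pM2l //; apply: hK => //; exact: polar_sqr.
Qed.

(** Estimate from a sector of radius [s] and opening [kappa * s], where the bound on the argument
    makes [f] injective. An opening of [2 * pi] gives the whole disk of radius [s]. *)
Lemma fimg_lower r s kappa theta (K N : R -> R) : 0 < s -> s <= r -> r < 1 ->
  0 < kappa -> kappa * s <= 2 * pi ->
  (forall z, disk s z -> - pi < a * atan (2 * Im z / (1 - (Re z ^+ 2 + Im z ^+ 2))) < pi) ->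
  (forall u, 0 <= u -> u <= s -> {for u, continuous K}) ->
  (forall u, 0 <= u -> u <= s -> has_slope N u (K u)) ->
  (forall u v, square 0 0 s (u, v) -> let z := polar kappa theta u v in
     K u <= u * ((1 - lam ^+ 2 * u ^+ 2) * jac_weight (Re z) (Im z))) ->
  ((s * (kappa * (N s - N 0)))%:E <= mu2 (fimg r))%E.
Proof.
move=> s0 sr r1 ka0 kas Ts cK hN hK.
have s1 : s < 1 by exact: le_lt_trans r1.
have p1 u v : square 0 0 s (u, v) -> has_partials (polar_re h g kappa theta) u v
    (polar_re_u dh dg kappa theta u v) (polar_re_v dh dg kappa theta u v).
  by move=> /sq_bounds/(_ s1)[u0 u1 _]; exact: (polar_re_partials h_diff g_diff).
have p2 u v : square 0 0 s (u, v) -> has_partials (polar_im h g kappa theta) u v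
    (polar_im_u dh dg kappa theta u v) (polar_im_v dh dg kappa theta u v).
  by move=> /sq_bounds/(_ s1)[u0 u1 _]; exact: (polar_im_partials h_diff g_diff).
have sl u : 0 <= u -> u <= 0 + s -> has_slope (fun x => kappa * N x) u (kappa * K u).
  by rewrite add0r => u0 ur; apply: slope_scale; exact: hN.
have disk1 z : disk s z -> disk 1 z.
  by rewrite /disk /= => /lt_le_trans; apply; rewrite ler_sqr ?nnegrE ?(ltW s0) // ltW.
have inj u v u' v' : 0 < u -> u < 0 + s -> 0 < v -> v < 0 + s -> 0 < u' -> u' < 0 + s ->
    0 < v' -> v' < 0 + s -> polar_re h g kappa theta u v = polar_re h g kappa theta u' v' ->
    polar_im h g kappa theta u v = polar_im h g kappa theta u' v' -> u = u' /\ v = v'.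
  rewrite !add0r => u0 us v0 vs u0' us' v0' vs' e1 e2.
  apply: (@polar_inj _ kappa theta s) => //; try by apply/andP.
  have d1 := polar_disk kappa theta v (ltW u0) us.
  have d2 := polar_disk kappa theta v' (ltW u0') us'.
  apply: (shear_injective lam01 h_diff g_diff hgk dilatation) => //;
    [exact: disk1|exact: disk1|exact: Ts|exact: Ts|].
  by apply: complex_ext; rewrite ?cReD ?cImD ?cRe_conj ?cIm_conj.
have Kp u : 0 <= u -> u <= 0 + s -> 0 < kappa * K u ->
    exists2 d, 0 < d & forall u', `|u' - u| < d -> 0 < kappa * K u'.
  rewrite add0r => u0 us; rewrite pmulr_rgt0 // => Ku.
  have := cK u u0 us => /cvgrPdist_lt /(_ (K u) Ku) /nbhs_ballP[d /= d0 hd].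
  exists d => // u' hu; rewrite pmulr_rgt0 //.
  have := hd u'; rewrite /ball /= distrC => /(_ hu).
  by rewrite ltr_norml => /andP[_]; lra.
have := area_image_ge p1 p2 inj s0 sl Kp.
rewrite add0r -mulrBr => H; apply: le_trans (H _) _.
  move=> u v sq; have [u0 u1 us] := sq_bounds sq s1.
  rewrite partials_det // ger0_norm; last first.
    apply: mulr_ge0; [exact: ltW|apply: mulr_ge0 => //; apply: mulr_ge0].
      exact/ltW/lam_factor_gt0.
    exact: jac_weight_ge0.
  by rewrite ler_pM2l //; apply: hK.
have mimg Q : compact Q -> Q `<=` square 0 0 s -> measurable (F kappa theta @` Q : set RR).
  move=> cQ Qs; apply: compact_measurable2; apply: continuous_image_compact2 cQ.
  move=> u v /Qs sq; exists (polar_re_u dh dg kappa theta u v), (polar_re_v dh dg kappa theta u v).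
  by exists (polar_im_u dh dg kappa theta u v), (polar_im_v dh dg kappa theta u v);
      split; [exact: p1|exact: p2].
(* For [s = r] the side [u = s] parametrizes points of the circle, outside the open disk; its image
   is null and may be added to [fimg r]. *)
have E0 : mu2 (F kappa theta @` ([set s] `*` `[0, 0 + s])) = 0.
  by apply: (vertical_edge_null p1 p2); rewrite ?add0r // ltW.
have mE : measurable (F kappa theta @` ([set s] `*` `[0, 0 + s]) : set RR).
  apply: mimg; first by apply: compact_setX; [exact: compact_set1|exact: segment_compact].
  move=> [u v] [/= ->]; rewrite in_itv /= add0r => /andP[v0 vs].
  by apply/squareP; rewrite !add0r; split => //; exact: ltW.
have mf : measurable (fimg r) by apply: measurable_fimg => //; exact: lt_le_trans sr.
have <- := measureU0 mf mE E0; apply: le_measure; rewrite ?inE.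
- by apply: mimg => //; exact: compact_square.
- exact: measurableU.
move=> _ [[u v] sq <-]; have /squareP[u0 us v0 vs] := sq.
have [us'|us'] := ltP u s; first by left; apply: F_fimg => //; exact: lt_le_trans sr.
right; exists (u, v) => //; split => /=; last by rewrite in_itv /= v0.
by apply/eqP; rewrite eq_le us' andbT; rewrite add0r in us.
Qed.

End AreaOfDisk.

(** * Real estimates *)

Section RealEstimates.
Variable R : realType.
Implicit Types (f g : R -> R) (x e : R).

Lemma powR_expR x e : 0 < x -> x `^ e = expR (e * ln x).
Proof. by move=> x0; rewrite /powR gt_eqF. Qed.

Definition sloped f x := exists k, has_slope f x k.

Lemma sloped_cst (c x : R) : sloped (fun=> c) x.
Proof. by exists 0; exact: slope_of_partials (has_partials_cst c x 0). Qed.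

Lemma sloped_id x : sloped id x.
Proof. by exists 1; exact: slope_of_partials (has_partials_fst x 0). Qed.

Lemma slopedD f g x : sloped f x -> sloped g x -> sloped (fun y => f y + g y) x.
Proof.
move=> [k hf] [l hg]; eexists.
exact: slope_of_partials (has_partialsD (partials_of_slope 0 hf) (partials_of_slope 0 hg)).
Qed.

Lemma slopedB f g x : sloped f x -> sloped g x -> sloped (fun y => f y - g y) x.
Proof.
move=> [k hf] [l hg]; eexists.
exact: slope_of_partials (has_partialsB (partials_of_slope 0 hf) (partials_of_slope 0 hg)).
Qed.

Lemma slopedM f g x : sloped f x -> sloped g x -> sloped (fun y => f y * g y) x.
Proof.
move=> [k hf] [l hg]; eexists.
exact: slope_of_partials (has_partialsM (partials_of_slope 0 hf) (partials_of_slope 0 hg)).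
Qed.

Lemma slopedV f x : f x != 0 -> sloped f x -> sloped (fun y => (f y)^-1) x.
Proof.
move=> f0 [k hf]; eexists.
exact: slope_of_partials (has_partialsV (f := fun x _ => f x) (v := 0) f0 (partials_of_slope 0 hf)).
Qed.

Lemma slopedX f x n : sloped f x -> sloped (fun y => f y ^+ n) x.
Proof.
move=> hf; elim: n => [|n IH]; first exact: sloped_cst.
have [l hl] := slopedM hf IH; exists l.
by apply: has_slope_eq hl => // y; rewrite exprS.
Qed.

Lemma sloped_powR f x e : 0 < f x -> sloped f x -> sloped (fun y => f y `^ e) x.
Proof.
move=> f0 [k hf]; eexists.
apply: slope_of_partials (has_partials_slope (f := fun x _ => f x) (v := 0)
  (p := fun y => y `^ e) _ (partials_of_slope 0 hf)).
by apply/is_derive_slope; exact: is_derive1_powR.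
Qed.

Lemma sloped_continuous f x : sloped f x -> {for x, continuous f}.
Proof. by move=> [k /has_slope_continuous]. Qed.

Lemma slope_ge0_le (p k : R -> R) u1 u2 : u1 < u2 ->
  (forall u, u1 <= u -> u <= u2 -> has_slope p u (k u)) ->
  (forall u, u1 <= u -> u <= u2 -> 0 <= k u) -> p u1 <= p u2.
Proof.
move=> u12 hp k0.
have [||c] := @MVT R p k u1 u2 u12.
- by move=> x; rewrite in_itv /= => /andP[/ltW ? /ltW ?]; apply/is_derive_slope; exact: hp.
- apply: continuous_in_subspaceT => x; rewrite inE /= in_itv /= => /andP[? ?].
  by apply: has_slope_continuous (hp x _ _).
- rewrite in_itv /= => /andP[/ltW c1 /ltW c2] e.
  by rewrite -subr_ge0 e mulr_ge0 ?k0 // subr_ge0 ltW.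
Qed.

(** With [c] this cosine, the triple angle formula for [cos pi = -1] reads
    [(c + 1) (2 c - 1)^2 = 0], and [c >= 0]. *)
Lemma cos_pithird : cos (pi / 3) = 1 / 2 :> R.
Proof.
set c := cos _.
have p0 := pi_gt0 R.
have c0 : 0 <= c by apply: cos_ge0_pihalf; apply/andP; split; lra.
have : cos (pi / 3 + pi / 3 *+ 2) = - 1 :> R.
  by rewrite -cospi; congr cos; move: (pi : R) => p; field.
rewrite cosD cos_mulr2n sin_mulr2n -/c.
have -> : sin (pi / 3) * ((c * sin (pi / 3)) *+ 2) = 2 * c * (1 - c ^+ 2) :> R.
  by rewrite -sin2cos2; ring.
rewrite -/c => h; have /eqP : (c + 1) * (2 * c - 1) ^+ 2 = 0.
  have -> : (c + 1) * (2 * c - 1) ^+ 2 = (c * (c ^+ 2 *+ 2 - 1) - 2 * c * (1 - c ^+ 2)) + 1 by ring.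
  by rewrite -sin2cos2; rewrite -sin2cos2 in h; move: h; lra.
rewrite mulf_eq0 sqrf_eq0 gt_eqF /=; last by lra.
by move/eqP; lra.
Qed.

Lemma cos_ge_half x : - (pi / 3) <= x -> x <= pi / 3 -> 1 / 2 <= cos x.
Proof.
move=> x1 x2; have p0 := pi_gt0 R.
have ax : `|x| <= pi / 3 by rewrite ler_norml x1.
rewrite -cos_pithird -(cos_norm x) leNgt; apply/negP.
rewrite ltr_cos ?in_itv /=; first by rewrite ltNge ax.
  by apply/andP; split => //; lra.
by apply/andP; split => //; lra.
Qed.

Lemma atan_le x : 0 <= x -> atan x <= x.
Proof.
rewrite le_eqVlt => /predU1P[<-|x0]; first by rewrite atan0.
rewrite -subr_ge0.
have := @slope_ge0_le (fun y => y - atan y) (fun y => 1 - (1 + y ^+ 2)^-1) 0 x x0.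
rewrite atan0 subr0; apply => u _ _.
  have ha : has_slope (@atan R) u (1 + u ^+ 2)^-1 by apply/is_derive_slope; exact: is_derive1_atan.
  exact: slope_of_partials (has_partialsB (has_partials_fst u 0) (partials_of_slope 0 ha)).
by rewrite subr_ge0 invf_le1 ?lerDl ?sqr_ge0 // ltr_pwDl // sqr_ge0.
Qed.

(** In the disk of radius [s] the argument of [(1 + z) / (1 - z)] is at most [2 atan s <= 2 s] in
    absolute value, because [tan (2 atan s) = 2 s / (1 - s^2)]. Hence [b] times it is at most
    [2 < pi]. *)
Lemma atan_disk (x y s b : R) : 0 < s -> s < 1 -> 0 < b -> b * s <= 1 ->
  x ^+ 2 + y ^+ 2 < s ^+ 2 ->
  - pi < b * atan (2 * y / (1 - (x ^+ 2 + y ^+ 2))) < pi.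
Proof.
move=> s0 s1 b0 bs n.
have key (w : R) : 0 <= w -> x ^+ 2 + w ^+ 2 < s ^+ 2 ->
    0 <= b * atan (2 * w / (1 - (x ^+ 2 + w ^+ 2))) < pi.
  move=> w0 nw.
  have ws : w < s by rewrite -(@ltr_sqr _ w) ?nnegrE // ?(ltW s0) //; have := sqr_ge0 x; lra.
  have s2 : s ^+ 2 < 1 by rewrite expr_lt1 // ltW.
  have d0 : 0 < 1 - (x ^+ 2 + w ^+ 2) by lra.
  have d1 : 0 < 1 - s ^+ 2 by lra.
  have A0 : 0 <= atan (2 * w / (1 - (x ^+ 2 + w ^+ 2))).
    by rewrite -(atan0 R); apply: le_atan; rewrite divr_ge0 ?mulr_ge0 // ltW.
  rewrite mulr_ge0 ?(ltW b0) //=.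
  have p2 := pi_ge2 R.
  have at0 : 0 < atan s by rewrite -(atan0 R); exact: lt_atan.
  have at1 : atan s < pi / 4 by rewrite -(atan1 R); exact: lt_atan.
  have T : tan (atan s *+ 2) = 2 * s / (1 - s ^+ 2).
    rewrite tan_mulr2n ?atanK; first by rewrite mulr_natl.
    by rewrite gt_eqF // cos_gt0_pihalf // atan_gtNpi2 atan_ltpi2.
  have a2 : atan (2 * s / (1 - s ^+ 2)) = atan s *+ 2.
    by rewrite -T tanK // in_itv /=; apply/andP; split; lra.
  have le1 : atan (2 * w / (1 - (x ^+ 2 + w ^+ 2))) <= atan s *+ 2.
    rewrite -a2; apply: le_atan.
    rewrite ler_pM ?mulr_ge0 ?invr_ge0 ?(ltW d0) //; first by lra.
    by rewrite lef_pV2 ?posrE //; lra.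
  have le2 := atan_le (ltW s0).
  (* If [pi] were [2], then [cos 1 = cos (pi / 2) = 0]. *)
  have p2' : 2 < pi :> R.
    rewrite lt_neqAle p2 andbT; apply/eqP => e2; have := cos1_gt0 R.
    by have := cos_pihalf R; rewrite -e2 divff ?pnatr_eq0 // => ->; rewrite ltxx.
  apply: (@le_lt_trans _ _ (b * (2 * s))); last by lra.
  by rewrite ler_pM2l //; lra.
have [y0|y0] := leP 0 y.
  by have /andP[h1 h2] := key y y0 n; apply/andP; split => //; have := pi_gt0 R; lra.
have := key (- y); rewrite sqrrN mulrN mulNr atanN mulrN => /(_ _ n) h.
have /andP[h1 h2] := h ltac:(by lra).
by apply/andP; split; have := pi_gt0 R; lra.
Qed.

End RealEstimates.

(** * Bounds for the Jacobian on circles *)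

Section WeightBounds.
Variable R : realType.
Variables (a lam : R).
Hypothesis lam01 : 0 <= lam < 1.
Local Notation W := (jac_weight a lam).

Lemma ler_powR_ge0 (b p e : R) : 0 <= e -> 0 < b -> b <= p -> b `^ e <= p `^ e.
Proof.
move=> e0 b0 bp; apply: ge0_ler_powR => //; rewrite nnegrE ?ltW //.
exact: lt_le_trans bp.
Qed.

Lemma ler_powR_le0 (b p e : R) : e <= 0 -> 0 < b -> b <= p -> p `^ e <= b `^ e.
Proof.
move=> e0 b0 bp; have p0 := lt_le_trans b0 bp.
rewrite -(opprK e) !(powRN _ (- e)) lef_pV2 ?posrE ?powR_gt0 //.
by apply: ler_powR_ge0 => //; rewrite oppr_ge0.
Qed.

Lemma powR_sqr (x e : R) : 0 < x -> (x ^+ 2) `^ e = x `^ (2 * e).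
Proof. by move=> x0; rewrite powRrM powR_mulrn // ltW. Qed.

(** With [|1 + z|] and [|1 - z|] separated, the exponents are [a - 1] and [- (a + 1)]. Their signs
    decide which end of the range of each modulus is extremal, and they change at [a = 1] and
    [a = -1]: hence the three cases of the theorem. *)
Lemma jac_weightE x y : 0 < plus_sq x y -> 0 < minus_sq x y ->
  W x y = plus_sq x y `^ (a - 1) * minus_sq x y `^ (- (a + 1)) / lam_sq lam x y.
Proof.
rewrite /jac_weight; set P := plus_sq x y; set M := minus_sq x y => P0 M0.
rewrite !powR_expR ?divr_gt0 // ln_div ?posrE //.
rewrite (_ : a * (ln P - ln M) = (a - 1) * ln P + (- (a + 1)) * ln M + (ln P + ln M)); last by ring.
rewrite !expRD !lnK ?posrE //.
have PM0 : P * M != 0 by rewrite mulf_neq0 ?gt_eqF.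
by rewrite -[RHS]mulr1 -(divff PM0) mulf_div.
Qed.

Section Circle.
Variables (u x y : R).
Hypothesis u0 : 0 <= u.
Hypothesis u1 : u < 1.
Hypothesis xy : x ^+ 2 + y ^+ 2 = u ^+ 2.

Lemma circle_x : - u <= x <= u.
Proof.
have : `|x| <= u.
  by rewrite -(@ler_sqr _ `|x|) ?nnegrE // real_normK ?num_real // -xy lerDl sqr_ge0.
by rewrite ler_norml.
Qed.

Lemma plus_sqE : plus_sq x y = 1 + u ^+ 2 + 2 * x.
Proof. by rewrite /plus_sq -xy; ring. Qed.

Lemma minus_sqE : minus_sq x y = 1 + u ^+ 2 - 2 * x.
Proof. by rewrite /minus_sq -xy; ring. Qed.

Lemma lam_sqE : lam_sq lam x y = 1 + (lam * u) ^+ 2 - 2 * (lam * x).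
Proof. by rewrite /lam_sq [(lam * u) ^+ 2]exprMn -xy; ring. Qed.

Lemma plus_sq_bounds : (1 - u) ^+ 2 <= plus_sq x y <= (1 + u) ^+ 2.
Proof.
have /andP[? ?] := circle_x; rewrite plus_sqE; apply/andP; split.
  by rewrite (_ : (1 - u) ^+ 2 = 1 + u ^+ 2 - 2 * u); [lra|ring].
by rewrite (_ : (1 + u) ^+ 2 = 1 + u ^+ 2 + 2 * u); [lra|ring].
Qed.

Lemma minus_sq_bounds : (1 - u) ^+ 2 <= minus_sq x y <= (1 + u) ^+ 2.
Proof.
have /andP[? ?] := circle_x; rewrite minus_sqE; apply/andP; split.
  by rewrite (_ : (1 - u) ^+ 2 = 1 + u ^+ 2 - 2 * u); [lra|ring].
by rewrite (_ : (1 + u) ^+ 2 = 1 + u ^+ 2 + 2 * u); [lra|ring].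
Qed.

Lemma lam_sq_bounds : (1 - lam * u) ^+ 2 <= lam_sq lam x y <= (1 + lam * u) ^+ 2.
Proof.
have /andP[x1 x2] := circle_x; have /andP[l0 _] := lam01; rewrite lam_sqE.
have h1 := ler_wpM2l l0 x1; have h2 := ler_wpM2l l0 x2.
apply/andP; split.
  by rewrite (_ : (1 - lam * u) ^+ 2 = 1 + (lam * u) ^+ 2 - 2 * (lam * u)); [lra|ring].
by rewrite (_ : (1 + lam * u) ^+ 2 = 1 + (lam * u) ^+ 2 + 2 * (lam * u)); [lra|ring].
Qed.

Lemma lam_u : 0 <= lam * u < 1.
Proof.
have /andP[l0 l1] := lam01; rewrite mulr_ge0 //=.
by apply: le_lt_trans u1; rewrite -[leRHS]mul1r ler_wpM2r // ltW.
Qed.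

Let sq1 : 0 < (1 - u) ^+ 2. Proof. by rewrite exprn_gt0 // subr_gt0. Qed.
Let P0 : 0 < plus_sq x y.
Proof. by have /andP[h _] := plus_sq_bounds; exact: lt_le_trans h. Qed.
Let M0 : 0 < minus_sq x y.
Proof. by have /andP[h _] := minus_sq_bounds; exact: lt_le_trans h. Qed.
Let num0 : 0 <= u - lam ^+ 2 * u ^+ 3.
Proof.
rewrite (_ : _ - _ = u * (1 - lam ^+ 2 * u ^+ 2)); last by ring.
by rewrite mulr_ge0 // ltW // lam_factor_gt0.
Qed.

Lemma weight_upper bp bm : plus_sq x y `^ (a - 1) <= bp -> minus_sq x y `^ (- (a + 1)) <= bm ->
  u * ((1 - lam ^+ 2 * u ^+ 2) * W x y) <= (u - lam ^+ 2 * u ^+ 3) * (bp * bm / (1 - lam * u) ^+ 2).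
Proof.
move=> hp hm; rewrite (_ : u * _ = (u - lam ^+ 2 * u ^+ 3) * W x y); last by ring.
rewrite ler_wpM2l // jac_weightE //.
have /andP[lu0 lu1] := lam_u; have /andP[q1 _] := lam_sq_bounds.
have L0 : 0 < (1 - lam * u) ^+ 2 by rewrite exprn_gt0 // subr_gt0.
have Q0 := lt_le_trans L0 q1.
apply: ler_pM.
- by rewrite mulr_ge0 ?powR_ge0.
- by rewrite invr_ge0 ltW.
- by apply: ler_pM => //; exact: powR_ge0.
- by rewrite lef_pV2 ?posrE.
Qed.

Lemma weight_lower bp bm : 0 <= bp -> 0 <= bm ->
  bp <= plus_sq x y `^ (a - 1) -> bm <= minus_sq x y `^ (- (a + 1)) ->
  (u - lam ^+ 2 * u ^+ 3) * (bp * bm / (1 + lam * u) ^+ 2) <= u * ((1 - lam ^+ 2 * u ^+ 2) * W x y).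
Proof.
move=> p0 m0 hp hm; rewrite (_ : u * _ = (u - lam ^+ 2 * u ^+ 3) * W x y); last by ring.
rewrite ler_wpM2l // jac_weightE //.
have /andP[lu0 lu1] := lam_u; have /andP[q1 q2] := lam_sq_bounds.
have L0 : 0 < (1 - lam * u) ^+ 2 by rewrite exprn_gt0 // subr_gt0.
have Q0 := lt_le_trans L0 q1.
have Q1 := lt_le_trans Q0 q2.
apply: ler_pM.
- by rewrite mulr_ge0.
- by rewrite invr_ge0 ltW.
- by apply: ler_pM.
- by rewrite lef_pV2 ?posrE.
Qed.

(** The constant is [12 / 25 = (3 / 4) * (16 / 25)]. For [x >= u / 2], [(1 + u) (1 - u + u^2) = 1 +
    u^3 <= 1 + u + u^2] gives [|(1 + z) / (1 - z)|^2 >= 1 + u], whose power [a >= 2] is at least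
    [(1 + u)^2]. Next, [(1 - lam^2 u^2) / |1 - lam z|^2 >= (1 - u) / (1 + u)], so the product is at
    least [1 - u^2 >= 3 / 4]. Finally [|1 - z^2|^2 <= (1 + u^2)^2 <= 25 / 16]. For [a <= -2] the
    signs of [a] and [x] are reversed. *)
Lemma weight_sector : u <= 1 / 2 -> (2 <= a /\ u / 2 <= x) \/ (a <= - 2 /\ x <= - (u / 2)) ->
  12 / 25 * u <= u * ((1 - lam ^+ 2 * u ^+ 2) * W x y).
Proof.
move=> uh hx; have hu0 := u0; have hu1 := u1; rewrite mulrC ler_wpM2l // /jac_weight.
have /andP[lu0 lu1] := lam_u; have /andP[q1 q2] := lam_sq_bounds.
have L0 : 0 < (1 - lam * u) ^+ 2 by rewrite exprn_gt0 // subr_gt0.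
have Q0 := lt_le_trans L0 q1.
have G : (1 + u) ^+ 2 <= (plus_sq x y / minus_sq x y) `^ a.
  have gen (b p m : R) : 2 <= b -> 0 < m -> (1 + u) * m <= p -> (1 + u) ^+ 2 <= (p / m) `^ b.
    move=> b2 m0 pm; have u10 : 0 <= 1 + u by lra.
    rewrite -(powR_mulrn 2 u10).
    have pmu : 1 + u <= p / m by rewrite ler_pdivlMr.
    apply: (@le_trans _ _ ((p / m) `^ 2)); first by apply: ler_powR_ge0 => //; lra.
    by apply: ler_powR => //; lra.
  have u2 : 0 <= u * u by rewrite mulr_ge0.
  case: hx => -[ha hx].
    apply: gen => //; rewrite plus_sqE minus_sqE.
    have : (1 + u) * (1 + u ^+ 2 - 2 * x) <= (1 + u) * (1 + u ^+ 2 - u) by rewrite ler_wpM2l //; lra.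
    by nra.
  have -> : (plus_sq x y / minus_sq x y) `^ a = (minus_sq x y / plus_sq x y) `^ (- a).
    by rewrite !powR_expR ?divr_gt0 // !ln_div ?posrE //; congr expR; ring.
  apply: gen => //; first by lra.
  rewrite plus_sqE minus_sqE.
  have : (1 + u) * (1 + u ^+ 2 + 2 * x) <= (1 + u) * (1 + u ^+ 2 - u) by rewrite ler_wpM2l //; lra.
  by nra.
have PM : plus_sq x y * minus_sq x y <= 25 / 16.
  rewrite plus_sqE minus_sqE.
  rewrite (_ : _ * _ = (1 + u ^+ 2) ^+ 2 - 4 * x ^+ 2); last by ring.
  have := sqr_ge0 x.
  have : (1 + u ^+ 2) ^+ 2 <= (5 / 4) ^+ 2.
    rewrite ler_sqr ?nnegrE ?addr_ge0 ?sqr_ge0 //.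
    have : u ^+ 2 <= (1 / 2) ^+ 2 by rewrite ler_sqr ?nnegrE.
    lra.
  lra.
have PM0 : 0 < plus_sq x y * minus_sq x y by rewrite mulr_gt0.
rewrite mulrA ler_pdivlMr ?mulr_gt0 //.
have QPM : lam_sq lam x y * (plus_sq x y * minus_sq x y) <= (1 + lam * u) ^+ 2 * (25 / 16).
  by apply: ler_pM => //; exact: ltW.
have luu : lam * u <= u.
  by have /andP[_ /ltW l1] := lam01; rewrite -[leRHS]mul1r ler_wpM2r.
have F0 := lam_factor_gt0 lam01 u0 u1.
apply: (@le_trans _ _ ((1 - lam ^+ 2 * u ^+ 2) * (1 + u) ^+ 2)); last first.
  by rewrite ler_wpM2l // ltW.
apply: (@le_trans _ _ (12 / 25 * ((1 + lam * u) ^+ 2 * (25 / 16)))); first by rewrite ler_wpM2l.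
move: lu0 lu1 luu; rewrite (_ : 1 - lam ^+ 2 * u ^+ 2 = (1 - lam * u) * (1 + lam * u)); last by ring.
move: (lam * u) => l l0 l1 lu.
rewrite (_ : 12 / 25 * ((1 + l) ^+ 2 * (25 / 16)) = (1 + l) * (3 / 4 * (1 + l))); last by field.
rewrite (_ : (1 - l) * (1 + l) * (1 + u) ^+ 2 = (1 + l) * ((1 - l) * (1 + u) ^+ 2)); last by ring.
rewrite ler_pM2l; last by lra.
apply: (@le_trans _ _ (3 / 4 * (1 + u))); first by lra.
apply: (@le_trans _ _ ((1 - u) * (1 + u) ^+ 2)); last by rewrite ler_wpM2r ?sqr_ge0 //; lra.
rewrite (_ : (1 - u) * (1 + u) ^+ 2 = (1 - u ^+ 2) * (1 + u)); last by ring.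
rewrite ler_pM2r; last by lra.
have : u ^+ 2 <= (1 / 2) ^+ 2 by rewrite ler_sqr ?nnegrE.
lra.
Qed.

End Circle.
End WeightBounds.

(** * The lower bound for [r = 1] *)

Section TailIntegral.
Variable R : realType.
Variable b : R.
Hypothesis b2 : 2 < b.

(** With [b = |a|], [u * tail_weight u] is the integrand of the lower bound for [lam = 0], which
    dominates those for [lam > 0]. *)
Definition tail_weight (u : R) : R := (1 - u) `^ (2 * (b - 1)) / (1 + u) `^ (2 * (b + 1)).

Let E (e u : R) := expR (e * (ln (1 - u) - ln (1 + u))).
(* With [t = (1 - u) / (1 + u)], so that [E e u = t^e], the integral of
   [u * tail_weight u] becomes that of [- (1 - t^2) t^(2b-2) / 8]. *)
Let B (u : R) :=
  (- (1 / 8) / (2 * b - 1)) * E (2 * b - 1) u + (1 / 8 / (2 * b + 1)) * E (2 * b + 1) u.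

Let E_slope e u : 0 <= u -> u < 1 ->
  has_slope (E e) u (E e u * (e * (- (1 - u)^-1 - (1 + u)^-1))).
Proof.
move=> u0 u1; apply: (slope_of_partials (v := 0) (B := 0)).
have hln x : 0 < x -> has_slope (@ln R) x x^-1.
  by move=> x0; apply/is_derive_slope; exact: is_derive1_ln.
have h1 := has_partials_slope (f := fun x _ => 1 - x) (v := 0) (hln (1 - u) ltac:(lra))
  (has_partialsB (has_partials_cst 1 u 0) (has_partials_fst u 0)).
have h2 := has_partials_slope (f := fun x _ => 1 + x) (v := 0) (hln (1 + u) ltac:(lra))
  (has_partialsD (has_partials_cst 1 u 0) (has_partials_fst u 0)).
have h3 := has_partialsM (has_partials_cst e u 0) (has_partialsB h1 h2).
by apply: has_partials_cast (has_partials_slope (f := fun x _ => e * (ln (1 - x) - ln (1 + x)))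
  (v := 0) (expR_slope _) h3) _ _; rewrite /E; ring.
Qed.

Let B_slope u : 0 <= u -> u < 1 -> has_slope B u (u * tail_weight u).
Proof.
move=> u0 u1; have hb := b2.
have n1 : 1 - u != 0 by rewrite gt_eqF //; lra.
have n2 : 1 + u != 0 by rewrite gt_eqF //; lra.
have n3 : 2 * b - 1 != 0 by rewrite gt_eqF //; lra.
have n4 : 2 * b + 1 != 0 by rewrite gt_eqF //; lra.
apply: (slope_of_partials (v := 0) (B := 0)).
have e1 := partials_of_slope 0 (E_slope (2 * b - 1) u0 u1).
have e2 := partials_of_slope 0 (E_slope (2 * b + 1) u0 u1).
apply: has_partials_cast (has_partials_lin (- (1 / 8) / (2 * b - 1)) (1 / 8 / (2 * b + 1))
  e1 e2) _ _; last by ring.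
have l1 : expR (ln (1 - u)) = 1 - u by rewrite lnK // posrE; lra.
have l2 : expR (ln (1 + u)) = 1 + u by rewrite lnK // posrE; lra.
have E2 : E (2 * b + 1) u = E (2 * b - 1) u * ((1 - u) / (1 + u)) ^+ 2.
  rewrite /E (_ : (2 * b + 1) * (ln (1 - u) - ln (1 + u)) = (2 * b - 1) * (ln (1 - u) - ln (1 + u)) +
    (ln (1 - u) - ln (1 + u)) + (ln (1 - u) - ln (1 + u))); last by ring.
  by rewrite !expRD expRN l1 l2 -mulrA -expr2.
have TE : tail_weight u = E (2 * b - 1) u / ((1 - u) * (1 + u) ^+ 3).
  rewrite /tail_weight !powR_expR; [|lra|lra].
  rewrite -expRN -expRD /E.
  rewrite (_ : 2 * (b - 1) * ln (1 - u) - 2 * (b + 1) * ln (1 + u) =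
     (2 * b - 1) * (ln (1 - u) - ln (1 + u)) +
     - (ln (1 - u) + ln (1 + u) + ln (1 + u) + ln (1 + u))); last by ring.
  rewrite expRD expRN !expRD l1 l2; congr (_ / _); ring.
rewrite TE E2; field.
by rewrite n1 n2 n3 n4.
Qed.

(** The increment of [N] is at most that of the explicit primitive [B], and [B r <= 0] while [- B 0]
    is the stated constant, the integral over the whole of [[0, 1]]. *)
Lemma tail_bound (N K : R -> R) r : 0 < r -> r < 1 ->
  (forall u, 0 <= u -> u <= r -> has_slope N u (K u)) ->
  (forall u, 0 <= u -> u <= r -> K u <= u * tail_weight u) ->
  N r - N 0 <= (4 * (4 * b ^+ 2 - 1))^-1.
Proof.
move=> r0 r1 hN hK; have hb := b2.
have cmp : B 0 - N 0 <= B r - N r.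
  apply: (@slope_ge0_le _ (fun u => B u - N u) (fun u => u * tail_weight u - K u) 0 r r0).
    move=> u u0 ur; have u1 : u < 1 by lra.
    exact: slope_of_partials (has_partialsB (partials_of_slope 0 (B_slope u0 u1))
       (partials_of_slope 0 (hN u u0 ur))).
  by move=> u u0 ur; rewrite subr_ge0 hK.
have B0 : B 0 = - (4 * (4 * b ^+ 2 - 1))^-1.
  rewrite /B /E subr0 addr0 ln1 subrr !mulr0 expR0 !mulr1.
  have -> : 4 * b ^+ 2 - 1 = (2 * b - 1) * (2 * b + 1) by ring.
  by field; rewrite !gt_eqF //; lra.
have Br : B r <= 0.
  have l : ln (1 - r) - ln (1 + r) <= 0 by rewrite subr_le0 ler_ln ?posrE; lra.
  have EE : E (2 * b + 1) r <= E (2 * b - 1) r.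
    by rewrite /E ler_expR ler_wnM2r //; lra.
  have E0 : 0 < E (2 * b + 1) r by exact: expR_gt0.
  have i1 : (2 * b + 1)^-1 <= (2 * b - 1)^-1 by rewrite lef_pV2 ?posrE; lra.
  have i0 : 0 < (2 * b + 1)^-1 by rewrite invr_gt0; lra.
  have : (2 * b + 1)^-1 * E (2 * b + 1) r <= (2 * b - 1)^-1 * E (2 * b - 1) r.
    by apply: ler_pM => //; exact: ltW.
  rewrite /B; lra.
by rewrite B0 in cmp; lra.
Qed.

End TailIntegral.

(** * Lower bound of the area for every [a] *)

Section LowerBound.
Variable R : realType.
Local Notation Re := (@complex.Re R).
Local Notation Im := (@complex.Im R).
Local Notation mu := (@lebesgue_measure R).
Local Notation RR := (measurableTypeR R * measurableTypeR R)%type.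
Local Notation mu2 := ((mu \x mu)%E : set RR -> \bar R).
Variables (a lam : R) (h g dh dg : R[i] -> R[i]).
Hypothesis lam01 : 0 <= lam < 1.
Hypothesis h_diff : forall z, disk 1 z -> cdiff h z (dh z).
Hypothesis g_diff : forall z, disk 1 z -> cdiff g z (dg z).
Hypothesis hgk : forall z, disk 1 z -> h z - g z = k a z.
Hypothesis dilatation : forall z, disk 1 z ->
  dh z != 0 /\ dg z / dh z = (lam%:C)%C * z.

Lemma arg_small_a (t : R) : `|a| <= 2 -> - pi < a * atan t < pi.
Proof.
rewrite ler_norml => /andP[a1 a2].
have t1 := atan_gtNpi2 t; have t2 := atan_ltpi2 t; have p0 := pi_gt0 R.
rewrite -ltr_norml normrM.
have at2 : `|atan t| < pi / 2 by rewrite ltr_norml t1 t2.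
have a2' : `|a| <= 2 by rewrite ler_norml a1 a2.
apply: (@le_lt_trans _ _ (2 * `|atan t|)); first by rewrite ler_wpM2r.
by move: at2; lra.
Qed.

Lemma arg_small_disk s z : 0 < s -> s < 1 -> 0 < `|a| -> `|a| * s <= 1 -> disk s z ->
  - pi < a * atan (2 * Im z / (1 - (Re z ^+ 2 + Im z ^+ 2))) < pi.
Proof.
move=> s0 s1 a0 as1 dz.
have := @atan_disk R (Re z) (Im z) s `|a| s0 s1 a0 as1 dz.
move: (atan _) => t; have [ap|an] := leP 0 a; first by rewrite ger0_norm.
by rewrite ltr0_norm // mulNr => /andP[? ?]; apply/andP; split; lra.
Qed.

Lemma fimg_lower_radial r (K : R -> R) : 0 < r -> r < 1 ->
  (forall u, 0 <= u -> u <= r -> {for u, continuous K}) ->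
  (forall u x y, 0 <= u -> u <= r -> x ^+ 2 + y ^+ 2 = u ^+ 2 ->
     K u <= u * ((1 - lam ^+ 2 * u ^+ 2) * jac_weight a lam x y)) ->
  (2 < `|a| -> forall u, 0 <= u -> u <= r -> K u <= u * tail_weight `|a| u) ->
  ((2 * pi)%:E * \int[mu]_(u in `[0%R, r]) (K u)%:E <= mu2 (fimg h g r))%E.
Proof.
move=> r0 r1 cK hK tK; have p0 := pi_gt0 R.
have [N [hN ->]] := primitive r0 cK; rewrite -EFinM.
have low := fimg_lower lam01 h_diff g_diff hgk dilatation.
have [easy|] := boolP ((`|a| <= 2) || (`|a| * r <= 1)).
  have -> : 2 * pi * (N r - N 0) = r * (2 * pi / r * (N r - N 0)) by field; rewrite gt_eqF.
  apply: (low r r (2 * pi / r) 0 K N) => //.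
  - by rewrite divr_gt0 // mulr_gt0.
  - by rewrite mulfVK // gt_eqF.
  - move=> z dz; have [a2|a2] := leP `|a| 2; first exact: arg_small_a.
    rewrite leNgt a2 /= in easy; apply: (@arg_small_disk r) => //; lra.
  - move=> u v /squareP[u0]; rewrite add0r => ur _ _.
    by apply: hK => //; exact: polar_sqr.
(* [f] may fail to be injective here; the sector of radius [s = 1 / |a|] suffices. *)
rewrite negb_or -!ltNge => /andP[a2 ar].
have b0 : 0 < `|a| by lra.
pose s := `|a|^-1.
have s0 : 0 < s by rewrite invr_gt0.
have bs : `|a| * s = 1 by rewrite mulfV // gt_eqF.
have sr : s <= r by rewrite -(ler_pM2l b0) bs ltW.
have sh : s <= 1 / 2 by rewrite -(ler_pM2l b0) bs; lra.
have tail := tail_bound a2 r0 r1 hN (tK a2).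
(* The sector is centred on the positive real axis for [a > 0] and on the negative one for
   [a < 0]. *)
pose th : R := if 0 <= a then - (pi / 3) else 2 * pi / 3.
pose ka : R := 2 * pi / 3 / s.
have ka0 : 0 < ka by rewrite !divr_gt0 // mulr_gt0.
have kas : ka * s = 2 * pi / 3 by rewrite mulfVK // gt_eqF.
(* The sector yields at least [(2 pi / 3) (6 / 25) s^2 = 4 pi / (25 a^2)]. *)
pose K' (u : R) := 12 / 25 * u; pose N' (u : R) := 6 / 25 * (u * u).
have sN' u : has_slope N' u (K' u).
  apply: (slope_of_partials (v := 0) (B := 0)).
  by apply: has_partials_cast (has_partialsM (has_partials_cst (6 / 25) u 0)
    (has_partialsM (has_partials_fst u 0) (has_partials_fst u 0))) _ _; rewrite /K'; field.
apply: (@le_trans _ _ (s * (ka * (N' s - N' 0)))%:E).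
  rewrite lee_fin mulrA [s * ka]mulrC kas /N' mulr0 mulr0 subr0.
  have b2 : 4 < `|a| ^+ 2.
    have : (2 : R) ^+ 2 < `|a| ^+ 2 by rewrite ltr_sqr ?nnegrE.
    lra.
  have s2 : s * s = (`|a| ^+ 2)^-1 by rewrite /s -invfM.
  rewrite s2; have bb : `|a| ^+ 2 * (`|a| ^+ 2)^-1 = 1 by rewrite mulfV // gt_eqF //; lra.
  (* This amounts to [25 / 2 * a^2 <= 16 * a^2 - 4], which holds because [a^2 > 4]. *)
  have i1 : (4 * (4 * `|a| ^+ 2 - 1))^-1 <= 2 / 25 * (`|a| ^+ 2)^-1.
    rewrite -[leRHS]invrK lef_pV2 ?posrE ?invr_gt0 ?mulr_gt0 ?invr_gt0 //; [|lra|lra].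
    by rewrite invfM invrK invf_div; lra.
  apply: (@le_trans _ _ (2 * pi * (2 / 25 * (`|a| ^+ 2)^-1))).
    by rewrite ler_pM2l ?mulr_gt0 //; exact: le_trans i1.
  by rewrite le_eqVlt; apply/orP; left; apply/eqP; move: (pi : R) => p; field; rewrite gt_eqF.
apply: (low r s ka th K' N') => //.
- by rewrite kas; lra.
- move=> z; apply: arg_small_disk => //; [lra|by rewrite bs].
- by move=> u _ _; exact: has_slope_continuous (slope_scale (12 / 25)
    (slope_of_partials (has_partials_fst u 0))).
move=> u v /squareP[u0 us v0 vs]; rewrite add0r in us vs.
have kv0 : 0 <= ka * v by rewrite mulr_ge0 // ltW.
have kv1 : ka * v <= 2 * pi / 3 by rewrite -kas ler_pM2l.
apply: weight_sector => //; [lra|exact: polar_sqr|lra|].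
rewrite /= /th; have [ap|an] := leP 0 a.
  left; split; first by move: a2; rewrite ger0_norm // => /ltW.
  by apply: ler_wpM2l => //; rewrite -[X in X <= _]mul1r; apply: cos_ge_half; lra.
right; split; first by move: a2; rewrite ltr0_norm //; lra.
(* Rotation by [pi] carries the sector about the negative axis to the one about the positive
   axis. *)
have -> : ka * v + 2 * pi / 3 = (ka * v - pi / 3) + pi by move: (pi : R) => p; field.
rewrite cosDpi mulrN lerN2; apply: ler_wpM2l => //.
by rewrite -[X in X <= _]mul1r; apply: cos_ge_half; lra.
Qed.

End LowerBound.

(** * Radial bounds for the powers and the final integrands *)

Section RadialBounds.
Variable R : realType.
Implicit Types (a lam u e c x : R).

Lemma powR_sq_ge0 u c e : 0 <= u -> u < 1 -> (1 - u) ^+ 2 <= c <= (1 + u) ^+ 2 -> 0 <= e ->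
  (1 - u) `^ (2 * e) <= c `^ e <= (1 + u) `^ (2 * e).
Proof.
move=> u0 u1 /andP[c1 c2] e0.
have s0 : 0 < (1 - u) ^+ 2 by rewrite exprn_gt0 // subr_gt0.
rewrite -!powR_sqr; [|lra|lra].
by rewrite !ler_powR_ge0 //; exact: lt_le_trans c1.
Qed.

Lemma powR_sq_le0 u c e : 0 <= u -> u < 1 -> (1 - u) ^+ 2 <= c <= (1 + u) ^+ 2 -> e <= 0 ->
  (1 + u) `^ (2 * e) <= c `^ e <= (1 - u) `^ (2 * e).
Proof.
move=> u0 u1 /andP[c1 c2] e0.
have s0 : 0 < (1 - u) ^+ 2 by rewrite exprn_gt0 // subr_gt0.
rewrite -!powR_sqr; [|lra|lra].
by rewrite !ler_powR_le0 //; exact: lt_le_trans c1.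
Qed.

Lemma powR_opp x a : x `^ (2 * - (a + 1)) = (x `^ (2 * (a + 1)))^-1.
Proof. by rewrite mulrN powRN. Qed.

(** For [-1 < a < 1] both powers are extremal at the same base, and their exponents add up to [-4];
    this is why [a] disappears from the middle case. *)
Lemma powR_mid x a : 0 < x -> x `^ (2 * (a - 1)) * x `^ (2 * - (a + 1)) = (x ^+ 4)^-1.
Proof.
move=> x0; rewrite -powRD; last by apply/implyP => _; rewrite gt_eqF.
rewrite (_ : 2 * (a - 1) + 2 * - (a + 1) = - 4%:R); last by ring.
by rewrite powRN powR_mulrn // ltW.
Qed.

Lemma sloped_num lam u : sloped (fun rho : R => rho - lam ^+ 2 * rho ^+ 3) u.
Proof.
apply: slopedB; first exact: sloped_id.
by apply: slopedM; [exact: sloped_cst|apply: slopedX; exact: sloped_id].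
Qed.

Lemma sloped_plus lam u : sloped (fun rho : R => 1 + lam * rho) u.
Proof. by apply: slopedD; [exact: sloped_cst|apply: slopedM; [exact: sloped_cst|exact: sloped_id]]. Qed.

Lemma sloped_minus lam u : sloped (fun rho : R => 1 - lam * rho) u.
Proof. by apply: slopedB; [exact: sloped_cst|apply: slopedM; [exact: sloped_cst|exact: sloped_id]]. Qed.

Lemma sloped_plus1 u : sloped (fun rho : R => 1 + rho) u.
Proof. by apply: slopedD; [exact: sloped_cst|exact: sloped_id]. Qed.

Lemma sloped_minus1 u : sloped (fun rho : R => 1 - rho) u.
Proof. by apply: slopedB; [exact: sloped_cst|exact: sloped_id]. Qed.

(** The factor [(1 - lam^2 u^2) / (1 + lam u)^2] is at most [1]. *)
Lemma tail_le lam u (X Z : R) : 0 <= lam < 1 -> 0 <= u -> u < 1 -> 0 <= X -> 0 < Z ->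
  (u - lam ^+ 2 * u ^+ 3) * X / ((1 + lam * u) ^+ 2 * Z) <= u * (X / Z).
Proof.
move=> lam01 u0 u1 X0 Z0; have /andP[l0 l1] := lam_u lam01 u0 u1.
rewrite invfM (_ : _ * _ = (u - lam ^+ 2 * u ^+ 3) / (1 + lam * u) ^+ 2 * (X / Z)); last by ring.
rewrite ler_wpM2r //; first by rewrite divr_ge0 // ltW.
rewrite ler_pdivrMr ?exprn_gt0 //; last by lra.
have : 0 <= u * (lam * u) by rewrite mulr_ge0.
have : 0 <= u * (lam * u) ^+ 2 by rewrite mulr_ge0 // sqr_ge0.
rewrite (_ : u * (1 + lam * u) ^+ 2 = u + 2 * (u * (lam * u)) + u * (lam * u) ^+ 2); last by ring.
rewrite (_ : lam ^+ 2 * u ^+ 3 = u * (lam * u) ^+ 2); last by ring.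
lra.
Qed.

End RadialBounds.

Theorem theorem2p6 (R : realType) (a lam : R) (h g : R[i] -> R[i]) :
  0 <= lam < 1 ->
  analytic_on (disk 1) h -> analytic_on (disk 1) g ->
  h 0 = 0 -> g 0 = 0 ->
  (forall z, disk 1 z -> h z - g z = k a z) ->
  (forall z, disk 1 z ->
     cderiv h z != 0 /\ cderiv g z / cderiv h z = (lam%:C)%C * z) ->
  forall r : R, 0 < r < 1 ->
  let A := area ((fun z => h z + (g z)^* ) @` disk r) in
  let I := fun F : R -> R =>
    ((2 * pi)%:E * \int[lebesgue_measure]_(rho in `[0%R, r%R]) (F rho)%:E)%E in
  let L1 := fun rho : R => (rho - lam ^+ 2 * rho ^+ 3) * (1 - rho) `^ (2 * (a - 1))
                    / ((1 + lam * rho) ^+ 2 * (1 + rho) `^ (2 * (a + 1))) in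
  let U1 := fun rho : R => (rho - lam ^+ 2 * rho ^+ 3) * (1 + rho) `^ (2 * (a - 1))
                    / ((1 - lam * rho) ^+ 2 * (1 - rho) `^ (2 * (a + 1))) in
  let L2 := fun rho : R => (rho - lam ^+ 2 * rho ^+ 3)
                    / ((1 + lam * rho) ^+ 2 * (1 + rho) ^+ 4) in
  let U2 := fun rho : R => (rho - lam ^+ 2 * rho ^+ 3)
                    / ((1 - lam * rho) ^+ 2 * (1 - rho) ^+ 4) in
  let L3 := fun rho : R => (rho - lam ^+ 2 * rho ^+ 3) * (1 + rho) `^ (2 * (a - 1))
                    / ((1 + lam * rho) ^+ 2 * (1 - rho) `^ (2 * (a + 1))) in
  let U3 := fun rho : R => (rho - lam ^+ 2 * rho ^+ 3) * (1 - rho) `^ (2 * (a - 1))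
                    / ((1 - lam * rho) ^+ 2 * (1 + rho) `^ (2 * (a + 1))) in
  (1 <= a -> (I L1 <= A <= I U1)%E) /\
  (-1 < a < 1 -> (I L2 <= A <= I U2)%E) /\
  (a <= -1 -> (I L3 <= A <= I U3)%E).
Proof.
move=> lam01 ah ag _ _ hgk dil r /andP[r0 r1] A I L1 U1 L2 U2 L3 U3.
have h_diff z : disk 1 z -> cdiff h z (cderiv h z) by move=> /ah; exact: derivable_cdiff.
have g_diff z : disk 1 z -> cdiff g z (cderiv g z) by move=> /ag; exact: derivable_cdiff.
have up K := fimg_upper (K := K) lam01 h_diff g_diff hgk dil r0 r1.
have low K := fimg_lower_radial (K := K) lam01 h_diff g_diff hgk dil r0 r1.
have m1 (u : R) : u <= r -> 0 < 1 - u by move=> ur; lra.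
have p1 (u : R) : 0 <= u -> 0 < 1 + u by move=> u0; lra.
have lp (u : R) : 0 <= u -> u <= r -> 0 < (1 + lam * u) ^+ 2.
  move=> u0 ur; have /andP[] := lam_u lam01 u0 (le_lt_trans ur r1).
  by move=> ? ?; rewrite exprn_gt0 //; lra.
have lm (u : R) : 0 <= u -> u <= r -> 0 < (1 - lam * u) ^+ 2.
  move=> u0 ur; have /andP[] := lam_u lam01 u0 (le_lt_trans ur r1).
  by move=> ? ?; rewrite exprn_gt0 //; lra.
have sX (u : R) := sloped_num lam u.
have sLp u : sloped (fun rho : R => (1 + lam * rho) ^+ 2) u by apply: slopedX; exact: sloped_plus.
have sLm u : sloped (fun rho : R => (1 - lam * rho) ^+ 2) u by apply: slopedX; exact: sloped_minus.
have sp (u e : R) : 0 <= u -> sloped (fun rho : R => (1 + rho) `^ e) u.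
  by move=> u0; apply: sloped_powR; [exact: p1|exact: sloped_plus1].
have sm (u e : R) : u <= r -> sloped (fun rho : R => (1 - rho) `^ e) u.
  by move=> ur; apply: sloped_powR; [exact: m1|exact: sloped_minus1].
have div (X Y : R -> R) u : sloped X u -> sloped Y u -> 0 < Y u ->
    {for u, continuous (fun rho => X rho / Y rho)}.
  move=> hX hY Y0; apply: sloped_continuous; apply: slopedM => //.
  by apply: slopedV => //; rewrite gt_eqF.
have pw0 (x e : R) : 0 < x -> 0 < x `^ e by exact: powR_gt0.
split; [move=> a1|split; [move=> /andP[a1 a2]|move=> a1]]; apply/andP; split.
- apply: low.
  + move=> u u0 ur; apply: div; [apply: slopedM => //; exact: sm|apply: slopedM => //; exact: sp|].
    by rewrite mulr_gt0 ?lp ?pw0 ?p1.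
  + move=> u x y u0 ur xy; have u1 := le_lt_trans ur r1.
    have /andP[b1 _] := powR_sq_ge0 u0 u1 (plus_sq_bounds u0 xy) (e := a - 1) ltac:(lra).
    have /andP[b2 _] := powR_sq_le0 u0 u1 (minus_sq_bounds u0 xy) (e := - (a + 1)) ltac:(lra).
    apply: le_trans (weight_lower lam01 u0 u1 xy _ _ b1 b2); rewrite ?powR_ge0 //.
    by rewrite le_eqVlt; apply/orP; left; apply/eqP; rewrite /L1 powR_opp (invfM _ (_ `^ _)); ring.
  + move=> a2 u u0 ur; have u1 := le_lt_trans ur r1.
    rewrite /L1 /tail_weight ger0_norm; last by lra.
    by apply: tail_le => //; [exact: powR_ge0|apply: pw0; exact: p1].
- apply: up.
  + move=> u u0 ur; apply: div; [apply: slopedM => //; exact: sp|apply: slopedM => //; exact: sm|].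
    by rewrite mulr_gt0 ?lm ?pw0 ?m1.
  + move=> u x y u0 ur xy; have u1 := le_lt_trans ur r1.
    have /andP[_ b1] := powR_sq_ge0 u0 u1 (plus_sq_bounds u0 xy) (e := a - 1) ltac:(lra).
    have /andP[_ b2] := powR_sq_le0 u0 u1 (minus_sq_bounds u0 xy) (e := - (a + 1)) ltac:(lra).
    apply: le_trans (weight_upper lam01 u0 u1 xy b1 b2) _.
    by rewrite le_eqVlt; apply/orP; left; apply/eqP; rewrite /U1 powR_opp (invfM _ (_ `^ _)); ring.
- apply: low.
  + move=> u u0 ur; apply: div => //; [apply: slopedM => //; apply: slopedX; exact: sloped_plus1|].
    by rewrite mulr_gt0 ?lp ?exprn_gt0 ?p1.
  + move=> u x y u0 ur xy; have u1 := le_lt_trans ur r1.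
    have /andP[b1 _] := powR_sq_le0 u0 u1 (plus_sq_bounds u0 xy) (e := a - 1) ltac:(lra).
    have /andP[b2 _] := powR_sq_le0 u0 u1 (minus_sq_bounds u0 xy) (e := - (a + 1)) ltac:(lra).
    apply: le_trans (weight_lower lam01 u0 u1 xy _ _ b1 b2); rewrite ?powR_ge0 //.
    by rewrite powR_mid ?p1 // le_eqVlt; apply/orP; left; apply/eqP; rewrite /L2 (invfM _ (_ ^+ 4)); ring.
  (* Here [|a| <= 1], so the comparison with the tail is vacuous. *)
  + by move=> a3; exfalso; move: a3; apply/negP; rewrite -leNgt ler_norml; apply/andP; split; lra.
- apply: up.
  + move=> u u0 ur; apply: div => //; [apply: slopedM => //; apply: slopedX; exact: sloped_minus1|].
    by rewrite mulr_gt0 ?lm ?exprn_gt0 ?m1.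
  + move=> u x y u0 ur xy; have u1 := le_lt_trans ur r1.
    have /andP[_ b1] := powR_sq_le0 u0 u1 (plus_sq_bounds u0 xy) (e := a - 1) ltac:(lra).
    have /andP[_ b2] := powR_sq_le0 u0 u1 (minus_sq_bounds u0 xy) (e := - (a + 1)) ltac:(lra).
    apply: le_trans (weight_upper lam01 u0 u1 xy b1 b2) _.
    by rewrite powR_mid ?m1 // le_eqVlt; apply/orP; left; apply/eqP; rewrite /U2 (invfM _ (_ ^+ 4)); ring.
- apply: low.
  + move=> u u0 ur; apply: div; [apply: slopedM => //; exact: sp|apply: slopedM => //; exact: sm|].
    by rewrite mulr_gt0 ?lp ?pw0 ?m1.
  + move=> u x y u0 ur xy; have u1 := le_lt_trans ur r1.
    have /andP[b1 _] := powR_sq_le0 u0 u1 (plus_sq_bounds u0 xy) (e := a - 1) ltac:(lra).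
    have /andP[b2 _] := powR_sq_ge0 u0 u1 (minus_sq_bounds u0 xy) (e := - (a + 1)) ltac:(lra).
    apply: le_trans (weight_lower lam01 u0 u1 xy _ _ b1 b2); rewrite ?powR_ge0 //.
    by rewrite le_eqVlt; apply/orP; left; apply/eqP; rewrite /L3 powR_opp (invfM _ (_ `^ _)); ring.
  + move=> a2 u u0 ur; have u1 := le_lt_trans ur r1.
    rewrite /L3 /tail_weight ler0_norm; last by lra.
    (* With [|a| = - a] the two exponents of [tail_weight] become [- 2 (a + 1)] and [- 2 (a - 1)],
       so numerator and denominator change places. *)
    rewrite (_ : 2 * (- a - 1) = - (2 * (a + 1))); last by ring.
    rewrite (_ : 2 * (- a + 1) = - (2 * (a - 1))); last by ring.
    rewrite !powRN invrK [X in u * X]mulrC.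
    by apply: tail_le => //; [exact: powR_ge0|apply: pw0; exact: m1].
- apply: up.
  + move=> u u0 ur; apply: div; [apply: slopedM => //; exact: sm|apply: slopedM => //; exact: sp|].
    by rewrite mulr_gt0 ?lm ?pw0 ?p1.
  + move=> u x y u0 ur xy; have u1 := le_lt_trans ur r1.
    have /andP[_ b1] := powR_sq_le0 u0 u1 (plus_sq_bounds u0 xy) (e := a - 1) ltac:(lra).
    have /andP[_ b2] := powR_sq_ge0 u0 u1 (minus_sq_bounds u0 xy) (e := - (a + 1)) ltac:(lra).
    apply: le_trans (weight_upper lam01 u0 u1 xy b1 b2) _.
    by rewrite le_eqVlt; apply/orP; left; apply/eqP; rewrite /U3 powR_opp (invfM _ (_ `^ _)); ring.
Qed.
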